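(* The stochastic Benjamin-Bona-Mahony equation $$\begin{cases}\partial_t u-\partial_{txx}u+\partial_x u+\partial_x(u^2)=\partial_x\zeta\\ u|_{t=0}=0\end{cases}\qquad (t,x)\in\mathbb{R}_+\times\mathbb{T},$$ forced by the derivative of the spatial white noise $\zeta$, is almost surely globally well-posed. More precisely, let $\varepsilon>0$ be sufficiently small. Then there exists a set $\Sigma\subset\Omega$ with $\mathbb{P}(\Sigma)=1$ such that for every $\omega\in\Sigma$ there exists a unique global-in-time solution $u=u^\omega\in C(\mathbb{R}_+;H^{\frac12-\varepsilon}(\mathbb{T}))$ of the form $u=Z+v$, where $$Z(t)=-\int_0^tS(t-t')\,\varphi(D)\zeta\,dt'\ \in\ C(\mathbb{R}_+;W^{\frac12-\varepsilon,\infty}(\mathbb{T}))$$ and $v$ is the unique solution in the class $C(\mathbb{R}_+;H^1(\mathbb{T}))$ to $$\begin{cases}\partial_t v=\varphi(D)v+\varphi(D)\big((v+Z)^2\big)\\ v|_{t=0}=0.\end{cases}$$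
   Context: $\mathbb{T}=\mathbb{R}/(2\pi\mathbb{Z})$ carries the normalized Lebesgue measure $(2\pi)^{-1}dx$; $e_n(x)=e^{inx}$; $\langle n\rangle=\sqrt{1+n^2}$; $\mathbb{R}_+=[0,\infty)$. All function spaces consist of real-valued functions. $\|f\|_{H^s}=\|\langle n\rangle^s\widehat f(n)\|_{\ell^2_n}$; $W^{s,\infty}(\mathbb{T})$ is the completion of $C^\infty(\mathbb{T})$ under $\|\mathcal{F}^{-1}(\langle n\rangle^s\widehat f(n))\|_{L^\infty}$. $\varphi(D)=-(1-\partial_x^2)^{-1}\partial_x$ is the Fourier multiplier with symbol $\varphi(n)=\frac{-in}{1+n^2}$, and $S(t)=e^{t\varphi(D)}$. Solutions are understood in the Duhamel (mild) sense. $\zeta=\sum_{n\in\mathbb{Z}}\mathfrak{g}_ne_n$ is a spatial white noise, where $\{\mathfrak{g}_n\}_{n\in\mathbb{Z}}$ are independent standard complex Gaussian random variables on the underlying probability space $(\Omega,\mathscr{F},\mathbb{P})$ with $\mathbb{E}|\mathfrak{g}_n|^2=1$, conditioned so that $\mathfrak{g}_{-n}=\overline{\mathfrak{g}_n}$. *)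

(* Defs.v *)
From HB Require Import structures.
From mathcomp Require Import all_boot all_order all_algebra.
From mathcomp Require Import finmap.
From mathcomp Require Export complex.
From mathcomp Require Export all_classical all_reals all_analysis.

Set Implicit Arguments.
Unset Strict Implicit.
Unset Printing Implicit Defensive.

Import Order.TTheory GRing.Theory Num.Theory.
Import numFieldNormedType.Exports.

Local Open Scope classical_set_scope.
Local Open Scope ring_scope.

Section Fourier.
Context {R : realType}.

Local Notation mu := (@lebesgue_measure R).

Definition cexp (z : R[i]) : R[i] :=
  Complex (expR (complex.Re z) * cos (complex.Im z))
          (expR (complex.Re z) * sin (complex.Im z)).

Definition Cintegral (D : set R) (f : R -> R[i]) : R[i] :=
  Complex (\int[mu]_(x in D) complex.Re (f x))
          (\int[mu]_(x in D) complex.Im (f x)).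

(* Real functions on the torus R/(2 pi Z) are 2 pi-periodic functions on R,
   identified when they agree Lebesgue-almost everywhere. *)
Definition ae_equal (f g : R -> R) : Prop := {ae mu, forall x, f x = g x}.

Definition torus_L1 : set (R -> R) :=
  [set f : R -> R | [/\ periodic f (pi *+ 2), measurable_fun setT f &
               mu.-integrable `[0, pi *+ 2] (EFin \o f)]].

Definition torus_smooth : set (R -> R) :=
  [set f : R -> R | periodic f (pi *+ 2) /\
           forall (k : nat) (x : R), derivable (derive1n k f) x 1].

(* A periodic distribution, or more generally a formal trigonometric series
   \sum_n c_n e_n, is represented by its Fourier coefficients. *)
Definition fseries : Type := int -> R[i].

Definition e_ (n : int) (x : R) : R[i] := cexp (Complex 0 (n%:~R * x)).

Definition fourier (f : R -> R) : fseries := fun n =>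
  (((pi *+ 2)^-1)%:C * Cintegral `[0, pi *+ 2] (fun x => (f x)%:C * e_ (- n) x))%C.

Definition japanese (n : int) : R := Num.sqrt (1 + n%:~R ^+ 2).

Definition multiplier (m : int -> R[i]) (c : fseries) : fseries :=
  fun n => m n * c n.

Definition bessel (s : R) : fseries -> fseries :=
  multiplier (fun n => (japanese n `^ s)%:C%C).

(* - i n / (1 + n^2) *)
Definition phi (n : int) : R[i] :=
  Complex 0 (- n%:~R / (1 + n%:~R ^+ 2)).

Definition phiD : fseries -> fseries := multiplier phi.

Definition semigroup (t : R) : fseries -> fseries :=
  multiplier (fun n => cexp (t%:C%C * phi n)).

Definition Hnorm (s : R) (f : R -> R) : \bar R :=
  ((\esum_(n in [set: int])
      (Normc.normc (bessel s (fourier f) n) ^+ 2)%:E) `^ 2^-1)%E.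

(* Used for s >= 0 only, where every element of H^s is an L^1 function. *)
Definition Hspace (s : R) : set (R -> R) :=
  [set f | torus_L1 f /\ (Hnorm s f < +oo)%E].

(* For periodic w the essential supremum over R is the one over the torus.
   At most one w (up to a.e. equality) has the prescribed Fourier coefficients;
   the norm is +oo if there is none. *)
Definition Wnorm (s : R) (f : R -> R) : \bar R :=
  ereal_inf [set ('N[mu]_+oo[EFin \o w])%E | w in
    [set w | torus_L1 w /\ fourier w = bessel s (fourier f)]].

(* The completion of the smooth functions under Wnorm s, realised (for s >= 0)
   inside L^1. *)
Definition Wspace (s : R) : set (R -> R) :=
  [set f | torus_L1 f /\ exists h : nat -> R -> R,
    (forall k, torus_smooth (h k)) /\
    Wnorm s (h k \- f) @[k --> \oo] --> 0%E].

(* C(R_+; X) for X normed by N. The path u is only relevant at times t >= 0. *)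
Definition continuous_path (X : set (R -> R)) (N : (R -> R) -> \bar R)
    (u : R -> R -> R) : Prop :=
  forall t : R, 0 <= t ->
    X (u t) /\ N (u t' \- u t) @[t' --> within `[0, +oo[ (nbhs t)] --> 0%E.

Definition C_H (s : R) := continuous_path (Hspace s) (Hnorm s).

Definition C_W (s : R) := continuous_path (Wspace s) (Wnorm s).

Definition path_equal (u w : R -> R -> R) : Prop :=
  forall t : R, 0 <= t -> ae_equal (u t) (w t).

(* S(t) w0 + \int_0^t S(t - t') N(t') dt', the integral being taken
   coefficientwise. *)
Definition duhamel (w0 : fseries) (N : R -> fseries) (t : R) : fseries :=
  fun n => semigroup t w0 n +
           Cintegral `[0, t] (fun t' => semigroup (t - t') (N t') n).

(* Mild solutions of \partial_t w = phi(D) w + N(t), w(0) = w0. *)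
Definition mild_solution (w0 : fseries) (N : R -> fseries) (w : R -> R -> R) :
    Prop :=
  forall t : R, 0 <= t -> fourier (w t) = duhamel w0 N t.

(* Applying (1 - \partial_x^2)^{-1} to the stochastic BBM equation gives
   \partial_t u = phi(D) u + phi(D) (u^2) - phi(D) zeta. *)
Definition solves_SBBM (zeta : fseries) (u : R -> R -> R) : Prop :=
  mild_solution (fun=> 0)
    (fun t n => phiD (fourier (fun x => u t x ^+ 2)) n - phiD zeta n) u.

Definition is_stochastic_convolution (zeta : fseries) (Z : R -> R -> R) : Prop :=
  forall t : R, 0 <= t -> forall n,
    fourier (Z t) n =
    - Cintegral `[0, t] (fun t' => semigroup (t - t') (phiD zeta) n).

Definition solves_remainder (Z v : R -> R -> R) : Prop :=
  mild_solution (fun=> 0)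
    (fun t => phiD (fourier (fun x => (v t x + Z t x) ^+ 2))) v.

End Fourier.

Arguments fseries : clear implicits.

Section WhiteNoise.
Context {R : realType} {d : measure_display} {Omega : measurableType d}.
Variable P : probability Omega R.

Definition mutually_independent {d' : measure_display} {T : measurableType d'}
    {I : choiceType} (X : I -> Omega -> T) : Prop :=
  forall (J : {fset I}) (A : I -> set T), (forall i, measurable (A i)) ->
    P (\bigcap_(i in [set` J]) (X i @^-1` A i)) =
    (\prod_(i <- J) P (X i @^-1` A i))%E.

Definition re_im (g : Omega -> R[i]) : Omega -> R * R :=
  fun w => (complex.Re (g w), complex.Im (g w)).

(* E|g|^2 = 1 : the real and imaginary parts are independent centred Gaussians
   of variance 1/2 (normal_prob takes the standard deviation). *)
Definition standard_complex_gaussian (g : Omega -> R[i]) : Prop :=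
  forall A : set (R * R), measurable A ->
    P (re_im g @^-1` A) =
    (normal_prob 0 (Num.sqrt 2^-1) \x normal_prob 0 (Num.sqrt 2^-1))%E A.

Definition standard_real_gaussian (g : Omega -> R) : Prop :=
  forall A : set R, measurable A -> P (g @^-1` A) = normal_prob 0 1 A.

(* The reality condition makes g 0 real, hence a standard real Gaussian, and
   leaves only the family (g n)_{n >= 0} independent. *)
Record white_noise_coefficients (g : int -> Omega -> R[i]) : Prop := {
  wnc_measurable : forall n, measurable_fun setT (re_im (g n));
  wnc_conj : forall (n : int) w, g (- n) w = conjc (g n w);
  wnc_law0 : standard_real_gaussian (fun w => complex.Re (g 0 w));
  wnc_law : forall n : int, n != 0 -> standard_complex_gaussian (g n);
  wnc_independent : mutually_independent (fun n : nat => re_im (g n%:Z)) }.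

Definition white_noise (g : int -> Omega -> R[i]) (w : Omega) : fseries R :=
  fun n => g n w.

End WhiteNoise.

(* Main.v *)
From HB Require Import structures.
Require Import Defs.
From mathcomp Require Import all_boot all_order all_algebra.
From mathcomp Require Import finmap.
From mathcomp Require Import all_classical all_reals all_analysis.
From mathcomp Require Import measurable_realfun ess_sup_inf.
From mathcomp Require Import ring lra.
Import Order.TTheory GRing.Theory Num.Theory.
Import numFieldNormedType.Exports.
Set Implicit Arguments.
Unset Strict Implicit.
Unset Printing Implicit Defensive.
Local Open Scope classical_set_scope.
Local Open Scope ring_scope.

(* The noise. Integrating in time, Z(t) = (1 - S(t)) zeta, where
   1 - e^(t phi(n)) = - t phi(n) + O(t^2 phi(n)^2). On the frequencies
   2^k <= |n| < 2^(k+1) the Gaussian field <D>^sigma phi(D) zeta has variance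
   O(2^(- 2 eps k)) if sigma <= 1/2 - eps. Exponential moments at 32^k grid points,
   and a crude Lipschitz bound between them, bound the sup norms of these blocks
   almost surely by a summable sequence. With sigma = 0 and sigma = 1/2 - eps, this
   makes Z and <D>^(1/2 - eps) Z uniformly convergent series, continuous in (t, x).

   The remainder. phi(D) is the convolution with a bounded kernel, so v = phi(D) n
   where n' = v + (v + Z)^2 is an ODE in the space of continuous functions, locally
   Lipschitz. It is global because v + v^2 integrates to zero against v_x, so that
   the energy \int v^2 + v_x^2, which controls sup |v|, grows at most exponentially.

   Uniqueness. A path in C(R_+; H^1) has a jointly continuous representative, by the
   Sobolev embedding and the injectivity of the Fourier transform on L^1; if it is a
   mild solution it solves the ODE above, and Gronwall's lemma applies. Since
   u = Z + v solves the full equation if and only if v solves that of the remainder,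
   the statements on u follow. *)

(** * Integrals of continuous functions *)

(** The operator phi(D) maps continuous functions to C^1 functions, so n only has to be continuous
    while v = phi(D) n is differentiable in x: the energy computation is classical, without
    regularization. The obstacle is global existence, the square being only locally Lipschitz.
    Instead of continuing local solutions, the square is truncated at a level Mb(t) fixed in
    advance. Picard iteration then converges at all times at once, and the energy estimate survives
    because the square of the truncated v is still a function of v. It yields |v| <= Mb(t), so the
    truncation is never active. On the random side, summing |g_n| over a block would lose the
    cancellation between its 2^k independent modes, which is what makes the block small at sigma =
    1/2 - eps. Cancellation is used only in the term of Z linear in t: the remainder carries a
    further factor |phi(n)| <= 2^(-k), so absolute values suffice there. No supremum over x is
    integrated: the exponentials at all grid points form one nonnegative random variable per block,
    of expectation O(2^(-k)). *)

Section ContinuousIntegrals.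
Context {R : realType}.
Local Notation mu := (@lebesgue_measure R).
Implicit Types (a b c x : R) (f g F : R -> R).

Lemma continuous_integrable f a b :
  continuous f -> mu.-integrable `[a, b] (EFin \o f).
Proof.
move=> cf; apply: continuous_compact_integrable; first exact: segment_compact.
exact: continuous_subspaceT.
Qed.

Lemma Rintegral_itv_le f g a b : continuous f -> continuous g ->
  (forall x, a <= x <= b -> f x <= g x) ->
  \int[mu]_(x in `[a, b]) f x <= \int[mu]_(x in `[a, b]) g x.
Proof.
by move=> cf cg fg; apply: le_Rintegral => //; exact: continuous_integrable.
Qed.

Lemma Rintegral_itv_cst a b r : a <= b ->
  \int[mu]_(x in `[a, b]) r = r * (b - a).
Proof.
move=> ab; rewrite Rintegral_cst//= lebesgue_measure_itv/=.
by case: ifPn => //; rewrite lte_fin -leNgt => ba; rewrite (@le_anti _ _ a b) ?ab// subrr.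
Qed.

Lemma Rintegral_itv_norm_le f a b r : a <= b -> continuous f ->
  (forall x, a <= x <= b -> `|f x| <= r) ->
  `|\int[mu]_(x in `[a, b]) f x| <= r * (b - a).
Proof.
move=> ab cf fr; apply: le_trans (le_normr_Rintegral _ _) _ => //.
  exact: continuous_integrable.
rewrite -Rintegral_itv_cst//; apply: Rintegral_itv_le => //.
- by move=> x; apply: cvg_norm; exact: cf.
- exact: cst_continuous.
Qed.

Lemma Rintegral_itv_gt f a b : b <= a -> \int[mu]_(x in `[a, b]) f x = 0.
Proof.
rewrite le_eqVlt => /predU1P[->|ab]; first by rewrite set_itv1 Rintegral_set1.
by rewrite set_itv_ge ?Rintegral_set0// -leNgt bnd_simp.
Qed.

Lemma Rintegral_itv_FTC2 F f a b : a <= b -> continuous f ->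
  (forall x, is_derive x 1 F (f x)) ->
  \int[mu]_(x in `[a, b]) f x = F b - F a.
Proof.
move=> ab cf dF; move: ab; rewrite le_eqVlt => /predU1P[->|ab].
  by rewrite Rintegral_itv_gt// subrr.
have cF : continuous F.
  by move=> x; apply/differentiable_continuous/derivable1_diffP; apply: ex_derive.
rewrite /Rintegral (@continuous_FTC2 _ f F)//.
- exact: continuous_subspaceT.
- by split=> //; [apply: cvg_at_right_filter|apply: cvg_at_left_filter]; exact: cF.
- by move=> x _; rewrite derive1E derive_val.
Qed.

Lemma cRintegralD f g a b : continuous f -> continuous g ->
  \int[mu]_(x in `[a, b]) (f x + g x) =
  \int[mu]_(x in `[a, b]) f x + \int[mu]_(x in `[a, b]) g x.
Proof. by move=> cf cg; rewrite RintegralD//; exact: continuous_integrable. Qed.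

Lemma cRintegralB f g a b : continuous f -> continuous g ->
  \int[mu]_(x in `[a, b]) (f x - g x) =
  \int[mu]_(x in `[a, b]) f x - \int[mu]_(x in `[a, b]) g x.
Proof. by move=> cf cg; rewrite RintegralB//; exact: continuous_integrable. Qed.

Lemma cRintegralZ f a b r : continuous f ->
  \int[mu]_(x in `[a, b]) (r * f x) = r * \int[mu]_(x in `[a, b]) f x.
Proof. by move=> cf; rewrite RintegralZl//; exact: continuous_integrable. Qed.

Lemma Rintegral_itv_split f a b c : continuous f -> a <= b -> b <= c ->
  \int[mu]_(x in `[a, c]) f x =
  \int[mu]_(x in `[a, b]) f x + \int[mu]_(x in `[b, c]) f x.
Proof.
move=> cf ab bc; apply/eqP; rewrite addrC -subr_eq; apply/eqP.
rewrite Rintegral_itvB ?bnd_simp//; last exact: continuous_integrable.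
rewrite Rintegral_itv_obnd_cbnd//.
apply: integrableS (continuous_integrable b c cf) => //.
exact: subset_itv_oc_cc.
Qed.

(* The oriented integral from 0 to x: an antiderivative on the whole line. *)
Definition primitive f x : R :=
  \int[mu]_(y in `[0, x]) f y - \int[mu]_(y in `[x, 0]) f y.

Lemma primitiveB f a b : continuous f -> a <= b ->
  primitive f b - primitive f a = \int[mu]_(x in `[a, b]) f x.
Proof.
move=> cf ab; rewrite /primitive.
have [a0|a0] := leP 0 a.
  rewrite (Rintegral_itv_gt _ a0) (Rintegral_itv_gt _ (le_trans a0 ab)).
  by rewrite (Rintegral_itv_split cf a0 ab); ring.
have [b0|b0] := leP 0 b.
  rewrite (Rintegral_itv_gt _ (ltW a0)) (Rintegral_itv_gt _ b0).
  by rewrite (Rintegral_itv_split cf (ltW a0) b0); ring.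
rewrite (Rintegral_itv_gt _ (ltW a0)) (Rintegral_itv_gt _ (ltW b0)).
by rewrite (Rintegral_itv_split cf ab (ltW b0)); ring.
Qed.

Lemma primitive0 f : primitive f 0 = 0.
Proof. by rewrite /primitive Rintegral_itv_gt// subr0. Qed.

Lemma is_derive_primitive f x : continuous f -> is_derive x 1 (primitive f) (f x).
Proof.
move=> cf; have := @continuous_FTC1_closed R f (x - 1) x (x + 1).
have x1 : x < x + 1 by rewrite ltrDl.
have x2 : x - 1 < x by rewrite gtrBl.
move=> /(_ x1 (continuous_integrable _ _ cf) x2 (cf x)) [dF F'].
set F := (fun _ => _) in dF F'.
(* The integral from the fixed endpoint x - 1 is differentiable at x; near x, [primitive f] is that
   integral plus the constant [primitive f (x - 1)]. *)
have dP : is_derive x 1 (F + cst (primitive f (x - 1))) (f x).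
  have := @is_deriveD _ _ _ F (cst (primitive f (x - 1))) x 1 (f x) 0.
  rewrite addr0; apply.
  by apply: DeriveDef; [exact: dF|rewrite -derive1E; exact: F'].
apply: near_eq_is_derive dP => //.
near=> y; rewrite /F /= !fctE -primitiveB//; first by rewrite subrK.
by near: y; exact: lt_le_nbhsr.
Unshelve. all: by end_near. Qed.

Lemma continuous_sum (T : topologicalType) (I : Type) (r : seq I) (P : pred I)
    (h : I -> T -> R) : (forall i, continuous (h i)) ->
  continuous (fun x : T => \sum_(i <- r | P i) h i x).
Proof.
move=> ch; elim: r => [|i r IHr].
  by under eq_fun do rewrite big_nil; exact: cst_continuous.
under eq_fun do rewrite big_cons.
by case: (P i) => // x; apply: cvgD; [exact: ch|exact: IHr].
Qed.

Lemma Rintegral_itv_sum (I : Type) (r : seq I) (f : I -> R -> R) a b :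
  (forall i, continuous (f i)) ->
  \int[mu]_(x in `[a, b]) (\sum_(i <- r) f i x) =
  \sum_(i <- r) \int[mu]_(x in `[a, b]) f i x.
Proof.
move=> cf; elim: r => [|i r IHr].
  under eq_Rintegral do rewrite big_nil.
  by rewrite big_nil Rintegral_cst// mul0r.
under eq_Rintegral do rewrite big_cons.
rewrite big_cons cRintegralD ?IHr// => x.
exact: continuous_sum.
Qed.

End ContinuousIntegrals.

(** * Integrals depending on a parameter *)

Section JointContinuity.
Context {R : realType}.
Local Notation mu := (@lebesgue_measure R).

Lemma jcont_comp (S T U V : topologicalType) (f : T -> U -> V)
    (g : S -> T) (h : S -> U) : continuous (fun p : T * U => f p.1 p.2) ->
  continuous g -> continuous h -> continuous (fun s : S => f (g s) (h s)).
Proof.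
move=> cf cg ch s.
apply: (@cvg_comp _ _ _ (fun s : S => (g s, h s)) (fun p : T * U => f p.1 p.2)
  _ (nbhs (g s, h s))); last exact: (cf (g s, h s)).
by apply: cvg_pair; [exact: cg|exact: ch].
Qed.

Section ParameterIntegrals.
Context {T : topologicalType}.
Implicit Types (f : T -> R -> R) (a b c d e : R).

Lemma jcont_section f t : continuous (fun p : T * R => f p.1 p.2) ->
  continuous (f t).
Proof.
move=> cf; apply: (jcont_comp (f := f)) => //; first exact: cst_continuous.
by move=> ?; exact: cvg_id.
Qed.


(** Tube lemma: compactness of [a, b] turns the neighbourhoods given by joint continuity at each (t,
    x) into a single neighbourhood of t. *)
Lemma jcont_uniform_near f (t : T) a b e :
  continuous (fun p : T * R => f p.1 p.2) -> 0 < e ->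
  \forall t' \near t, forall x, a <= x <= b -> `|f t' x - f t x| <= e.
Proof.
move=> cf e0.
have := (iffLR (compact_near_coveringP _)) (@segment_compact R a b) _ (nbhs t)
  (fun t' x => `|f t' x - f t x| <= e) _.
have H x : x \in `[a, b] ->
    \forall x' \near x & i \near nbhs t, `|f i x' - f t x'| <= e.
  move=> _.
  have /cvgrPdist_le/(_ (e / 2)) := cf (t, x).
  rewrite divr_gt0// => /(_ isT) [[U V] /= [Ut Vx] UV].
  exists (V, U) => // -[x' i] /= [Vx' Ui].
  have /= h1 := UV (i, x') (conj Ui Vx').
  have /= h2 := UV (t, x') (conj (nbhs_singleton Ut) Vx').
  have -> : f i x' - f t x' = (f t x - f t x') - (f t x - f i x') by ring.
  rewrite (splitr e); apply: le_trans (ler_normB _ _) _.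
  exact: lerD.
move=> /(_ _ H); apply: filterS => t' ht' x xab; apply: ht' => /=.
by rewrite in_itv.
Qed.

Lemma jcont_integral f a b : continuous (fun p : T * R => f p.1 p.2) ->
  continuous (fun t => \int[mu]_(x in `[a, b]) f t x).
Proof.
move=> cf t; have cs := fun t => jcont_section (t := t) cf.
have [ba|ab] := leP b a.
  by under eq_fun do rewrite Rintegral_itv_gt//; exact: cvg_cst.
have ba0 : 0 < b - a by rewrite subr_gt0.
apply/cvgrPdist_le => e e0.
have := jcont_uniform_near t a b cf (divr_gt0 e0 ba0); apply: filterS => t' ht'.
rewrite -cRintegralB// -[leRHS](@divfK _ (b - a)) ?gt_eqF//.
apply: Rintegral_itv_norm_le; first exact: ltW.
  by move=> x; apply: cvgB; exact: cs.
by move=> x xab; rewrite distrC; exact: ht'.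
Qed.

(** The integral over [0, x] is 0 for x < 0, hence the primitive composed with x -> max(0, x); this
    gives its continuity on the whole line. *)
Lemma Rintegral_primitive (g : R -> R) x :
  \int[mu]_(y in `[0, x]) g y = primitive g (Num.max 0 x).
Proof.
rewrite /primitive; have [x0|x0] := leP 0 x.
  by rewrite (Rintegral_itv_gt _ x0) subr0.
by rewrite (Rintegral_itv_gt _ (ltW x0)) subrr.
Qed.

Lemma continuous_primitive (g : R -> R) : continuous g -> continuous (primitive g).
Proof.
move=> cg x; apply/differentiable_continuous/derivable1_diffP.
exact: (@ex_derive _ _ _ _ _ _ _ (is_derive_primitive x cg)).
Qed.

Lemma jcont_integral_upto f : continuous (fun p : T * R => f p.1 p.2) ->
  continuous (fun p : T * R => \int[mu]_(y in `[0, p.2]) f p.1 y).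
Proof.
move=> cf [t x] /=; have cs := fun t => jcont_section (t := t) cf.
apply/cvgrPdist_le => e e0 /=.
(* All endpoints near x lie below B, so closeness of the integrands on the one segment [0, B] serves
   them all; the change of endpoint is treated at fixed t. *)
pose B := `|x| + 1.
have B0 : 0 < B by rewrite /B ltr_pwDr.
have cI : {for x, continuous (fun z : R => \int[mu]_(y in `[0, z]) f t y)}.
  have -> : (fun z : R => \int[mu]_(y in `[0, z]) f t y) =
      (fun z => primitive (f t) (Num.max 0 z)).
    by apply/funext => z; exact: Rintegral_primitive.
  apply: (@continuous_comp _ _ _ (fun x : R => Num.max 0 x)).
    by apply: continuous_max; [exact: cvg_cst|exact: cvg_id].
  exact: continuous_primitive.
have e2 : 0 < e / 2 by rewrite divr_gt0.
move/cvgrPdist_le/(_ _ e2) : cI => cI.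
have eB : 0 < e / 2 / B by rewrite divr_gt0.
have ct := jcont_uniform_near t 0 B cf eB.
have nB : \forall x' \near x, x' <= B.
  by near=> x'; near: x'; apply: lt_le_nbhsl; rewrite /B ltr_pwDr// ler_norm.
exists ([set t' | forall y, 0 <= y <= B -> `|f t' y - f t y| <= e / 2 / B],
  [set x' | x' <= B /\ `|\int[mu]_(y in `[0, x]) f t y - \int[mu]_(y in `[0, x']) f t y| <= e / 2]).
  by split => //=; exact: filterI.
move=> [t' x'] /= [ht [x'B hx]].
set I := (X in `|_ - X| <= _) in hx.
rewrite -(subrKA I) (splitr e); apply: le_trans (ler_normD _ _) _; apply: lerD => //.
rewrite /I -cRintegralB//; have [x0|x0] := leP 0 x'; last first.
  by rewrite (Rintegral_itv_gt _ (ltW x0)) normr0 ltW.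
apply: (@le_trans _ _ (e / 2 / B * (x' - 0))).
  apply: Rintegral_itv_norm_le => //; first by move=> y; apply: cvgB; exact: cs.
  move=> y /andP[y0 yx]; rewrite distrC; apply: ht.
  by rewrite y0 (le_trans yx).
by rewrite subr0 -[leRHS](@divfK _ B) ?gt_eqF// ler_wpM2l// ltW.
Unshelve. all: by end_near. Qed.

End ParameterIntegrals.

Lemma jcont_swap (f : R -> R -> R) : continuous (fun p : R * R => f p.1 p.2) ->
  continuous (fun p : R * R => f p.2 p.1).
Proof.
move=> cf; apply: (jcont_comp (f := f)) => // p; [exact: cvg_snd|exact: cvg_fst].
Qed.

Lemma jcont_primitive (f : R -> R -> R) : continuous (fun p : R * R => f p.1 p.2) ->
  forall s, continuous (fun x => primitive (f ^~ x) s).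
Proof.
move=> /jcont_swap cf s x; rewrite /primitive; apply: cvgB.
  exact: (@jcont_integral _ (fun x s => f s x) 0 s cf x).
exact: (@jcont_integral _ (fun x s => f s x) s 0 cf x).
Qed.

(** Differentiation under the integral sign: for times within d of s the functions f differ by at
    most 1 on [a, b], so [|f s y| + 1] dominates. It is Fubini's theorem in differential form. *)
Lemma is_derive_Rintegral_primitive (f : R -> R -> R) (a b s : R) :
  continuous (fun p : R * R => f p.1 p.2) ->
  is_derive s 1 (fun s => \int[mu]_(x in `[a, b]) primitive (f ^~ x) s)
    (\int[mu]_(x in `[a, b]) f s x).
Proof.
move=> cf; have cs := fun t => jcont_section (t := t) cf.
have [d /= d0 hd] := jcont_uniform_near s a b cf ltr01.
pose P t x := primitive (f ^~ x) t.
have cs' (x : R) : continuous (f^~ x).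
  exact: (@jcont_section _ (fun x s => f s x) x (jcont_swap cf)).
have dP (t x : R) : is_derive t 1 (P^~ x) (f t x).
  exact: (is_derive_primitive t (cs' x)).
have dPE (t x : R) : partial1of2 P t x = f t x by rewrite partial1of2E derive_val.
have Is : [set` `](s - d), (s + d)[] s by rewrite /= in_itv/= ltrDl ltrBlDr ltrDl d0.
have ip x : [set` `](s - d), (s + d)[] x -> mu.-integrable `[a, b] (EFin \o P x).
  by move=> _; apply: continuous_integrable; exact: jcont_primitive.
have de x y : [set` `](s - d), (s + d)[] x -> [set` `[a, b]] y -> derivable (P ^~ y) x 1.
  by move=> _ _; exact: ex_derive.
have G0 y : 0 <= `|f s y| + 1 by rewrite addr_ge0.
have iG : mu.-integrable `[a, b] (EFin \o (fun y => `|f s y| + 1)).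
  apply: continuous_integrable => x; apply: cvgD; last exact: cvg_cst.
  by apply: cvg_norm; exact: cs.
have ub x y : [set` `](s - d), (s + d)[] x -> [set` `[a, b]] y -> `|partial1of2 P x y| <= `|f s y| + 1.
  rewrite /= !in_itv/= dPE => xs yab.
  have -> : f x y = f s y + (f x y - f s y) by rewrite addrC subrK.
  apply: le_trans (ler_normD _ _) _; rewrite lerD2l; apply: hd => //.
  by rewrite /= ltr_distlC.
apply: DeriveDef.
  exact: (@derivable_under_integral R _ _ mu P _ (measurable_itv _) s _ _
    Is ip de _ G0 iG ub).
rewrite -derive1E.
rewrite (@differentiation_under_integral R _ _ mu P _ (measurable_itv _) s _ _
  Is ip de _ G0 iG ub).
by apply: eq_Rintegral => y _; rewrite dPE.
Qed.

(** The fundamental theorem of calculus evaluates the left side, whose integrand is the derivative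
    of an x-integral of primitives. No product measure enters. *)
Lemma jcont_Fubini (f : R -> R -> R) (a b c d : R) : a <= b ->
  continuous (fun p : R * R => f p.1 p.2) ->
  \int[mu]_(s in `[a, b]) \int[mu]_(x in `[c, d]) f s x =
  \int[mu]_(x in `[c, d]) \int[mu]_(s in `[a, b]) f s x.
Proof.
move=> ab cf; rewrite (Rintegral_itv_FTC2 ab _ (fun s => is_derive_Rintegral_primitive c d s cf)).
  rewrite -cRintegralB; do ?exact: jcont_primitive.
  apply: eq_Rintegral => x _; apply: primitiveB => //.
  exact: (@jcont_section _ (fun x s => f s x) x (jcont_swap cf)).
exact: jcont_integral.
Qed.

End JointContinuity.

Lemma jcont_slice {R : realType} (F : R -> R -> R) x :
  continuous (fun p : R * R => F p.1 p.2) -> continuous (F ^~ x).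
Proof.
by move=> cF; exact: (@jcont_section _ _ (fun x s => F s x) x (jcont_swap cF)).
Qed.

Section RealDerivatives.
Context {R : realType}.
Implicit Types (f g : R -> R) (x a b : R).

Lemma derD f g x a b : is_derive x 1 f a -> is_derive x 1 g b ->
  is_derive x 1 (fun y => f y + g y) (a + b).
Proof. by move=> df dg; have := is_deriveD df dg. Qed.

Lemma derB f g x a b : is_derive x 1 f a -> is_derive x 1 g b ->
  is_derive x 1 (fun y => f y - g y) (a - b).
Proof. by move=> df dg; have := is_deriveB df dg. Qed.

Lemma derM f g x a b : is_derive x 1 f a -> is_derive x 1 g b ->
  is_derive x 1 (fun y => f y * g y) (f x * b + g x * a).
Proof. by move=> df dg; have := is_deriveM df dg. Qed.

Lemma derZ f x a b : is_derive x 1 f a -> is_derive x 1 (fun y => b * f y) (b * a).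
Proof. by move=> df; have := is_deriveZ b df. Qed.

Lemma derN f x a : is_derive x 1 f a -> is_derive x 1 (fun y => - f y) (- a).
Proof. by move=> df; have := is_deriveN df. Qed.

Lemma der_cst x b : is_derive x 1 (fun _ : R => b) 0.
Proof. exact: is_derive_cst. Qed.

Lemma der_comp f g x a b : is_derive (f x) 1 g b -> is_derive x 1 f a ->
  is_derive x 1 (fun y => g (f y)) (b * a).
Proof. by move=> dg df; have := is_derive1_comp dg df. Qed.

Lemma der_eq f x a b : is_derive x 1 f a -> a = b -> is_derive x 1 f b.
Proof. by move=> ? <-. Qed.

Lemma der_continuous f (f' : R -> R) : (forall x, is_derive x 1 f (f' x)) ->
  continuous f.
Proof.
by move=> df x; apply/differentiable_continuous/derivable1_diffP; apply: ex_derive.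
Qed.

Lemma der_sum (I : Type) (r : seq I) (P : pred I) (F : I -> R -> R) (D : I -> R) x :
  (forall i, is_derive x 1 (F i) (D i)) ->
  is_derive x 1 (fun y => \sum_(i <- r | P i) F i y) (\sum_(i <- r | P i) D i).
Proof.
move=> dF; elim: r => [|i r IHr].
  by rewrite big_nil; under eq_fun do rewrite big_nil; exact: der_cst.
rewrite big_cons; under eq_fun do rewrite big_cons.
by case: (P i) => //; exact: derD.
Qed.

End RealDerivatives.

(** * Periodic resolvents of the derivative *)

Section PeriodicResolvent.
Context {R : realType}.
Local Notation mu := (@lebesgue_measure R).
Local Notation tau := (pi *+ 2 : R).
Implicit Types (f g : R -> R) (x r c : R).

Lemma tau_gt0 : 0 < tau.
Proof. by rewrite pmulrn_lgt0// pi_gt0. Qed.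

Let tau_ge0 := ltW tau_gt0.

Lemma Rintegral_period_derive f (f' : R -> R) : periodic f tau ->
  continuous f' -> (forall x, is_derive x 1 f (f' x)) ->
  \int[mu]_(x in `[0, tau]) f' x = 0.
Proof.
move=> pf cf' df; rewrite (Rintegral_itv_FTC2 tau_ge0 cf' df).
by rewrite -[X in f X]add0r pf subrr.
Qed.

(* exp(-r) / (1 - exp(-2 pi)) = \sum_(k >= 0) exp(- (r + 2 pi k)): the
   2 pi-periodization of the kernel of (1 + d/dx)^{-1}. *)
Definition resolvent_kernel r : R := expR (- r) / (1 - expR (- tau)).

(** [resolventp] inverts 1 + d/dx on continuous 2 pi-periodic functions, and its mirror image
    [resolventm] inverts 1 - d/dx. *)
Definition resolventp f x : R :=
  \int[mu]_(r in `[0, tau]) (resolvent_kernel r * f (x - r)).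

Definition resolventm f x : R :=
  \int[mu]_(r in `[0, tau]) (resolvent_kernel r * f (x + r)).

Let den_gt0 : 0 < 1 - expR (- tau).
Proof. by rewrite subr_gt0 -expR0 ltr_expR oppr_lt0 tau_gt0. Qed.

Lemma resolvent_kernel_ge0 r : 0 <= resolvent_kernel r.
Proof. by rewrite divr_ge0 ?expR_ge0// ltW. Qed.

Lemma continuous_resolvent_kernel : continuous resolvent_kernel.
Proof.
move=> r; apply: cvgM; last exact: cvg_cst.
apply: (@continuous_comp _ _ _ (fun r : R => - r) expR); last exact: continuous_expR.
exact: opp_continuous.
Qed.

Lemma Rintegral_resolvent_kernel :
  \int[mu]_(r in `[0, tau]) resolvent_kernel r = 1.
Proof.
have d r : is_derive r 1 (fun r => - resolvent_kernel r) (resolvent_kernel r).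
  have d1 : is_derive r 1 (fun r : R => - r) (-1) by exact: derN.
  have := derN (derZ (1 - expR (- tau))^-1 (der_comp (is_derive_expR (- r)) d1)).
  rewrite /resolvent_kernel; under eq_fun do rewrite mulrC.
  by move=> h; apply: der_eq h _; rewrite mulrN1 mulrN opprK mulrC.
rewrite (Rintegral_itv_FTC2 tau_ge0 continuous_resolvent_kernel d).
by rewrite /resolvent_kernel oppr0 expR0; field; rewrite gt_eqF.
Qed.

Lemma continuous_shiftm f x : continuous f -> continuous (fun r => f (x - r)).
Proof.
move=> cf r; apply: (@continuous_comp _ _ _ (fun r : R => x - r) f); last exact: cf.
by apply: cvgB; [exact: cvg_cst|exact: cvg_id].
Qed.

Let cker_m f x : continuous f -> continuous (fun r => resolvent_kernel r * f (x - r)).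
Proof.
move=> cf r; apply: cvgM; first exact: continuous_resolvent_kernel.
exact: continuous_shiftm.
Qed.

Lemma resolventm_reflect f x :
  resolventm f x = resolventp (fun y => f (- y)) (- x).
Proof. by apply: eq_Rintegral => r _; rewrite opprB opprK addrC. Qed.

(** The kernel is nonnegative of total mass one, so the operator takes averages. *)
Lemma resolventp_norm_le f c : continuous f -> (forall x, `|f x| <= c) ->
  forall x, `|resolventp f x| <= c.
Proof.
move=> cf fc x; rewrite -[c]mulr1 -Rintegral_resolvent_kernel.
rewrite -cRintegralZ; last exact: continuous_resolvent_kernel.
apply: le_trans (le_normr_Rintegral _ _) _ => //.
  exact/continuous_integrable/cker_m.
apply: Rintegral_itv_le.
- by move=> r; apply: cvg_norm; exact: cker_m.
- by move=> r; apply: cvgM; [exact: cvg_cst|exact: continuous_resolvent_kernel].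
- move=> r _; rewrite normrM ger0_norm ?resolvent_kernel_ge0// mulrC.
  by rewrite ler_wpM2r// resolvent_kernel_ge0.
Qed.

Lemma resolventp_periodic f : periodic f tau -> periodic (resolventp f) tau.
Proof. by move=> pf x; apply: eq_Rintegral => r _; rewrite addrAC pf. Qed.

Lemma resolventpB f g x : continuous f -> continuous g ->
  resolventp (fun x => f x - g x) x = resolventp f x - resolventp g x.
Proof.
move=> cf cg; rewrite /resolventp -cRintegralB; do ?exact: cker_m.
by apply: eq_Rintegral => r _; rewrite mulrBr.
Qed.

Lemma jcont_resolventp (T : topologicalType) (f : T -> R -> R) :
  continuous (fun p : T * R => f p.1 p.2) ->
  continuous (fun p : T * R => resolventp (f p.1) p.2).
Proof.
move=> cf; apply: (@jcont_integral R _ (fun (p : T * R) r =>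
  resolvent_kernel r * f p.1 (p.2 - r))) => p.
apply: cvgM.
  apply: (@continuous_comp _ _ _ (fun p : (T * R) * R => p.2)); first exact: cvg_snd.
  exact: continuous_resolvent_kernel.
suff H : continuous (fun p : (T * R) * R => f p.1.1 (p.1.2 - p.2)) by exact: (H p).
apply: (jcont_comp (f := f)) => // q.
  apply: (@continuous_comp _ _ _ (fun p : (T * R) * R => p.1) fst); exact: cvg_fst.
apply: cvgB; last exact: cvg_snd.
apply: (@continuous_comp _ _ _ (fun p : (T * R) * R => p.1) snd); first exact: cvg_fst.
exact: cvg_snd.
Qed.

Lemma resolventp_Rintegral (F : R -> R -> R) t x : 0 <= t ->
  continuous (fun p : R * R => F p.1 p.2) ->
  resolventp (fun x => \int[mu]_(s in `[0, t]) F s x) x =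
  \int[mu]_(s in `[0, t]) resolventp (F s) x.
Proof.
move=> t0 cF; rewrite [RHS](@jcont_Fubini R (fun s r => resolvent_kernel r * F s (x - r)))//.
  apply: eq_Rintegral => r _; rewrite cRintegralZ//.
  exact: (@jcont_section _ _ (fun x s => F s x) (x - r) (jcont_swap cF)).
move=> p; apply: cvgM.
  apply: (@continuous_comp _ _ _ (@snd R R)); first exact: cvg_snd.
  exact: continuous_resolvent_kernel.
apply: (jcont_comp (f := F) cF) => q; first exact: cvg_fst.
by apply: cvgB; [exact: cvg_cst|exact: cvg_snd].
Qed.

(** The substitution z = y - r turns the integral into C e^(-y) (P(y) - P(y - tau)), with P a
    primitive of e^y f, which is differentiable although f is only continuous. The boundary terms
    combine to f(x) because f is periodic and C = 1 / (1 - e^(-tau)). *)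
Lemma is_derive_resolventp f x : continuous f -> periodic f tau ->
  is_derive x 1 (resolventp f) (f x - resolventp f x).
Proof.
move=> cf pf; pose g y := expR y * f y.
have cg : continuous g.
  by move=> y; apply: cvgM; [exact: continuous_expR|exact: cf].
pose P := primitive g; have dP (y : R) : is_derive y 1 P (g y) by exact: is_derive_primitive.
pose C := (1 - expR (- tau))^-1.
have E y : resolventp f y = C * (expR (- y) * (P y - P (y - tau))).
  have dQ r : is_derive r 1 (fun r => - P (y - r)) (g (y - r)).
    have d1 : is_derive r 1 (fun r : R => y - r) (0 - 1).
      exact: derB.
    have h := derN (@der_comp _ (fun r => y - r) P r _ _ (dP (y - r)) d1); apply: der_eq h _; by rewrite sub0r mulrN1 opprK.
  have := Rintegral_itv_FTC2 tau_ge0 (@continuous_shiftm g y cg) dQ.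
  rewrite subr0 opprK addrC => <-; rewrite -!cRintegralZ.
  - apply: eq_Rintegral => r _; rewrite /resolvent_kernel /g -/C.
    have -> : expR (- r) = expR (- y) * expR (y - r).
      by rewrite -expRD; congr expR; ring.
    by ring.
  - move=> r; apply: cvgM; first exact: cvg_cst.
    exact: continuous_shiftm.
  - exact: continuous_shiftm.
have -> : resolventp f = fun y => C * (expR (- y) * (P y - P (y - tau))).
  by apply/funext.
have dN : is_derive x 1 (fun r : R => - r) (-1) by exact: derN.
have ds : is_derive x 1 (fun r : R => r - tau) (1 - 0).
  exact: derB.
have h := derZ C (derM (der_comp (is_derive_expR (- x)) dN)
   (derB (dP x) (@der_comp _ (fun r => r - tau) P x _ _ (dP (x - tau)) ds))).
apply: der_eq h _; rewrite /g.
have -> : f (x - tau) = f x by rewrite -[in RHS](subrK tau x) pf.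
rewrite expRD; have := expRxMexpNx_1 x; set a := expR x; set b := expR (- x) => ab.
transitivity (C * (1 - expR (- tau)) * (a * b) * f x - C * (b * (P x - P (x - tau)))).
  by ring.
by rewrite ab /C mulVf ?gt_eqF// !mul1r.
Qed.

Lemma is_derive_resolventm f x : continuous f -> periodic f tau ->
  is_derive x 1 (resolventm f) (resolventm f x - f x).
Proof.
move=> cf pf.
have -> : resolventm f = fun x => resolventp (fun y => f (- y)) (- x).
  by apply/funext => y; exact: resolventm_reflect.
have dN : is_derive x 1 (fun r : R => - r) (-1) by exact: derN.
have := der_comp (@is_derive_resolventp (fun y => f (- y)) (- x) _ _) dN.
move=> h; apply: der_eq (h _ _) _.
- move=> y; apply: (@continuous_comp _ _ _ (fun r : R => - r) f); last exact: cf.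
  exact: opp_continuous.
- by move=> y; rewrite opprD -[in RHS](subrK tau (- y)) pf.
- by rewrite opprK mulrN1 opprB.
Qed.

End PeriodicResolvent.

(** * Uniqueness of Fourier coefficients *)

Section LebesgueTranslation.
Context {R : realType}.
Local Notation mu := (@lebesgue_measure R).

Lemma measurable_addr (c : R) : measurable_fun setT (fun x : R => x + c).
Proof. exact: measurable_funD. Qed.

(** The pushforward by a translation agrees with Lebesgue measure on half-open intervals, which
    determine it. *)
Lemma lebesgue_measure_preimage_addr (c : R) (A : set R) : measurable A ->
  mu ((fun x => x + c) @^-1` A) = mu A.
Proof.
move=> mA; symmetry.
have mc : @measurable_fun _ _ (measurableTypeR R) (measurableTypeR R) setT
  (fun x : R => x + c) by exact: measurable_addr.
pose f : {mfun measurableTypeR R >-> measurableTypeR R} := HB.pack (fun x : R => x + c)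
  (@isMeasurableFun.Build _ _ (measurableTypeR R) (measurableTypeR R) (fun x : R => x + c) mc).
have := @lebesgue_measure_unique R (pushforward mu f).
apply => // X [[a b] /= ab <-]; rewrite /pushforward.
have -> : (fun x => x + c) @^-1` `]a, b] = `](a - c), (b - c)]%classic.
  by apply/seteqP; split=> x /=; rewrite !in_itv/= ltrBlDr lerBrDr.
rewrite !lebesgue_measure_itv/= !lte_fin ltrD2r.
by case: ifPn => // _; rewrite -!EFinB; congr EFin; ring.
Qed.

Lemma periodicz (f : R -> R) (T : R) : periodic f T ->
  forall (k : int) x, f (x + k%:~R * T) = f x.
Proof.
move=> pf [n|n] x; first by rewrite -[_ * T]/(n%:R * T) mulr_natl periodicn.
by rewrite NegzE mulrNz mulNr -[in RHS](subrK (n.+1%:R * T) x) mulr_natl periodicn// -pmulrn mulr_natl.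
Qed.

(** The exceptional set is covered by the translates of the one inside a period, together with the
    lattice of period endpoints, which the hypothesis on the open interval leaves out. *)
Lemma ae_periodic_zero (f : R -> R) (T : R) : 0 < T -> periodic f T ->
  measurable_fun setT f ->
  {ae mu, forall x, x \in `]0, T[ -> f x = 0} -> {ae mu, forall x, f x = 0}.
Proof.
move=> T0 pf mf [N [mN N0 sN]].
pose NN k := (fun x : R => x + (k%:~R * T)) @^-1` N.
pose PP (k : int) : set R := [set k%:~R * T].
(* The union runs over natural numbers, each contributing the translates by n and by - n, so that
   all integers are reached. *)
suff : mu.-negligible (\bigcup_(n : nat) ((NN n `|` PP n) `|` (NN (- n%:Z) `|` PP (- n%:Z)))).
  apply: negligibleS.
  move=> x /= fx; pose k := Num.floor (x / T).
  have kx : k%:~R * T <= x < (k + 1)%:~R * T.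
    by rewrite -ler_pdivlMr// -ltr_pdivrMr// floor_le/= floorD1_gt.
  have hU : exists k, (NN k `|` PP k) x; last first.
    by case: hU => -[n|n] h; [exists n => //; left|exists n.+1 => //; right; rewrite -NegzE].
  have [xk|xk] := eqVneq x (k%:~R * T); first by exists k; right.
  exists (- k); left; apply: sN => /= H; apply: fx.
  rewrite -(periodicz pf (- k)); apply: H; rewrite in_itv/= rmorphN mulNr.
  case/andP: kx; rewrite intrD mulrDl mul1r => k1 k2.
  by rewrite subr_gt0 ltrBlDl k2 andbT lt_def xk.
have hk k : mu.-negligible (NN k `|` PP k).
  apply: negligibleU.
    exists (NN k); split => //; last exact: etrans (lebesgue_measure_preimage_addr _ mN) N0.
    by rewrite -[NN k]setTI; exact: (measurable_addr (k%:~R * T)).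
  exists (PP k); split; last by [].
    exact: (measurable_set1 (k%:~R * T)).
  exact: (@lebesgue_measure_set1 R (k%:~R * T)).
by apply: negligible_bigcup => n; exact: negligibleU.
Qed.

End LebesgueTranslation.

Section TrigonometricUniqueness.
Context {R : realType}.
Local Notation mu := (@lebesgue_measure R).
Local Notation tau := (pi *+ 2 : R).

Lemma bernoulli_ge (h : R) k : 0 <= h -> 1 + h * k%:R <= (1 + h) ^+ k.
Proof.
move=> h0; elim: k => [|k IHk]; first by rewrite mulr0 expr0 addr0.
apply: (@le_trans _ _ ((1 + h) ^+ k + h * (1 + h) ^+ k)); last first.
  by rewrite exprS mulrDl mul1r.
rewrite -natr1 mulrDr mulr1 addrA lerD// ler_peMr//.
by rewrite exprn_ege1// lerDl.
Qed.

(** Put w = sqrt r and 1/w = 1 + h. Bernoulli's inequality bounds h k by w^(-k), so one of the two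
    factors w^k of r^k absorbs k. It serves both the steep powers below and the summability of the
    noise blocks. *)
Lemma geometric_linear_le (r : R) : 0 < r < 1 -> exists C : R, 0 < C /\
  forall k, k%:R * r ^+ k <= C * Num.sqrt r ^+ k.
Proof.
move=> /andP[r0 r1]; pose w := Num.sqrt r.
have w0 : 0 < w by rewrite sqrtr_gt0.
have w2 : w * w = r by rewrite -expr2 sqr_sqrtr// ltW.
have w1 : w < 1 by rewrite -sqrtr1 ltr_sqrt.
pose h := w^-1 - 1; have h0 : 0 < h by rewrite subr_gt0 invf_gt1.
exists h^-1; split => [|k]; first by rewrite invr_gt0.
rewrite -/w -[in leLHS]w2 exprMn mulrA ler_wpM2r ?exprn_ge0 ?(ltW w0)//.
rewrite -[h^-1]mulr1 ler_pdivlMl// mulrA.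
have B : h * k%:R <= w^-1 ^+ k.
  have -> : w^-1 = 1 + h by rewrite /h addrC subrK.
  by apply: le_trans (bernoulli_ge k (ltW h0)); rewrite lerDr.
apply: le_trans (ler_wpM2r (exprn_ge0 k (ltW w0)) B) _.
by rewrite -exprMn mulVf ?gt_eqF// expr1n.
Qed.

(** The exponent m makes m rho^k about k. Then m y^k tends to 0 for y < rho and to infinity for y >=
    rho, so (1 - y^k)^m tends to 1 or to 0 accordingly: the device of the Brosowski-Deutsch proof of
    the Stone-Weierstrass theorem. *)
Definition steep_exponent (rho : R) (k : nat) : nat := (Num.truncn (k%:R / rho ^+ k)).+1.

Lemma steep_exponentP rho k : 0 < rho ->
  k%:R <= (steep_exponent rho k)%:R * rho ^+ k <= k%:R + rho ^+ k.
Proof.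
move=> r0; have rk : 0 < rho ^+ k by exact: exprn_gt0.
have x0 : 0 <= k%:R / rho ^+ k by rewrite divr_ge0// ltW.
rewrite -ler_pdivrMr//; apply/andP; split; first exact/ltW/truncnS_gt.
rewrite -ler_pdivlMr// mulrDl divff ?gt_eqF// -natr1 lerD2r.
by rewrite truncn_le.
Qed.

Lemma steep_power_cvg1 (rho y : R) : 0 < rho -> rho < 1 -> 0 <= y < rho ->
  (1 - y ^+ k) ^+ steep_exponent rho k @[k --> \oo] --> (1 : R).
Proof.
move=> r0 r1 /andP[y0 yr].
(* A ratio strictly between y / rho and 1, positive even when y = 0. *)
pose r := (1 + y / rho) / 2.
have yr1 : y / rho < 1 by rewrite ltr_pdivrMr// mul1r.
have yr0 : 0 <= y / rho by rewrite divr_ge0// ltW.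
have r01 : 0 < r < 1 by rewrite /r; apply/andP; split; lra.
have [C [C0 HC]] := geometric_linear_le r01.
have yrr : y <= rho * r by rewrite mulrC -ler_pdivrMr// /r; lra.
have s1 : Num.sqrt r < 1 by rewrite -sqrtr1 ltr_sqrt//; case/andP: r01.
apply: (@squeeze_cvgr _ _ _ _ (fun k => 1 - (C * Num.sqrt r ^+ k + r ^+ k)) (fun=> 1)).
- apply: nearW => k; have y1 : y ^+ k <= 1 by rewrite exprn_ile1// (le_trans (ltW yr) (ltW r1)).
  have yk0 : 0 <= y ^+ k by exact: exprn_ge0.
  apply/andP; split; last first.
    by rewrite exprn_ile1// ?subr_ge0// lerBlDr lerDl.
  have H (m : nat) : 1 - m%:R * y ^+ k <= (1 - y ^+ k) ^+ m.
    elim: m => [|m IHm]; first by rewrite mul0r subr0 expr0.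
    have h1 : 0 <= 1 - y ^+ k by rewrite subr_ge0.
    rewrite exprS; apply: le_trans (ler_wpM2l h1 IHm); rewrite -natr1.
    have : 0 <= m%:R * y ^+ k * y ^+ k by rewrite !mulr_ge0.
    by move=> h; lra.
  apply: le_trans (H _); rewrite lerD2l lerN2.
  have /andP[_ m2] := steep_exponentP k r0.
  have r00 : 0 <= r by case/andP: r01 => /ltW.
  have yk : y ^+ k <= rho ^+ k * r ^+ k by rewrite -exprMn lerXn2r ?nnegrE// mulr_ge0// ltW.
  apply: le_trans (ler_wpM2l (ler0n _ _) yk) _; rewrite mulrA.
  apply: le_trans (ler_wpM2r (exprn_ge0 k r00) m2) _; rewrite mulrDl lerD ?HC//.
  by rewrite ler_piMl ?exprn_ge0// exprn_ile1// ltW.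
- rewrite -[X in _ --> X]subr0; apply: cvgB; first exact: cvg_cst.
  rewrite -[X in _ --> X]addr0; apply: cvgD; last first.
    by apply: cvg_expr; case/andP: r01 => h1 h2; rewrite ger0_norm// ltW.
  rewrite -[X in _ --> X](mulr0 C); apply: cvgM; first exact: cvg_cst.
  by apply: cvg_expr; rewrite ger0_norm.
- exact: cvg_cst.
Qed.

Lemma steep_power_cvg0 (rho y : R) : 0 < rho -> rho <= y <= 1 ->
  (1 - y ^+ k) ^+ steep_exponent rho k @[k --> \oo] --> (0 : R).
Proof.
move=> r0 /andP[ry y1]; have y0 := lt_le_trans r0 ry.
apply: (@squeeze_cvgr _ _ _ _ (fun=> 0) harmonic); last 2 first.
- exact: cvg_cst.
- exact: cvg_harmonic.
apply: nearW => k; set m := steep_exponent _ _.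
have yk1 : y ^+ k <= 1 by rewrite exprn_ile1// ltW.
have yk0 : 0 <= y ^+ k by rewrite exprn_ge0// ltW.
apply/andP; split; first by rewrite exprn_ge0// subr_ge0.
(* Since (1 - y^k)^m (1 + y^k)^m <= 1, a lower bound k + 1 for the second factor bounds the first by
   1 / (k + 1). *)
have B : k.+1%:R <= (1 + y ^+ k) ^+ m.
  apply: le_trans (bernoulli_ge m yk0); rewrite -natr1 addrC lerD2l mulrC.
  have /andP[m1 _] := steep_exponentP k r0; apply: le_trans m1 _.
  by rewrite ler_wpM2l// lerXn2r ?nnegrE// ltW.
rewrite /= -[leRHS]mul1r ler_pdivlMr//.
apply: le_trans (ler_wpM2l _ B) _; first by rewrite exprn_ge0// subr_ge0.
rewrite -exprMn exprn_ile1//; first by rewrite mulr_ge0 ?subr_ge0// addr_ge0.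
by have := mulr_ge0 yk0 yk0 => h; lra.
Qed.

Section Orthogonal.
Variable f : R -> R.
Hypothesis mf : measurable_fun setT f.
Hypothesis intf : mu.-integrable `[0, tau] (EFin \o f).

Lemma integrable_mul_continuous (p : R -> R) : continuous p ->
  mu.-integrable `[0, tau] (EFin \o (fun x => f x * p x)).
Proof.
move=> cp; rewrite (_ : EFin \o _ = (EFin \o f) \* (EFin \o p))%E//.
apply: integrableMl => //.
  by apply: measurable_funTS; exact: continuous_measurable_fun.
have /compact_bounded [M [Mr HM]] :=
  continuous_compact (continuous_subspaceT cp) (@segment_compact R 0 tau).
exists M; split => // y My x xt; apply: (HM y My); exists x => //.
Qed.

Let J (p : R -> R) := \int[mu]_(x in `[0, tau]) (f x * p x).

Let JD p q : continuous p -> continuous q -> J (fun x => p x + q x) = J p + J q.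
Proof.
move=> cp cq; rewrite /J -RintegralD//; try exact: integrable_mul_continuous.
by apply: eq_Rintegral => x _; rewrite mulrDr.
Qed.

Let JZ (p : R -> R) c : continuous p -> J (fun x => c * p x) = c * J p.
Proof.
move=> cp; rewrite /J -RintegralZl//; last exact: integrable_mul_continuous.
by apply: eq_Rintegral => x _; rewrite mulrCA.
Qed.

Let ccos (n : int) : continuous (fun x : R => cos (n%:~R * x)).
Proof.
move=> x; apply: (@continuous_comp _ _ _ (fun x : R => n%:~R * x) cos); last exact: continuous_cos.
exact: mulrl_continuous.
Qed.

Let csin (n : int) : continuous (fun x : R => sin (n%:~R * x)).
Proof.
move=> x; apply: (@continuous_comp _ _ _ (fun x : R => n%:~R * x) sin); last exact: continuous_sin.
exact: mulrl_continuous.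
Qed.

Let cM (p q : R -> R) : continuous p -> continuous q -> continuous (fun x => p x * q x).
Proof. by move=> cp cq x; apply: cvgM; [exact: cp|exact: cq]. Qed.

Let cD (p q : R -> R) : continuous p -> continuous q -> continuous (fun x => p x + q x).
Proof. by move=> cp cq x; apply: cvgD; [exact: cp|exact: cq]. Qed.

Let cC (c : R) : continuous (fun _ : R => c).
Proof. by move=> x; exact: cvg_cst. Qed.

(* The class of p such that f p is orthogonal to all trigonometric functions;
   the multipliers preserving it form an algebra containing cos (x - c). *)
Let V (p : R -> R) := continuous p /\ forall n : int,
  J (fun x => p x * cos (n%:~R * x)) = 0 /\ J (fun x => p x * sin (n%:~R * x)) = 0.

Let Mu (q : R -> R) := forall p, V p -> V (fun x => q x * p x).

Let VD p q : V p -> V q -> V (fun x => p x + q x).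
Proof.
move=> [cp Vp] [cq Vq]; split => [|n]; first exact: cD.
have [p1 p2] := Vp n; have [q1 q2] := Vq n; split.
  rewrite [X in J X](_ : _ = fun x => p x * cos (n%:~R * x) + q x * cos (n%:~R * x)).
    by rewrite JD ?p1 ?q1 ?addr0//; exact: cM.
  by apply/funext => x; rewrite mulrDl.
rewrite [X in J X](_ : _ = fun x => p x * sin (n%:~R * x) + q x * sin (n%:~R * x)).
  by rewrite JD ?p2 ?q2 ?addr0//; exact: cM.
by apply/funext => x; rewrite mulrDl.
Qed.

Let VZ p c : V p -> V (fun x => c * p x).
Proof.
move=> [cp Vp]; split => [|n]; first exact: cM.
have [p1 p2] := Vp n; split.
  rewrite [X in J X](_ : _ = fun x => c * (p x * cos (n%:~R * x))).
    by rewrite JZ ?p1 ?mulr0//; exact: cM.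
  by apply/funext => x; rewrite mulrA.
rewrite [X in J X](_ : _ = fun x => c * (p x * sin (n%:~R * x))).
  by rewrite JZ ?p2 ?mulr0//; exact: cM.
by apply/funext => x; rewrite mulrA.
Qed.

Let MuD q1 q2 : Mu q1 -> Mu q2 -> Mu (fun x => q1 x + q2 x).
Proof.
move=> M1 M2 p Vp; rewrite (_ : (fun _ => _) = fun x => q1 x * p x + q2 x * p x).
  by apply: VD; [exact: M1|exact: M2].
by apply/funext => x; rewrite mulrDl.
Qed.

Let MuM q1 q2 : Mu q1 -> Mu q2 -> Mu (fun x => q1 x * q2 x).
Proof.
move=> M1 M2 p Vp; rewrite (_ : (fun _ => _) = fun x => q1 x * (q2 x * p x)).
  exact/M1/M2.
by apply/funext => x; rewrite mulrA.
Qed.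

Let MuC c : Mu (fun=> c).
Proof. by move=> p Vp; exact: VZ. Qed.

Let MuX q k : Mu q -> Mu (fun x => q x ^+ k).
Proof.
move=> Mq; elim: k => [|k IHk].
  by under eq_fun do rewrite expr0; exact: MuC.
by under eq_fun do rewrite exprS; exact: MuM.
Qed.

Let intr_shift (n m : int) (x : R) : (n + m)%:~R * x = n%:~R * x + m%:~R * x.
Proof. by rewrite intrD mulrDl. Qed.

(** Product-to-sum formulas: multiplication by cos shifts the frequency n to n + 1 and n - 1, and
    orthogonality is known at every frequency. *)
Let Mucos : Mu cos.
Proof.
move=> p [cp Vp]; split => [|n]; first by apply: cM => //; exact: continuous_cos.
have [p1 p2] := Vp (n + 1); have [q1 q2] := Vp (n - 1); split.
  rewrite [X in J X](_ : _ = fun x => 2^-1 * (p x * cos ((n + 1)%:~R * x)) +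
      2^-1 * (p x * cos ((n - 1)%:~R * x))).
    by rewrite JD ?JZ ?p1 ?q1 ?mulr0 ?addr0//; do ?apply: cM.
  apply/funext => x; rewrite !intr_shift mulN1r mul1r cosD cosB.
  by field.
rewrite [X in J X](_ : _ = fun x => 2^-1 * (p x * sin ((n + 1)%:~R * x)) +
    2^-1 * (p x * sin ((n - 1)%:~R * x))).
  by rewrite JD ?JZ ?p2 ?q2 ?mulr0 ?addr0//; do ?apply: cM.
apply/funext => x; rewrite !intr_shift mulN1r mul1r sinD sinB.
by field.
Qed.

Let Musin : Mu sin.
Proof.
move=> p [cp Vp]; split => [|n]; first by apply: cM => //; exact: continuous_sin.
have [p1 p2] := Vp (n + 1); have [q1 q2] := Vp (n - 1); split.
  rewrite [X in J X](_ : _ = fun x => 2^-1 * (p x * sin ((n + 1)%:~R * x)) +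
      (- 2^-1) * (p x * sin ((n - 1)%:~R * x))).
    by rewrite JD ?JZ ?p2 ?q2 ?mulr0 ?addr0//; do ?apply: cM.
  apply/funext => x; rewrite !intr_shift mulr1z mul1r mulrN1z mulN1r !sinD.
  by rewrite cosN sinN; field.
rewrite [X in J X](_ : _ = fun x => (- 2^-1) * (p x * cos ((n + 1)%:~R * x)) +
    2^-1 * (p x * cos ((n - 1)%:~R * x))).
  by rewrite JD ?JZ ?p1 ?q1 ?mulr0 ?addr0//; do ?apply: cM.
apply/funext => x; rewrite !intr_shift mulr1z mul1r mulrN1z mulN1r !cosD.
by rewrite cosN sinN; field.
Qed.

(** A trigonometric polynomial with values in [0, 1], equal to 1 at c and decreasing with the
    distance to c on the circle: its superlevel sets are arcs centred at c. *)
Let y c x : R := (1 + cos (x - c)) / 2.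

Let Muy c : Mu (y c).
Proof.
rewrite (_ : y c = fun x => 2^-1 + (2^-1 * cos c * cos x + 2^-1 * sin c * sin x)).
  by apply: MuD => //; apply: MuD; (apply: MuM; [exact: MuC|]).
by apply/funext => x; rewrite /y cosB; field.
Qed.

Let y01 c x : 0 <= y c x <= 1.
Proof.
rewrite /y; have := cos_geN1 (x - c); have := cos_le1 (x - c) => h1 h2.
by apply/andP; split; lra.
Qed.

Hypothesis f0 : forall n : int,
  J (fun x => cos (n%:~R * x)) = 0 /\ J (fun x => sin (n%:~R * x)) = 0.

Let V1 : V (fun=> 1).
Proof.
split => [|n]; first exact: cC.
have [h1 h2] := f0 n.
by split; [under [X in J X]eq_fun do rewrite mul1r|under [X in J X]eq_fun do rewrite mul1r].
Qed.

Let JMu q : Mu q -> J q = 0.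
Proof.
move=> /(_ _ V1) [_ /(_ 0)[+ _]]; congr (J _ = _).
by apply/funext => x; rewrite mulr0z mul0r cos0 !mulr1.
Qed.

Let arcE a b x : 0 <= a -> a < b -> b <= tau -> b - a < tau -> 0 < x < tau ->
  ((1 + cos ((b - a) / 2)) / 2 <= y ((a + b) / 2) x) = (a <= x <= b).
Proof.
move=> a0 ab bt bat /andP[x0 xt].
have pi0 := @pi_gt0 R; have tauE : tau = 2 * pi :> R by rewrite mulr2n; ring.
rewrite /y ler_pM2r ?invr_gt0// lerD2l.
set d := (b - a) / 2; set c := (a + b) / 2.
have ad : a = c - d by rewrite /c /d; field.
have bd : b = c + d by rewrite /c /d; field.
have d0 : 0 < d by rewrite /d; lra.
have dpi : d < pi by rewrite /d; lra.
have -> : a <= x <= b = (`|x - c| <= d) by rewrite ler_distl ad bd.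
have -> : cos (x - c) = cos `|x - c|.
  have [h|h] := leP 0 (x - c); first by rewrite ger0_norm.
  by rewrite ltr0_norm// cosN.
have [h|h] := leP `|x - c| pi.
  by rewrite leNgt ltr_cos ?in_itv/= ?h ?(ltW d0) ?(ltW dpi) ?normr_ge0// -leNgt.
(* Beyond distance pi the cosine increases again. The distance round the circle, tau - |x - c|,
   still exceeds d because the arc does not leave [0, tau]. *)
rewrite [RHS]leNgt (lt_trans dpi h)/=; apply/negbTE; rewrite -ltNge.
have -> : cos `|x - c| = cos (tau - `|x - c|).
  by rewrite -[in RHS]cosN opprB -[in RHS](@cosD2pi R) subrK.
have hx : `|x - c| < tau - d by rewrite ltr_norml; apply/andP; split; lra.
by rewrite ltr_cos ?in_itv/= ?(ltW d0) ?(ltW dpi)//=; lra.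
Qed.

Let JE p : continuous p -> \int[mu]_(x in `]0, tau[) (f x * p x) = J p.
Proof.
move=> cp; have ip := integrable_mul_continuous cp.
rewrite Rintegral_itv_bndo_bndc; last by apply: integrableS ip => //; exact: subset_itv_oo_cc.
rewrite Rintegral_itv_obnd_cbnd//; apply: integrableS ip => //; exact: subset_itv_oc_cc.
Qed.

(** The multipliers [q k] stay in [0, 1] and converge to the indicator of the complement of the arc.
    Dominated convergence makes the integral of f over that complement vanish, and so does the
    integral of f over the whole period. *)
Let arc_integral a b : 0 <= a -> a < b -> b <= tau -> b - a < tau ->
  \int[mu]_(x in `]0, tau[) (f \_ `[a, b]) x = 0.
Proof.
move=> a0 ab bt bat.
have pi0 := @pi_gt0 R; have tauE : tau = 2 * pi :> R by rewrite mulr2n; ring.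
set d := (b - a) / 2; set c := (a + b) / 2.
have d0 : 0 < d by rewrite /d; lra.
have dpi : d < pi by rewrite /d; lra.
pose rho := (1 + cos d) / 2.
have cd1 : cos d < 1.
  by rewrite -cos0 ltr_cos ?in_itv/= ?lexx ?(ltW pi0) ?(ltW d0) ?(ltW dpi).
have cd2 : -1 < cos d.
  by rewrite -cospi ltr_cos ?in_itv/= ?lexx ?(ltW pi0) ?(ltW d0) ?(ltW dpi).
have r0 : 0 < rho by rewrite /rho; lra.
have r1 : rho < 1 by rewrite /rho; lra.
pose q k x := (1 - y c x ^+ k) ^+ steep_exponent rho k.
have Mq k : Mu (q k).
  apply: MuX; rewrite (_ : (fun _ => _) = fun x => 1 + (-1) * y c x ^+ k).
    by apply: MuD; [exact: MuC|apply: MuM; [exact: MuC|exact: MuX]].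
  by apply/funext => x; rewrite mulN1r.
have cq k : continuous (q k).
  by have [+ _] := Mq k _ V1; under [X in continuous X]eq_fun do rewrite mulr1.
have Jq k : \int[mu]_(x in `]0, tau[) (f x * q k x) = 0 by rewrite JE// JMu.
pose g x := f x - (f \_ `[a, b]) x.
have iff : mu.-integrable `]0, tau[ (EFin \o f).
  by apply: integrableS intf => //; exact: subset_itv_oo_cc.
have mg : measurable_fun `]0, tau[ g.
  apply: measurable_funB; first exact: measurable_funTS.
  by apply: measurable_funTS; apply/(measurable_restrictT _ _).1 => //; exact: measurable_funTS.
have [] := @dominated_convergence _ _ _ mu _ (measurable_itv `]0, tau[%R)
  (fun k x => (f x * q k x)%:E) (EFin \o g) (fun x => `|f x|%:E).
- move=> k; apply/measurable_EFinP/measurable_funM; first exact: measurable_funTS.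
  by apply: measurable_funTS; exact: continuous_measurable_fun.
- exact/measurable_EFinP.
- apply: aeW => x /=; rewrite in_itv/= => x0t; apply/cvg_EFin; first exact: nearW.
  have h := arcE a0 ab bt bat x0t.
  have /andP[y0 y1] := y01 c x.
  have [axb|axb] := boolP (a <= x <= b).
    rewrite /g patchE mem_set ?subrr//= -[X in _ --> X](mulr0 (f x)).
    apply: cvgM; first exact: cvg_cst.
    by apply: steep_power_cvg0 => //; rewrite y1 andbT h.
  rewrite /g patchE memNset//; last by rewrite /= in_itv/=; exact/negP.
  rewrite subr0 -[X in _ --> X](mulr1 (f x)); apply: cvgM; first exact: cvg_cst.
  by apply: steep_power_cvg1 => //; rewrite y0 ltNge h.
- exact: integrable_norm.
- apply: aeW => x k _; rewrite lee_fin normrM ler_piMr//.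
  have /andP[y0 y1] := y01 c x.
  have : 0 <= y c x ^+ k <= 1 by rewrite exprn_ge0//= exprn_ile1.
  move=> /andP[h0 h1]; rewrite ger0_norm ?exprn_ge0 ?subr_ge0//.
  by rewrite exprn_ile1// ?subr_ge0// lerBlDr lerDl.
move=> ig _ lim.
have Jg : \int[mu]_(x in `]0, tau[) g x = 0.
  rewrite /Rintegral; have -> : (\int[mu]_(x in `]0%R, tau[) (g x)%:E = 0)%E => //.
  apply: (cvg_unique _ lim) => //.
  rewrite (_ : [sequence _]_n = fun=> 0%E); first exact: cvg_cst.
  apply/funext => k /=; rewrite -[LHS]fineK; first by congr EFin; exact: Jq.
  apply: integrable_fin_num => //.
  apply: integrableS (integrable_mul_continuous (cq k)) => //; exact: subset_itv_oo_cc.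
have J1 : \int[mu]_(x in `]0, tau[) f x = 0.
  have := @JE _ (@cC 1); rewrite (JMu (@MuC 1)).
  by under eq_Rintegral do rewrite mulr1.
rewrite (_ : (fun _ => _) = fun x => f x - g x); last first.
  by apply/funext => x; rewrite /g opprB addrC subrK.
by rewrite RintegralB// J1 Jg subrr.
Qed.

(** All integrals over [0, z] with z < tau vanish, and by Lebesgue's differentiation theorem their
    derivative is f almost everywhere. *)
Lemma trig_orthogonal_ae_zero : {ae mu, forall x, x \in `]0, tau[ -> f x = 0}.
Proof.
pose g := f \_ `]0, tau[.
have iff : mu.-integrable `]0, tau[ (EFin \o f).
  by apply: integrableS intf => //; exact: subset_itv_oo_cc.
have lg : locally_integrable [set: R] g by exact: integrable_locally.
have ig A : measurable A -> mu.-integrable A (EFin \o g).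
  move=> mA; rewrite -restrict_EFin; apply/integrable_restrict => //.
  by apply: integrableS iff => //; exact: measurableI.
have := @FTC1 R g (BLeft 0) (fun y => ig _ (measurable_itv _)) lg.
apply: filterS; first exact: (ae_filter_ringOfSetsType mu).
move=> x H; rewrite in_itv/= => /andP[x0 xt].
have [|_] := H; first exact: x0.
have gx : g x = f x by rewrite /g patchE mem_set//= in_itv/= x0 xt.
rewrite gx => <-; rewrite derive1E.
have d0 : is_derive x 1 (fun _ : R => 0 : R) 0 by exact: is_derive_cst.
transitivity ('D_1 (fun _ : R => 0 : R) x); last exact: derive_val.
apply: near_eq_derive => //.
near=> z; rewrite /g -Rintegral_mkcondr.
rewrite setIC Rintegral_mkcondr; apply: arc_integral => //.
- by near: z; exact: lt_nbhsr.
- by apply: ltW; near: z; exact: lt_nbhsl.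
- by rewrite subr0; near: z; exact: lt_nbhsl.
Unshelve. all: by end_near. Qed.

End Orthogonal.

End TrigonometricUniqueness.

Section ContinuityRules.
Context {R : realType} {T : topologicalType}.
Implicit Types f g : T -> R.

Lemma ctsC (c : R) : continuous (fun _ : T => c).
Proof. by move=> x; exact: cvg_cst. Qed.

Lemma ctsD f g : continuous f -> continuous g -> continuous (fun x => f x + g x).
Proof. by move=> cf cg x; apply: cvgD; [exact: cf|exact: cg]. Qed.

Lemma ctsB f g : continuous f -> continuous g -> continuous (fun x => f x - g x).
Proof. by move=> cf cg x; apply: cvgB; [exact: cf|exact: cg]. Qed.

Lemma ctsN f : continuous f -> continuous (fun x => - f x).
Proof. by move=> cf x; apply: cvgN; exact: cf. Qed.

Lemma ctsM f g : continuous f -> continuous g -> continuous (fun x => f x * g x).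
Proof. by move=> cf cg x; apply: cvgM; [exact: cf|exact: cg]. Qed.

Lemma ctsX f k : continuous f -> continuous (fun x => f x ^+ k).
Proof.
move=> cf; elim: k => [|k IHk].
  by under eq_fun do rewrite expr0; exact: ctsC.
by under eq_fun do rewrite exprS; exact: ctsM.
Qed.

Lemma cts_norm f : continuous f -> continuous (fun x => `|f x|).
Proof. by move=> cf x; apply: cvg_norm; exact: cf. Qed.

Lemma cts_comp (h : R -> R) f : continuous h -> continuous f ->
  continuous (fun x => h (f x)).
Proof. by move=> ch cf x; apply: continuous_comp; [exact: cf|exact: ch]. Qed.

End ContinuityRules.

(** * Trigonometric functions and averages over a period *)

Section TrigFunctions.
Context {R : realType}.
Local Notation mu := (@lebesgue_measure R).
Local Notation tau := (pi *+ 2 : R).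
Implicit Types (f g : R -> R) (n m : int).

Definition cosn n (x : R) : R := cos (n%:~R * x).
Definition sinn n (x : R) : R := sin (n%:~R * x).

Lemma continuous_cosn n : continuous (cosn n).
Proof. by apply: cts_comp; [exact: continuous_cos|exact: mulrl_continuous]. Qed.

Lemma continuous_sinn n : continuous (sinn n).
Proof. by apply: cts_comp; [exact: continuous_sin|exact: mulrl_continuous]. Qed.

Lemma is_derive_cosn n (x : R) : is_derive x 1 (cosn n) (- (n%:~R * sinn n x)).
Proof.
have d1 := derZ n%:~R (is_derive_id x (1 : R)).
have h := @der_comp _ (fun x : R => n%:~R * x) cos x _ _ (is_derive_cos (n%:~R * x)) d1.
apply: der_eq h _.
by rewrite /sinn mulr1 mulNr mulrC.
Qed.

Lemma is_derive_sinn n (x : R) : is_derive x 1 (sinn n) (n%:~R * cosn n x).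
Proof.
have d1 := derZ n%:~R (is_derive_id x (1 : R)).
have h := @der_comp _ (fun x : R => n%:~R * x) sin x _ _ (is_derive_sin (n%:~R * x)) d1.
apply: der_eq h _.
by rewrite /cosn mulr1 mulrC.
Qed.

Lemma sincos_shift_tau (k : nat) (x : R) :
  (cos (x + tau *+ k) = cos x) * (sin (x + tau *+ k) = sin x).
Proof. by rewrite (periodicn (@cosD2pi R)) (periodicn (@sinD2pi R)). Qed.

Lemma cosn_periodic n : periodic (cosn n) tau.
Proof.
move=> x; rewrite /cosn mulrDr; case: n => k.
  by rewrite -[_ * tau]/(k%:R * tau) [k%:R * tau]mulr_natl sincos_shift_tau.
rewrite NegzE mulrNz !mulNr -opprD !cosN.
by rewrite -[_ * tau]/(k.+1%:R * tau) [k.+1%:R * tau]mulr_natl sincos_shift_tau.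
Qed.

Lemma sinn_periodic n : periodic (sinn n) tau.
Proof.
move=> x; rewrite /sinn mulrDr; case: n => k.
  by rewrite -[_ * tau]/(k%:R * tau) [k%:R * tau]mulr_natl sincos_shift_tau.
rewrite NegzE mulrNz !mulNr -opprD !sinN.
by rewrite -[_ * tau]/(k.+1%:R * tau) [k.+1%:R * tau]mulr_natl sincos_shift_tau.
Qed.

Lemma cosnN n x : cosn (- n) x = cosn n x.
Proof. by rewrite /cosn rmorphN mulNr cosN. Qed.

Lemma sinnN n x : sinn (- n) x = - sinn n x.
Proof. by rewrite /sinn rmorphN mulNr sinN. Qed.

Lemma norm_cosn_le1 n x : `|cosn n x| <= 1.
Proof. by rewrite ler_norml cos_geN1 cos_le1. Qed.

Lemma norm_sinn_le1 n x : `|sinn n x| <= 1.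
Proof. by rewrite ler_norml sin_geN1 sin_le1. Qed.

Lemma cosnD n m x : cosn (n + m) x = cosn n x * cosn m x - sinn n x * sinn m x.
Proof. by rewrite /cosn /sinn intrD mulrDl cosD. Qed.

Lemma sinnD n m x : sinn (n + m) x = sinn n x * cosn m x + cosn n x * sinn m x.
Proof. by rewrite /cosn /sinn intrD mulrDl sinD. Qed.

Definition mean f : R := tau^-1 * \int[mu]_(x in `[0, tau]) f x.

Lemma meanD f g : continuous f -> continuous g ->
  mean (fun x => f x + g x) = mean f + mean g.
Proof. by move=> cf cg; rewrite /mean cRintegralD// mulrDr. Qed.

Lemma meanB f g : continuous f -> continuous g ->
  mean (fun x => f x - g x) = mean f - mean g.
Proof. by move=> cf cg; rewrite /mean cRintegralB// mulrBr. Qed.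

Lemma meanZ f (c : R) : continuous f -> mean (fun x => c * f x) = c * mean f.
Proof. by move=> cf; rewrite /mean cRintegralZ// mulrCA. Qed.

Lemma mean_sum (I : Type) (r : seq I) (f : I -> R -> R) :
  (forall i, continuous (f i)) ->
  mean (fun x => \sum_(i <- r) f i x) = \sum_(i <- r) mean (f i).
Proof. by move=> cf; rewrite /mean Rintegral_itv_sum// mulr_sumr. Qed.

Lemma mean_cst (c : R) : mean (fun=> c) = c.
Proof.
have t0 := @tau_gt0 R.
rewrite /mean Rintegral_itv_cst ?(ltW t0)// subr0 mulrCA mulVf ?mulr1//.
by rewrite gt_eqF.
Qed.

Lemma mean_le f g : continuous f -> continuous g ->
  (forall x, f x <= g x) -> mean f <= mean g.
Proof.
move=> cf cg fg; rewrite /mean ler_wpM2l ?invr_ge0 ?(ltW tau_gt0)//.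
exact: Rintegral_itv_le.
Qed.

Lemma mean_norm_le f (c : R) : continuous f -> (forall x, `|f x| <= c) ->
  `|mean f| <= c.
Proof.
move=> cf fc; have t0 := @tau_gt0 R.
rewrite /mean normrM gtr0_norm ?invr_gt0// ler_pdivrMl//.
have := @Rintegral_itv_norm_le R f 0 tau c (ltW t0) cf; rewrite subr0 mulrC; exact.
Qed.

Lemma mean_derive f f' : periodic f tau -> continuous f' ->
  (forall x : R, is_derive x 1 f (f' x)) -> mean f' = 0.
Proof. by move=> pf cf' df; rewrite /mean (Rintegral_period_derive pf)// mulr0. Qed.

Lemma mean_cosn n : mean (cosn n) = (n == 0)%:R.
Proof.
have [->|n0] := eqVneq n 0.
  rewrite /mean; under eq_Rintegral do rewrite /cosn mul0r cos0.
  exact: (mean_cst 1).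
have nR : n%:~R != 0 :> R by rewrite intr_eq0.
have cs : continuous (fun x => n%:~R * cosn n x).
  by apply: ctsM; [exact: ctsC|exact: continuous_cosn].
have /= := mean_derive (sinn_periodic n) cs (is_derive_sinn n).
rewrite meanZ; last exact: continuous_cosn.
by move/eqP; rewrite mulf_eq0 (negbTE nR)/= => /eqP.
Qed.

Lemma mean_sinn n : mean (sinn n) = 0.
Proof.
have [->|n0] := eqVneq n 0.
  rewrite /mean; under eq_Rintegral do rewrite /sinn mul0r sin0.
  exact: (mean_cst 0).
have nR : n%:~R != 0 :> R by rewrite intr_eq0.
have cs : continuous (fun x => n%:~R * sinn n x).
  by apply: ctsM; [exact: ctsC|exact: continuous_sinn].
have /= := mean_derive (cosn_periodic n) (ctsN cs) (is_derive_cosn n).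
rewrite (_ : (fun _ => _) = fun x => (- n%:~R) * sinn n x); last first.
  by apply/funext => x; rewrite mulNr.
rewrite meanZ; last exact: continuous_sinn.
by move/eqP; rewrite mulf_eq0 oppr_eq0 (negbTE nR)/= => /eqP.
Qed.

Lemma mean_cosn_cosn n m :
  mean (fun x => cosn n x * cosn m x) = ((n == m)%:R + (n == - m)%:R) / 2.
Proof.
rewrite (_ : (fun _ => _) = fun x => 2^-1 * cosn (n - m) x + 2^-1 * cosn (n + m) x).
  have cc k : continuous (fun x => 2^-1 * cosn k x).
    by apply: ctsM; [exact: ctsC|exact: continuous_cosn].
  rewrite meanD ?meanZ//; do ?exact: continuous_cosn.
  by rewrite !mean_cosn subr_eq0 addr_eq0 -mulrDr mulrC.
by apply/funext => x; rewrite !cosnD cosnN sinnN; field.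
Qed.

Lemma mean_sinn_sinn n m :
  mean (fun x => sinn n x * sinn m x) = ((n == m)%:R - (n == - m)%:R) / 2.
Proof.
rewrite (_ : (fun _ => _) = fun x => 2^-1 * cosn (n - m) x - 2^-1 * cosn (n + m) x).
  have cc k : continuous (fun x => 2^-1 * cosn k x).
    by apply: ctsM; [exact: ctsC|exact: continuous_cosn].
  rewrite meanB ?meanZ//; do ?exact: continuous_cosn.
  by rewrite !mean_cosn subr_eq0 addr_eq0 -mulrBr mulrC.
by apply/funext => x; rewrite !cosnD cosnN sinnN; field.
Qed.

Lemma mean_sinn_cosn n m : mean (fun x => sinn n x * cosn m x) = 0.
Proof.
rewrite (_ : (fun _ => _) = fun x => 2^-1 * sinn (n - m) x + 2^-1 * sinn (n + m) x).
  have cc k : continuous (fun x => 2^-1 * sinn k x).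
    by apply: ctsM; [exact: ctsC|exact: continuous_sinn].
  rewrite meanD ?meanZ//; do ?exact: continuous_sinn.
  by rewrite !mean_sinn mulr0 addr0.
by apply/funext => x; rewrite !sinnD cosnN sinnN; field.
Qed.

End TrigFunctions.

Section ComplexParts.
Context {R : realType}.
Implicit Types z w : R[i].

Lemma complex_ext z w : complex.Re z = complex.Re w ->
  complex.Im z = complex.Im w -> z = w.
Proof. by case: z => a b; case: w => c d /= -> ->. Qed.

Lemma ReD z w : complex.Re (z + w) = complex.Re z + complex.Re w.
Proof. by case: z => a b; case: w. Qed.
Lemma ImD z w : complex.Im (z + w) = complex.Im z + complex.Im w.
Proof. by case: z => a b; case: w. Qed.
Lemma ReN z : complex.Re (- z) = - complex.Re z.
Proof. by case: z. Qed.
Lemma ImN z : complex.Im (- z) = - complex.Im z.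
Proof. by case: z. Qed.
Lemma ReM z w : complex.Re (z * w) =
  complex.Re z * complex.Re w - complex.Im z * complex.Im w.
Proof. by case: z => a b; case: w. Qed.
Lemma ImM z w : complex.Im (z * w) =
  complex.Re z * complex.Im w + complex.Im z * complex.Re w.
Proof. by case: z => a b; case: w. Qed.

Definition cparts := (ReD, ImD, ReN, ImN, ReM, ImM).

Lemma normc_sqr z : Normc.normc z ^+ 2 = complex.Re z ^+ 2 + complex.Im z ^+ 2.
Proof. by case: z => a b /=; rewrite sqr_sqrtr// addr_ge0// sqr_ge0. Qed.

Lemma normc_ge0 z : 0 <= Normc.normc z.
Proof. by case: z => a b /=; rewrite sqrtr_ge0. Qed.

Lemma Re_le_normc z : `|complex.Re z| <= Normc.normc z.
Proof.
rewrite -(@ler_pXn2r _ 2)// ?nnegrE ?normc_ge0// normc_sqr -normrX ger0_norm ?sqr_ge0//.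
by rewrite lerDl sqr_ge0.
Qed.

Lemma Im_le_normc z : `|complex.Im z| <= Normc.normc z.
Proof.
rewrite -(@ler_pXn2r _ 2)// ?nnegrE ?normc_ge0// normc_sqr -normrX ger0_norm ?sqr_ge0//.
by rewrite lerDr sqr_ge0.
Qed.

Lemma normc_le_ReIm z : Normc.normc z <= `|complex.Re z| + `|complex.Im z|.
Proof.
rewrite -(@ler_pXn2r _ 2)// ?nnegrE ?normc_ge0 ?addr_ge0// normc_sqr.
rewrite sqrrD -!normrX !(ger0_norm (sqr_ge0 _)).
by rewrite -addrA lerD2l lerDr mulrn_wge0// mulr_ge0.
Qed.

End ComplexParts.

(** * Fourier coefficients of integrable periodic functions *)

Section FourierCoefficients.
Context {R : realType}.
Local Notation mu := (@lebesgue_measure R).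
Local Notation tau := (pi *+ 2 : R).
Implicit Types (f g : R -> R) (n m : int).

Lemma torus_L1_continuous f : continuous f -> periodic f tau -> torus_L1 f.
Proof.
by move=> cf pf; split => //; [exact: continuous_measurable_fun|exact: continuous_integrable].
Qed.

Lemma torus_L1D f g : torus_L1 f -> torus_L1 g -> torus_L1 (fun x => f x + g x).
Proof.
move=> [pf mf jf] [pg mg jg]; split.
- by move=> x; rewrite pf pg.
- exact: measurable_funD.
- rewrite -[EFin \o _]/((EFin \o f) \+ (EFin \o g))%E; exact: integrableD.
Qed.

Lemma torus_L1B f g : torus_L1 f -> torus_L1 g -> torus_L1 (fun x => f x - g x).
Proof.
move=> [pf mf jf] [pg mg jg]; split.
- by move=> x; rewrite pf pg.
- exact: measurable_funB.
- rewrite -[EFin \o _]/((EFin \o f) \- (EFin \o g))%E; exact: integrableB.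
Qed.

Lemma fourierE f n : torus_L1 f -> fourier f n =
  Complex (mean (fun x => f x * cosn n x)) (- mean (fun x => f x * sinn n x)).
Proof.
move=> [pf mf jf]; rewrite /fourier /Cintegral.
have -> : forall (a b c : R), (a%:C%C * Complex b c)%C = Complex (a * b) (a * c).
  by move=> a b c; apply: complex_ext; rewrite !cparts/=; ring.
congr Complex; rewrite /mean.
  congr (_ * _); apply: eq_Rintegral => x _.
  by rewrite !cparts/= /cosn mul0r subr0 expR0 mul1r rmorphN mulNr cosN.
rewrite -mulrN; congr (_ * _); rewrite -mulN1r -RintegralZl//; last first.
  by apply: integrable_mul_continuous => //; exact: continuous_sinn.
apply: eq_Rintegral => x _.
by rewrite !cparts/= /sinn mul0r addr0 expR0 mul1r rmorphN mulNr sinN mulN1r mulrN.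
Qed.

Lemma L1_meanD f g (p : R -> R) : torus_L1 f -> torus_L1 g -> continuous p ->
  mean (fun x => (f x + g x) * p x) = mean (fun x => f x * p x) + mean (fun x => g x * p x).
Proof.
move=> [pf mf jf] [pg mg jg] cp; rewrite /mean -mulrDr; congr (_ * _).
rewrite -RintegralD//; do ?exact: integrable_mul_continuous.
by apply: eq_Rintegral => x _; rewrite mulrDl.
Qed.

Lemma L1_meanB f g (p : R -> R) : torus_L1 f -> torus_L1 g -> continuous p ->
  mean (fun x => (f x - g x) * p x) = mean (fun x => f x * p x) - mean (fun x => g x * p x).
Proof.
move=> [pf mf jf] [pg mg jg] cp; rewrite /mean -mulrBr; congr (_ * _).
rewrite -RintegralB//; do ?exact: integrable_mul_continuous.
by apply: eq_Rintegral => x _; rewrite mulrBl.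
Qed.

Lemma fourierD f g n : torus_L1 f -> torus_L1 g ->
  fourier (fun x => f x + g x) n = fourier f n + fourier g n.
Proof.
move=> Lf Lg; rewrite !fourierE//; last exact: torus_L1D.
rewrite !L1_meanD//; do ?[exact: continuous_cosn|exact: continuous_sinn].
by apply: complex_ext; rewrite !cparts//= opprD.
Qed.

Lemma fourierB f g n : torus_L1 f -> torus_L1 g ->
  fourier (fun x => f x - g x) n = fourier f n - fourier g n.
Proof.
move=> Lf Lg; rewrite !fourierE//; last exact: torus_L1B.
rewrite !L1_meanB//; do ?[exact: continuous_cosn|exact: continuous_sinn].
by apply: complex_ext; rewrite !cparts//= opprB opprK addrC.
Qed.

Lemma fourier_ae f g : torus_L1 f -> torus_L1 g -> ae_equal f g -> fourier f = fourier g.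
Proof.
move=> Lf Lg fg; apply/funext => n; rewrite !fourierE//.
have H (p : R -> R) : continuous p ->
    mean (fun x => f x * p x) = mean (fun x => g x * p x).
  move=> cp; rewrite /mean; congr (_ * _); rewrite /Rintegral; congr fine.
  have [_ mf _] := Lf; have [_ mg _] := Lg.
  apply: ae_eq_integral => //.
  - apply/measurable_EFinP/measurable_funM; first exact: measurable_funTS.
    by apply: measurable_funTS; exact: continuous_measurable_fun.
  - apply/measurable_EFinP/measurable_funM; first exact: measurable_funTS.
    by apply: measurable_funTS; exact: continuous_measurable_fun.
  - move: fg; apply: filterS; first exact: (ae_filter_ringOfSetsType mu).
    by move=> x /= ->.
by rewrite !H//; [exact: continuous_sinn|exact: continuous_cosn].
Qed.

Lemma fourier_conj f n : torus_L1 f -> fourier f (- n) = conjc (fourier f n).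
Proof.
move=> Lf; rewrite !fourierE//=; congr Complex.
  by rewrite /mean; under eq_Rintegral do rewrite cosnN.
congr (- _); have [pf mf jf] := Lf; rewrite /mean -mulrN; congr (_ * _).
rewrite -mulN1r -RintegralZl//.
  by apply: eq_Rintegral => x _; rewrite sinnN mulN1r mulrN.
by apply: integrable_mul_continuous => //; exact: continuous_sinn.
Qed.

Theorem fourier_inj_ae f g : torus_L1 f -> torus_L1 g -> fourier f = fourier g ->
  ae_equal f g.
Proof.
move=> Lf Lg fg; have Lh := torus_L1B Lf Lg.
suff : {ae mu, forall x, f x - g x = 0}.
  apply: filterS; first exact: (ae_filter_ringOfSetsType mu).
  by move=> x /eqP; rewrite subr_eq0 => /eqP.
have [ph mh jh] := Lh.
apply: (ae_periodic_zero tau_gt0 ph mh).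
apply: trig_orthogonal_ae_zero => // n.
have : fourier (fun x => f x - g x) n = 0 by rewrite fourierB// fg subrr.
rewrite fourierE// => -[/eqP + /eqP].
rewrite oppr_eq0 /mean !mulf_eq0 invr_eq0 gt_eqF ?tau_gt0//=.
by move=> /eqP -> /eqP ->.
Qed.

Lemma ae_equal_continuous f g : continuous f -> continuous g -> ae_equal f g -> f = g.
Proof.
move=> cf cg [N [mN N0 sN]]; apply/funext => x; apply: contrapT => /eqP fgx.
have ch : continuous (fun x => f x - g x) by exact: ctsB.
have h0 : 0 < `|f x - g x| by rewrite normr_gt0 subr_eq0.
have /cvgrPdist_lt /(_ _ h0) := ch x.
move=> [d /= d0 hd].
pose A := `]x - d, x + d[%classic.
have sub : A `<=` N.
  move=> y; rewrite /A /= in_itv/= => /andP[y1 y2]; apply: sN => /= fgy.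
  have hy : ball_ Num.norm x d y.
    by rewrite /= ltr_norml; apply/andP; split; lra.
  by have := hd y hy; rewrite /= fgy subrr subr0 ltxx.
have : (mu A <= 0)%E.
  by rewrite -N0; apply: le_measure => //; rewrite inE//; exact: measurable_itv.
rewrite lebesgue_measure_itv/= lte_fin.
have -> : x - d < x + d by lra.
by rewrite -EFinB lee_fin; apply/negP; rewrite -ltNge; lra.
Qed.

Lemma ae_equal_sym f g : ae_equal f g -> ae_equal g f.
Proof.
by apply: filterS; first exact: (ae_filter_ringOfSetsType mu).
Qed.

Lemma ae_equal_trans g f h : ae_equal f g -> ae_equal g h -> ae_equal f h.
Proof.
apply: filterS2; first exact: (ae_filter_ringOfSetsType mu).
by move=> x -> ->.
Qed.

Lemma ae_equal_comp2 (op : R -> R -> R) f f' g g' : ae_equal f f' -> ae_equal g g' ->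
  ae_equal (fun x => op (f x) (g x)) (fun x => op (f' x) (g' x)).
Proof.
apply: filterS2; first exact: (ae_filter_ringOfSetsType mu).
by move=> x -> ->.
Qed.

Lemma fourier_continuous_inj f g : continuous f -> periodic f tau ->
  continuous g -> periodic g tau -> fourier f = fourier g -> f = g.
Proof.
move=> cf pf cg pg fg; apply: ae_equal_continuous => //.
by apply: fourier_inj_ae => //; exact: torus_L1_continuous.
Qed.

Lemma der_unique f (x a b : R) : is_derive x 1 f a -> is_derive x 1 f b -> a = b.
Proof.
by move=> ha hb; rewrite -(@derive_val _ _ _ _ _ _ _ ha) (@derive_val _ _ _ _ _ _ _ hb).
Qed.

Lemma fourier_derive f f' n : periodic f tau -> continuous f' ->
  (forall x : R, is_derive x 1 f (f' x)) ->
  fourier f' n = Complex 0 n%:~R * fourier f n.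
Proof.
move=> pf cf' df; have cf := der_continuous df.
have cc := @continuous_cosn R n; have cs := @continuous_sinn R n.
have pf' : periodic f' tau.
  move=> x; have h := @der_comp _ (fun y : R => y + tau) f x _ _ (df (x + tau))
    (derD (is_derive_id x (1 : R)) (der_cst x tau)).
  have E : (fun y => f (y + tau)) = f by apply/funext => y; rewrite pf.
  by rewrite E in h; rewrite -(der_unique h (df x)) addr0 mulr1.
rewrite !fourierE; do ?exact: torus_L1_continuous.
have p1 : periodic (fun x => f x * cosn n x) tau by move=> x; rewrite pf cosn_periodic.
have p2 : periodic (fun x => f x * sinn n x) tau by move=> x; rewrite pf sinn_periodic.
have := mean_derive p1 _ (fun x => derM (df x) (is_derive_cosn n x)).
have := mean_derive p2 _ (fun x => derM (df x) (is_derive_sinn n x)).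
have E1 : (fun x => f x * (n%:~R * cosn n x) + sinn n x * f' x) =
  fun x => n%:~R * (f x * cosn n x) + f' x * sinn n x by apply/funext => x; ring.
have E2 : (fun x => f x * (- (n%:~R * sinn n x)) + cosn n x * f' x) =
  fun x => f' x * cosn n x - n%:~R * (f x * sinn n x) by apply/funext => x; ring.
rewrite E1 E2.
have c1 := ctsM cf cc; have c2 := ctsM cf cs; have c3 := ctsM cf' cc; have c4 := ctsM cf' cs.
have c5 := ctsM (@ctsC R R n%:~R) c1; have c6 := ctsM (@ctsC R R n%:~R) c2.
move=> /(_ (ctsD c5 c4)) h1 /(_ (ctsB c3 c6)) h2.
move: h1 h2; rewrite meanD// meanB// !meanZ// => h1 h2.
by apply: complex_ext; rewrite !cparts/=; lra.
Qed.

End FourierCoefficients.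

(** * Trigonometric series *)

Section WeierstrassTest.
Context {R : realType} {T : topologicalType}.
Variables (f : nat -> T -> R) (b : T -> R) (m : nat -> R).
Hypothesis cf : forall k, continuous (f k).
Hypothesis cb : continuous b.
Hypothesis b0 : forall x, 0 <= b x.
Hypothesis m0 : forall k, 0 <= m k.
Hypothesis cm : cvgn (series m).
Hypothesis fm : forall k x, `|f k x| <= b x * m k.

(** The majorant is a continuous, possibly unbounded, weight b times a summable sequence:
    convergence is only locally uniform, as fits series that grow with t. *)
Definition series_sum (x : T) : R := limn (fun K => \sum_(0 <= k < K) f k x).

Definition series_tail (K : nat) : R := limn (series m) - series m K.

Lemma series_tail_ge0 K : 0 <= series_tail K.
Proof.
rewrite subr_ge0; apply: nondecreasing_cvgn_le => //.
by apply: nondecreasing_series => k _ _; exact: m0.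
Qed.

Lemma series_tail_cvg0 : series_tail K @[K --> \oo] --> (0 : R).
Proof.
rewrite -[X in _ --> X](subrr (limn (series m))).
by apply: cvgB; [exact: cvg_cst|exact: cm].
Qed.

Lemma is_cvg_series_sum x : cvgn (fun K => \sum_(0 <= k < K) f k x).
Proof.
apply: normed_cvg.
apply: (@series_le_cvg _ _ (fun k => b x * m k)) => [k|k|k|].
- exact: normr_ge0.
- exact: mulr_ge0.
- exact: fm.
- by apply: is_cvg_seriesZ.
Qed.

Lemma series_sum_approx K x :
  `|series_sum x - \sum_(0 <= k < K) f k x| <= b x * series_tail K.
Proof.
have c1 : (`|(\sum_(0 <= k < N) f k x) - \sum_(0 <= k < K) f k x|) @[N --> \oo] -->
    `|series_sum x - \sum_(0 <= k < K) f k x|.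
  by apply: cvg_norm; apply: cvgB; [exact: is_cvg_series_sum|exact: cvg_cst].
have c2 : (b x * (series m N - series m K)) @[N --> \oo] --> b x * series_tail K.
  by apply: cvgM; [exact: cvg_cst|apply: cvgB; [exact: cm|exact: cvg_cst]].
apply: (ler_cvg_to c1 c2); near=> N.
have KN : (K <= N)%N by near: N; exact: nbhs_infty_ge.
rewrite /series/= !(@big_cat_nat _ _ _ K 0%N N)//= ![_ + _ - _]addrAC !subrr !add0r.
rewrite mulr_sumr; apply: le_trans (ler_norm_sum _ _ _) _.
by apply: ler_sum => k _; exact: fm.
Unshelve. all: by end_near. Qed.

(** Near x the weight is at most b(x) + 1, which makes the tails uniformly small there; the rest is
    the usual argument with three thirds of e. *)
Lemma continuous_series_sum : continuous series_sum.
Proof.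
move=> x; apply/cvgrPdist_le => e e0.
have e3 : 0 < e / 3 by rewrite divr_gt0.
have bx1 : 0 < b x + 1 by rewrite ltr_pwDr.
have e3b : 0 < e / 3 / (b x + 1) by rewrite divr_gt0.
have [K HK] : exists K, series_tail K <= e / 3 / (b x + 1).
  have /cvgrPdist_le /(_ _ e3b) [K _ /(_ K (leqnn K))] := series_tail_cvg0.
  by rewrite sub0r normrN => h; exists K; apply: le_trans h; exact: ler_norm.
have cS : continuous (fun x => \sum_(0 <= k < K) f k x) by exact: continuous_sum.
have /cvgrPdist_le /(_ _ e3) H1 := cS x.
have /cvgrPdist_le /(_ _ ltr01) H2 := @cb x.
near=> y.
have bK z : b z <= b x + 1 -> b z * series_tail K <= e / 3.
  move=> bz; rewrite -[leRHS](@divfK _ (b x + 1)) ?gt_eqF// mulrC.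
  by apply: ler_pM => //; exact: series_tail_ge0.
have h1 : `|series_sum x - \sum_(0 <= k < K) f k x| <= e / 3.
  by apply: le_trans (series_sum_approx K x) _; apply: bK; rewrite lerDl.
have h2 : `|series_sum y - \sum_(0 <= k < K) f k y| <= e / 3.
  apply: le_trans (series_sum_approx K y) _; apply: bK.
  have : `|b x - b y| <= 1 by near: y.
  by rewrite ler_distlC => /andP[].
have h3 : `|\sum_(0 <= k < K) f k x - \sum_(0 <= k < K) f k y| <= e / 3 by near: y.
have -> : e = e / 3 + (e / 3 + e / 3) by field.
set A := series_sum x - _ in h1; set C := \sum_(_ <= _ < _) f _ x in h3 A h1.
set D := \sum_(_ <= _ < _) f _ y in h2 h3.
have -> : series_sum x - series_sum y = A + ((C - D) - (series_sum y - D)).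
  by rewrite /A; ring.
apply: le_trans (ler_normD _ _) _; apply: lerD => //.
by apply: le_trans (ler_normB _ _) _; exact: lerD.
Unshelve. all: by end_near. Qed.

End WeierstrassTest.

Section TrigonometricPolynomials.
Context {R : realType}.
Local Notation mu := (@lebesgue_measure R).
Local Notation tau := (pi *+ 2 : R).
Implicit Types (f g : R -> R) (n m : int).

(* z e_n + conj(z) e_(-n) *)
Definition tmode (z : R[i]) n (x : R) : R :=
  2 * (complex.Re z * cosn n x - complex.Im z * sinn n x).

Lemma continuous_tmode z n : continuous (tmode z n).
Proof.
apply: ctsM; first exact: ctsC.
apply: ctsB; apply: ctsM; do ?exact: ctsC; first exact: continuous_cosn.
exact: continuous_sinn.
Qed.

Lemma tmode_periodic z n : periodic (tmode z n) tau.
Proof. by move=> x; rewrite /tmode cosn_periodic sinn_periodic. Qed.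

Lemma torus_L1_tmode z n : torus_L1 (tmode z n).
Proof.
by apply: torus_L1_continuous; [exact: continuous_tmode|exact: tmode_periodic].
Qed.

Lemma tmode_norm_le z n x : `|tmode z n x| <= 4 * Normc.normc z.
Proof.
rewrite /tmode normrM ger0_norm//.
have h1 : `|complex.Re z * cosn n x| <= Normc.normc z.
  by rewrite normrM; apply: le_trans (Re_le_normc z); rewrite ler_piMr// norm_cosn_le1.
have h2 : `|complex.Im z * sinn n x| <= Normc.normc z.
  by rewrite normrM; apply: le_trans (Im_le_normc z); rewrite ler_piMr// norm_sinn_le1.
have := ler_normB (complex.Re z * cosn n x) (complex.Im z * sinn n x) => h3.
by lra.
Qed.

Lemma fourier_tmode z n m : fourier (tmode z n) m =
  Complex (complex.Re z * ((n == m)%:R + (n == - m)%:R))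
          (complex.Im z * ((n == m)%:R - (n == - m)%:R)).
Proof.
rewrite fourierE; last exact: torus_L1_tmode.
have cc k l : continuous (fun x => cosn k x * cosn l x : R).
  by apply: ctsM; exact: continuous_cosn.
have ss k l : continuous (fun x => sinn k x * sinn l x : R).
  by apply: ctsM; exact: continuous_sinn.
have sc k l : continuous (fun x => sinn k x * cosn l x : R).
  by apply: ctsM; [exact: continuous_sinn|exact: continuous_cosn].
have cZ (a : R) (p : R -> R) : continuous p -> continuous (fun x => a * p x).
  by move=> cp; apply: ctsM => //; exact: ctsC.
congr Complex.
  rewrite (_ : (fun _ => _) = fun x => (2 * complex.Re z) * (cosn n x * cosn m x) -
      (2 * complex.Im z) * (sinn n x * cosn m x)).
    rewrite meanB ?meanZ//; do ?exact: cZ.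
    by rewrite mean_cosn_cosn mean_sinn_cosn; field.
  by apply/funext => x; rewrite /tmode; ring.
rewrite (_ : (fun _ => _) = fun x => (2 * complex.Re z) * (sinn m x * cosn n x) -
    (2 * complex.Im z) * (sinn n x * sinn m x)).
  rewrite meanB ?meanZ//; do ?exact: cZ.
  by rewrite mean_sinn_sinn mean_sinn_cosn; field.
by apply/funext => x; rewrite /tmode; ring.
Qed.

(** Each part of a Fourier coefficient is bounded by the sup norm, so a coefficient shared by
    arbitrarily close functions is also that of f. *)
Lemma fourier_limit f n (c : R[i]) : continuous f -> periodic f tau ->
  (forall e : R, 0 < e -> exists g, [/\ continuous g, periodic g tau,
     (forall x, `|f x - g x| <= e) & fourier g n = c]) ->
  fourier f n = c.
Proof.
move=> cf pf H; apply/eqP; rewrite -subr_eq0; apply/eqP.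
have K (e : R) : 0 < e -> `|complex.Re (fourier f n - c)| <= e /\
    `|complex.Im (fourier f n - c)| <= e.
  move=> e0; have [g [cg pg fg <-]] := H e e0.
  rewrite -fourierB; do ?exact: torus_L1_continuous.
  rewrite fourierE; last first.
    by apply: torus_L1_continuous; [exact: ctsB|move=> x; rewrite pf pg].
  have cfg : continuous (fun x => f x - g x) by exact: ctsB.
  split; rewrite /= ?normrN; apply: mean_norm_le.
  - by apply: ctsM => //; exact: continuous_cosn.
  - by move=> x; rewrite normrM; apply: le_trans (fg x); rewrite ler_piMr// norm_cosn_le1.
  - by apply: ctsM => //; exact: continuous_sinn.
  - by move=> x; rewrite normrM; apply: le_trans (fg x); rewrite ler_piMr// norm_sinn_le1.
by apply: complex_ext => /=; apply/eqP; rewrite -normr_le0; apply/ler_addgt0Pl => e e0;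
  have [h1 h2] := K e e0; rewrite addr0.
Qed.

Lemma torus_L1_fun0 : torus_L1 (fun _ : R => 0 : R).
Proof. by apply: torus_L1_continuous => //; exact: ctsC. Qed.

Lemma fourier0 n : fourier (fun _ : R => 0 : R) n = 0.
Proof.
rewrite fourierE.
under [X in mean X]eq_fun do rewrite mul0r.
under [X in - mean X]eq_fun do rewrite mul0r.
by rewrite mean_cst oppr0.
exact: torus_L1_fun0.
Qed.

Lemma torus_L1_sum (I : Type) (r : seq I) (P : pred I) (f : I -> R -> R) :
  (forall i, torus_L1 (f i)) -> torus_L1 (fun x => \sum_(i <- r | P i) f i x).
Proof.
move=> Lf; elim: r => [|i r IHr].
  by under [X in torus_L1 X]eq_fun do rewrite big_nil; exact: torus_L1_fun0.
under [X in torus_L1 X]eq_fun do rewrite big_cons.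
by case: (P i) => //; exact: torus_L1D.
Qed.

Lemma fourier_sum (I : Type) (r : seq I) (P : pred I) (f : I -> R -> R) n :
  (forall i, torus_L1 (f i)) ->
  fourier (fun x => \sum_(i <- r | P i) f i x) n = \sum_(i <- r | P i) fourier (f i) n.
Proof.
move=> Lf; elim: r => [|i r IHr].
  by rewrite big_nil; under [X in fourier X]eq_fun do rewrite big_nil; exact: fourier0.
rewrite big_cons; under [X in fourier X]eq_fun do rewrite big_cons.
case: (P i) => //; rewrite fourierD ?IHr//; exact: torus_L1_sum.
Qed.

(** The list [r] need not be symmetric, so the projection P + i Q of the real function f is complex.
    The inequality is the expansion of the mean of |f - P - i Q|^2, where both the mean of f P and
    that of P^2 + Q^2 equal the left side. *)
Lemma Bessel_inequality f (r : seq int) : continuous f -> periodic f tau -> uniq r ->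
  \sum_(n <- r) Normc.normc (fourier f n) ^+ 2 <= mean (fun x => f x ^+ 2).
Proof.
move=> cf pf ur.
pose a n : R := complex.Re (fourier f n); pose b n : R := complex.Im (fourier f n).
have aE n : mean (fun x => f x * cosn n x) = a n.
  by rewrite /a fourierE//; exact: torus_L1_continuous.
have bE n : mean (fun x => f x * sinn n x) = - b n.
  by rewrite /b fourierE ?opprK//; exact: torus_L1_continuous.
pose P x := \sum_(n <- r) (a n * cosn n x - b n * sinn n x).
pose Q x := \sum_(n <- r) (a n * sinn n x + b n * cosn n x).
have cC n : continuous (@cosn R n) := @continuous_cosn R n.
have cS n : continuous (@sinn R n) := @continuous_sinn R n.
have cZ (c : R) (p : R -> R) : continuous p -> continuous (fun x => c * p x).
  by move=> cp; apply: ctsM => //; exact: ctsC.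
have cP : continuous P by apply: continuous_sum => n; apply: ctsB; apply: cZ.
have cQ : continuous Q by apply: continuous_sum => n; apply: ctsD; apply: cZ.
pose S := \sum_(n <- r) Normc.normc (fourier f n) ^+ 2.
have fP : mean (fun x => f x * P x) = S.
  rewrite (_ : (fun _ => _) = fun x => \sum_(n <- r) (a n * (f x * cosn n x) - b n * (f x * sinn n x))).
    rewrite mean_sum => [|n]; last by apply: ctsB; apply: cZ; apply: ctsM.
    apply: eq_bigr => n _; rewrite meanB; do ?by apply: cZ; apply: ctsM.
    rewrite (meanZ (a n) (ctsM cf (@cC n))) (meanZ (b n) (ctsM cf (@cS n))).
    by rewrite aE bE normc_sqr -/(a n) -/(b n); ring.
  by apply/funext => x; rewrite /P mulr_sumr; apply: eq_bigr => n _; ring.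
have PQ : mean (fun x => P x ^+ 2 + Q x ^+ 2) = S.
  pose A n m := a n * a m + b n * b m; pose B n m := a n * b m - b n * a m.
  rewrite (_ : (fun _ => _) = fun x => \sum_(n <- r) \sum_(m <- r)
      (A n m * cosn (n - m) x + B n m * sinn (n - m) x)); last first.
    apply/funext => x; rewrite !expr2 /P /Q !mulr_suml -big_split/=.
    apply: eq_bigr => n _; rewrite !mulr_sumr -big_split/=; apply: eq_bigr => m _.
    by rewrite cosnD sinnD cosnN sinnN /A /B; ring.
  rewrite mean_sum => [|n]; last first.
    by apply: continuous_sum => m; apply: ctsD; apply: cZ.
  rewrite /S; apply: eq_big_seq => n nr; rewrite normc_sqr -/(a n) -/(b n).
  rewrite mean_sum => [|m]; last by apply: ctsD; apply: cZ.
  rewrite (bigD1_seq n)// big1 => [|m mn].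
    rewrite meanD ?meanZ//; do ?exact: cZ.
    by rewrite mean_cosn mean_sinn subrr eqxx /A /=; ring.
  rewrite meanD ?meanZ//; do ?exact: cZ.
  by rewrite mean_cosn mean_sinn subr_eq0 eq_sym (negbTE mn) !mulr0 addr0.
have : 0 <= mean (fun x => (f x - P x) ^+ 2 + Q x ^+ 2).
  rewrite -(mean_cst 0); apply: mean_le; first exact: ctsC.
    by apply: ctsD; apply: ctsX => //; exact: ctsB.
  by move=> x; rewrite addr_ge0 ?sqr_ge0.
rewrite (_ : (fun _ => _) = fun x => f x ^+ 2 - 2 * (f x * P x) + (P x ^+ 2 + Q x ^+ 2)).
  rewrite meanD; first last.
  - by apply: ctsD; exact: ctsX.
  - by apply: ctsB; [exact: ctsX|apply: cZ; exact: ctsM].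
  rewrite meanB; first last.
  - by apply: cZ; exact: ctsM.
  - exact: ctsX.
  by rewrite meanZ ?fP ?PQ; [rewrite /S; lra|exact: ctsM].
by apply/funext => x; ring.
Qed.

End TrigonometricPolynomials.

(** * The operator phi(D) on continuous functions *)

Section TimeIntegral.
Context {R : realType}.
Local Notation mu := (@lebesgue_measure R).
Local Notation tau := (pi *+ 2 : R).

Lemma fourier_Rintegral (F : R -> R -> R) t n : 0 <= t ->
  continuous (fun p : R * R => F p.1 p.2) -> (forall s, periodic (F s) tau) ->
  fourier (fun x => \int[mu]_(s in `[0, t]) F s x) n =
  Cintegral `[0, t] (fun s => fourier (F s) n).
Proof.
move=> t0 cF pF.
have cFs s : continuous (F s) := jcont_section (t := s) cF.
have cFx x : continuous (F ^~ x).
  exact: (@jcont_section _ _ (fun x s => F s x) x (jcont_swap cF)).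
have cI : continuous (fun x => \int[mu]_(s in `[0, t]) F s x).
  exact: (@jcont_integral _ _ (fun x s => F s x) 0 t (jcont_swap cF)).
have pI : periodic (fun x => \int[mu]_(s in `[0, t]) F s x) tau.
  by move=> x; apply: eq_Rintegral => s _; rewrite pF.
rewrite fourierE; last exact: torus_L1_continuous.
have H (p : R -> R) : continuous p ->
    mean (fun x => (\int[mu]_(s in `[0, t]) F s x) * p x) =
    \int[mu]_(s in `[0, t]) mean (fun x => F s x * p x).
  move=> cp; rewrite /mean.
  have cFp : continuous (fun q : R * R => F q.1 q.2 * p q.2).
    by apply: ctsM => //; apply: (@cts_comp _ _ p snd) => // q; exact: cvg_snd.
  rewrite cRintegralZ; last exact: (@jcont_integral _ _ (fun s x => F s x * p x)).
  congr (_ * _); rewrite (@jcont_Fubini _ (fun s x => F s x * p x))//.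
  apply: eq_Rintegral => x _; rewrite mulrC -cRintegralZ//.
  by apply: eq_Rintegral => s _; rewrite mulrC.
rewrite !H; [|exact: continuous_sinn|exact: continuous_cosn].
rewrite /Cintegral; congr Complex.
  by apply: eq_Rintegral => s _; rewrite fourierE//; exact: torus_L1_continuous.
rewrite -mulN1r -cRintegralZ.
  apply: eq_Rintegral => s _; rewrite fourierE//=; last exact: torus_L1_continuous.
  by rewrite mulN1r.
have cFp : continuous (fun q : R * R => F q.1 q.2 * sinn n q.2).
  by apply: ctsM => //; apply: (@cts_comp _ _ (sinn n) snd) => [|q];
    [exact: continuous_sinn|exact: cvg_snd].
apply: ctsM; first exact: ctsC.
exact: (@jcont_integral _ _ (fun s x => F s x * sinn n x)).
Qed.

Lemma continuous_fourier (T : topologicalType) (F : T -> R -> R) n :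
  continuous (fun p : T * R => F p.1 p.2) -> (forall s, periodic (F s) tau) ->
  continuous (fun s => complex.Re (fourier (F s) n)) /\
  continuous (fun s => complex.Im (fourier (F s) n)).
Proof.
move=> cF pF; have cFs s : continuous (F s) := jcont_section (t := s) cF.
have Fp (p : R -> R) : continuous p -> continuous (fun s => mean (fun x => F s x * p x)).
  move=> cp; apply: ctsM; first exact: ctsC.
  apply: (@jcont_integral _ _ (fun s x => F s x * p x)).
  by apply: ctsM => //; apply: (@cts_comp _ _ p snd) => // q; exact: cvg_snd.
split.
  rewrite (_ : (fun _ => _) = fun s => mean (fun x => F s x * cosn n x)).
    exact/Fp/continuous_cosn.
  by apply/funext => s; rewrite fourierE//; exact: torus_L1_continuous.
rewrite (_ : (fun _ => _) = fun s => - mean (fun x => F s x * sinn n x)).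
  exact/ctsN/Fp/continuous_sinn.
by apply/funext => s; rewrite fourierE//; exact: torus_L1_continuous.
Qed.

End TimeIntegral.

Section PhiOperator.
Context {R : realType}.
Local Notation mu := (@lebesgue_measure R).
Local Notation tau := (pi *+ 2 : R).
Implicit Types (f g : R -> R) (c x : R).

Let reflect_cts f : continuous f -> continuous (fun y => f (- y)).
Proof. by move=> cf; apply: cts_comp => //; exact: opp_continuous. Qed.

Lemma resolventm_norm_le f c : continuous f -> (forall x, `|f x| <= c) ->
  forall x, `|resolventm f x| <= c.
Proof.
move=> cf fc x; rewrite resolventm_reflect; apply: resolventp_norm_le => //.
exact: reflect_cts.
Qed.

Lemma resolventm_periodic f : periodic f tau -> periodic (resolventm f) tau.
Proof. by move=> pf x; apply: eq_Rintegral => r _; rewrite addrAC pf. Qed.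

Lemma resolventmB f g x : continuous f -> continuous g ->
  resolventm (fun x => f x - g x) x = resolventm f x - resolventm g x.
Proof.
by move=> cf cg; rewrite !resolventm_reflect -resolventpB//; exact: reflect_cts.
Qed.

Lemma jcont_resolventm (T : topologicalType) (f : T -> R -> R) :
  continuous (fun p : T * R => f p.1 p.2) ->
  continuous (fun p : T * R => resolventm (f p.1) p.2).
Proof.
move=> cf; rewrite (_ : (fun _ => _) = fun p : T * R => resolventp (fun y => f p.1 (- y)) (- p.2)).
  apply: (@jcont_comp (T * R)%type T R R (fun t x => resolventp (fun y => f t (- y)) x) fst (fun p => - p.2)).
  - apply: (jcont_resolventp (f := fun t y => f t (- y))).
    apply: (jcont_comp (f := f)) => //; first by move=> p; exact: cvg_fst.
    by apply: ctsN => p; exact: cvg_snd.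
  - by move=> p; exact: cvg_fst.
  - by apply: ctsN => p; exact: cvg_snd.
by apply/funext => p; exact: resolventm_reflect.
Qed.

Lemma resolventm_Rintegral (F : R -> R -> R) t x : 0 <= t ->
  continuous (fun p : R * R => F p.1 p.2) ->
  resolventm (fun x => \int[mu]_(s in `[0, t]) F s x) x =
  \int[mu]_(s in `[0, t]) resolventm (F s) x.
Proof.
move=> t0 cF; rewrite resolventm_reflect.
have cc : continuous (fun p : R * R => F p.1 (- p.2)).
  apply: (jcont_comp (f := F)) => //; first by move=> p; exact: cvg_fst.
  by apply: ctsN => p; exact: cvg_snd.
etransitivity; first exact: (@resolventp_Rintegral R (fun s y => F s (- y)) t (- x) t0 cc).
by apply: eq_Rintegral => s _; rewrite resolventm_reflect.
Qed.

(* phi(D) and (1 - d^2/dx^2)^{-1}, from the partial fractions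
   2 phi(n) = 1/(1 + i n) - 1/(1 - i n) and 2/(1 + n^2) = 1/(1 + i n) + 1/(1 - i n). *)
Definition phi_op f x : R := 2^-1 * (resolventp f x - resolventm f x).
Definition green_op f x : R := 2^-1 * (resolventp f x + resolventm f x).

Lemma phi_op_norm_le f c : continuous f -> (forall x, `|f x| <= c) ->
  forall x, `|phi_op f x| <= c.
Proof.
move=> cf fc x; rewrite /phi_op normrM ger0_norm ?invr_ge0//.
have := resolventp_norm_le cf fc x; have := resolventm_norm_le cf fc x.
have := ler_normB (resolventp f x) (resolventm f x); lra.
Qed.

Lemma phi_op_periodic f : periodic f tau -> periodic (phi_op f) tau.
Proof. by move=> pf x; rewrite /phi_op resolventp_periodic// resolventm_periodic. Qed.

Lemma green_op_periodic f : periodic f tau -> periodic (green_op f) tau.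
Proof. by move=> pf x; rewrite /green_op resolventp_periodic// resolventm_periodic. Qed.

Lemma phi_opB f g x : continuous f -> continuous g ->
  phi_op (fun x => f x - g x) x = phi_op f x - phi_op g x.
Proof. by move=> cf cg; rewrite /phi_op resolventpB// resolventmB//; ring. Qed.

Lemma jcont_phi_op (T : topologicalType) (f : T -> R -> R) :
  continuous (fun p : T * R => f p.1 p.2) ->
  continuous (fun p : T * R => phi_op (f p.1) p.2).
Proof.
move=> cf; apply: ctsM; first exact: ctsC.
by apply: ctsB; [exact: jcont_resolventp|exact: jcont_resolventm].
Qed.

Lemma jcont_green_op (T : topologicalType) (f : T -> R -> R) :
  continuous (fun p : T * R => f p.1 p.2) ->
  continuous (fun p : T * R => green_op (f p.1) p.2).
Proof.
move=> cf; apply: ctsM; first exact: ctsC.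
by apply: ctsD; [exact: jcont_resolventp|exact: jcont_resolventm].
Qed.

Lemma phi_op_Rintegral (F : R -> R -> R) t x : 0 <= t ->
  continuous (fun p : R * R => F p.1 p.2) ->
  phi_op (fun x => \int[mu]_(s in `[0, t]) F s x) x =
  \int[mu]_(s in `[0, t]) phi_op (F s) x.
Proof.
move=> t0 cF; rewrite /phi_op resolventp_Rintegral// resolventm_Rintegral//.
have c1 := jcont_slice (F := fun s => resolventp (F s)) (x := x) (jcont_resolventp (T := R) (f := F) cF).
have c2 := jcont_slice (F := fun s => resolventm (F s)) (x := x) (jcont_resolventm (T := R) (f := F) cF).
by rewrite cRintegralZ ?cRintegralB//; exact: ctsB.
Qed.

Lemma green_op_Rintegral (F : R -> R -> R) t x : 0 <= t ->
  continuous (fun p : R * R => F p.1 p.2) ->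
  green_op (fun x => \int[mu]_(s in `[0, t]) F s x) x =
  \int[mu]_(s in `[0, t]) green_op (F s) x.
Proof.
move=> t0 cF; rewrite /green_op resolventp_Rintegral// resolventm_Rintegral//.
have c1 := jcont_slice (F := fun s => resolventp (F s)) (x := x) (jcont_resolventp (T := R) (f := F) cF).
have c2 := jcont_slice (F := fun s => resolventm (F s)) (x := x) (jcont_resolventm (T := R) (f := F) cF).
by rewrite cRintegralZ ?cRintegralD//; exact: ctsD.
Qed.

(** Since - d^2/dx^2 = (1 - d^2/dx^2) - 1, the derivative of phi(D) f involves no derivative of f.
    Hence v = phi(D) n is C^1 in x for merely continuous n. *)
Lemma is_derive_phi_op f x : continuous f -> periodic f tau ->
  is_derive x 1 (phi_op f) (f x - green_op f x).
Proof.
move=> cf pf.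
have h := derZ 2^-1 (derB (is_derive_resolventp x cf pf) (is_derive_resolventm x cf pf)).
by apply: der_eq h _; rewrite /green_op; field.
Qed.

Lemma is_derive_green_op f x : continuous f -> periodic f tau ->
  is_derive x 1 (green_op f) (- phi_op f x).
Proof.
move=> cf pf.
have h := derZ 2^-1 (derD (is_derive_resolventp x cf pf) (is_derive_resolventm x cf pf)).
by apply: der_eq h _; rewrite /phi_op; field.
Qed.

Lemma continuous_phi_op f : continuous f -> periodic f tau -> continuous (phi_op f).
Proof. by move=> cf pf; apply: der_continuous => x; exact: is_derive_phi_op. Qed.

Lemma continuous_green_op f : continuous f -> periodic f tau -> continuous (green_op f).
Proof. by move=> cf pf; apply: der_continuous => x; exact: is_derive_green_op. Qed.

Lemma fourier_phi_op f n : continuous f -> periodic f tau ->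
  fourier (phi_op f) n = phi n * fourier f n.
Proof.
move=> cf pf.
have dp x := is_derive_resolventp x cf pf; have dm x := is_derive_resolventm x cf pf.
have cp := der_continuous dp; have cm := der_continuous dm.
have pp := resolventp_periodic pf; have pm := resolventm_periodic pf.
have Lf := torus_L1_continuous cf pf.
have Lp := torus_L1_continuous cp pp; have Lm := torus_L1_continuous cm pm.
have := fourier_derive n pp (ctsB cf cp) dp; rewrite fourierB//.
have := fourier_derive n pm (ctsB cm cf) dm; rewrite fourierB//.
have -> : fourier (phi_op f) n = Complex 2^-1 0 * (fourier (resolventp f) n - fourier (resolventm f) n).
  rewrite -fourierB//; have LB := torus_L1B Lp Lm.
  have c0 : continuous (fun x => resolventp f x - resolventm f x) by exact: ctsB.
  rewrite !fourierE//; last first.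
    apply: torus_L1_continuous; first exact: continuous_phi_op.
    exact: phi_op_periodic.
  apply: complex_ext; rewrite !cparts/= !mul0r ?subr0 ?addr0 ?mulrN.
    rewrite -meanZ; last by apply: ctsM => //; exact: continuous_cosn.
    by congr mean; apply/funext => x; rewrite /phi_op mulrA.
  rewrite -meanZ; last by apply: ctsM => //; exact: continuous_sinn.
  by congr (- mean _); apply/funext => x; rewrite /phi_op mulrA.
move: (fourier f n) (fourier (resolventp f) n) (fourier (resolventm f) n) => F P M.
have n0 : (1 + n%:~R ^+ 2 : R) != 0 by rewrite gt_eqF// ltr_pwDl// sqr_ge0.
rewrite /phi; set N : R := n%:~R in n0 *.
case: F => fr fi; case: P => pr p_i; case: M => mr m_i hm hp.
move: (congr1 (@complex.Re R) hp) (congr1 (@complex.Im R) hp).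
move: (congr1 (@complex.Re R) hm) (congr1 (@complex.Im R) hm) => /= h3 h4 h1 h2.
(* These are the real and imaginary parts of (1 + i n) P = F and (1 - i n) M = F, the differential
   equations of the two resolvents; the rest solves this linear system. *)
have e1 : fr = pr - N * p_i by lra.
have e2 : fi = p_i + N * pr by lra.
have e3 : fr = mr + N * m_i by lra.
have e4 : fi = m_i - N * mr by lra.
have q1 : pr = (fr + N * fi) / (1 + N ^+ 2) by rewrite {1}e1 e2; field.
have q2 : p_i = (fi - N * fr) / (1 + N ^+ 2) by rewrite e1 {1}e2; field.
have q3 : mr = (fr - N * fi) / (1 + N ^+ 2) by rewrite {1}e3 e4; field.
have q4 : m_i = (fi + N * fr) / (1 + N ^+ 2) by rewrite e3 {1}e4; field.
by apply: complex_ext; rewrite /= q1 q2 q3 q4; field.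
Qed.

End PhiOperator.

(** * Sobolev norms *)

Section SobolevNorms.
Context {R : realType}.
Local Notation mu := (@lebesgue_measure R).
Local Notation tau := (pi *+ 2 : R).
Implicit Types (f g : R -> R) (s : R).

(** With its converse [Hnorm_sum_le] this replaces the extended-real sum in [Hnorm] by finite sums
    over duplicate-free lists, to which Bessel's inequality applies. *)
Lemma Hnorm_le s f (C : R) : 0 <= C ->
  (forall r : seq int, uniq r ->
     \sum_(n <- r) Normc.normc (bessel s (fourier f) n) ^+ 2 <= C ^+ 2) ->
  (Hnorm s f <= C%:E)%E.
Proof.
move=> C0 H; rewrite /Hnorm poweR12_sqrt; last first.
  by apply: esum_ge0 => n _; rewrite lee_fin sqr_ge0.
rewrite -[C]ger0_norm// -sqrtr_sqr -[(Num.sqrt _)%:E]/(sqrte (C ^+ 2)%:E).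
rewrite -!poweR12_sqrt ?lee_fin ?sqr_ge0//; last first.
  by apply: esum_ge0 => n _; rewrite lee_fin sqr_ge0.
apply: gt0_ler_poweR; rewrite ?invr_ge0// ?in_itv/= ?andbT ?leey ?lee_fin ?sqr_ge0//.
  by rewrite esum_ge0// => n _; rewrite lee_fin sqr_ge0.
apply: ub_ereal_sup => _ [A [fA _] <-].
rewrite fsbig_finite//= sumEFin lee_fin; apply: H; exact: fset_uniq.
Qed.

Lemma Hnorm_sum_le s f : (Hnorm s f < +oo)%E ->
  0 <= fine (Hnorm s f) /\
  forall r : seq int, uniq r ->
    \sum_(n <- r) Normc.normc (bessel s (fourier f) n) ^+ 2 <= fine (Hnorm s f) ^+ 2.
Proof.
rewrite /Hnorm; set E := (esum _ _).
have E0 : (0 <= E)%E by apply: esum_ge0 => n _; rewrite lee_fin sqr_ge0.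
move=> /lty_poweRy; rewrite invr_eq0 pnatr_eq0 => /(_ isT) Ey.
have Ef : E \is a fin_num by rewrite ge0_fin_numE.
rewrite poweR12_sqrt//.
have F0 : 0 <= fine E by rewrite fine_ge0.
have -> : fine (sqrte E) = Num.sqrt (fine E) by rewrite -(fineK Ef).
split; first exact: sqrtr_ge0.
move=> r ur; rewrite sqr_sqrtr// -lee_fin fineK// -sumEFin fsbig_seq//.
by apply: ereal_sup_ubound; exists [set` r] => //; split => //; exact: finite_seq.
Qed.

Lemma Wnorm_ge0 s f : (0 <= Wnorm s f)%E.
Proof.
by apply: le_ereal_inf_tmp => _ [w _ <-]; exact: Lnorm_ge0.
Qed.

Lemma Wnorm_le s f w (C : R) : torus_L1 w -> fourier w = bessel s (fourier f) ->
  (forall x, `|w x| <= C) -> (Wnorm s f <= C%:E)%E.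
Proof.
move=> Lw fw wC; apply: (@le_trans _ _ ('N[mu]_+oo[EFin \o w])%E).
  by apply: ereal_inf_lbound; exists w.
rewrite unlock; case: ifPn => [_|_]; last by rewrite lee_fin (le_trans _ (wC 0)).
by apply/ess_supP; apply: aeW => x /=; rewrite lee_fin.
Qed.

Lemma Hnorm_ge0 s f : (0 <= Hnorm s f)%E.
Proof. exact: poweR_ge0. Qed.

Lemma japanese_ge1 n : 1 <= japanese n :> R.
Proof. by rewrite -[leLHS]sqrtr1; apply: ler_wsqrtr; rewrite lerDl sqr_ge0. Qed.

Lemma normc_bessel s (c : fseries R) n :
  Normc.normc (bessel s c n) = japanese n `^ s * Normc.normc (c n).
Proof.
rewrite /bessel /multiplier Normc.normcM; congr (_ * _).
by rewrite /= expr0n addr0 sqrtr_sqr ger0_norm// powR_ge0.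
Qed.

End SobolevNorms.

(** * The truncated equation *)

Section Gronwall.
Context {R : realType}.
Local Notation mu := (@lebesgue_measure R).

Lemma continuous_expRM (a : R) : continuous (fun s => expR (a * s)).
Proof. by apply: cts_comp; [exact: continuous_expR|exact: mulrl_continuous]. Qed.

Lemma is_derive_expRM (a s : R) : is_derive s 1 (fun s => expR (a * s)) (a * expR (a * s)).
Proof.
have h := @der_comp _ (fun s : R => a * s) expR s _ _ (is_derive_expR (a * s))
  (derZ a (is_derive_id s (1 : R))).
by apply: der_eq h _; rewrite mulr1 mulrC.
Qed.

Lemma Rintegral_expR_le (a t : R) : 0 < a -> 0 <= t ->
  \int[mu]_(s in `[0, t]) expR (a * s) <= a^-1 * expR (a * t).
Proof.
move=> a0 t0.
have d (s : R) : is_derive s 1 (fun s => a^-1 * expR (a * s)) (expR (a * s)).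
  by have h := derZ a^-1 (is_derive_expRM a s); apply: der_eq h _; rewrite mulKf ?gt_eqF.
rewrite (Rintegral_itv_FTC2 t0 (@continuous_expRM a) d).
by rewrite gerDl oppr_le0 mulr_ge0 ?invr_ge0 ?expR_ge0// ltW.
Qed.

(** With the weight e^(2 L t), each use of the hypothesis halves the bound. The hypothesis speaks of
    continuous majorants h, so that the supremum of |d t x| over x never has to be integrated in
    t. *)
Lemma Gronwall_zero (T L B : R) (d : R -> R -> R) : 0 <= T -> 0 < L -> 0 <= B ->
  (forall t x, 0 <= t <= T -> `|d t x| <= B) ->
  (forall h : R -> R, continuous h ->
     (forall s x, 0 <= s <= T -> `|d s x| <= h s) ->
     forall t x, 0 <= t <= T -> `|d t x| <= L * \int[mu]_(s in `[0, t]) h s) ->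
  forall t x, 0 <= t <= T -> d t x = 0.
Proof.
move=> T0 L0 B0 dB dL.
have L2 : 0 < 2 * L by rewrite mulr_gt0.
have H k : forall t x, 0 <= t <= T -> `|d t x| <= (B * 2^-1 ^+ k) * expR (2 * L * t).
  elim: k => [|k IHk] t x t0T; have /andP[t0 tT] := t0T.
    rewrite expr0 mulr1; apply: le_trans (dB t x t0T) _.
    by rewrite ler_peMr// -[leLHS]expR0 ler_expR mulr_ge0// (ltW L2).
  have ck : continuous (fun s => (B * 2^-1 ^+ k) * expR (2 * L * s)).
    by apply: ctsM; [exact: ctsC|exact: continuous_expRM].
  apply: le_trans (dL _ ck IHk t x t0T) _; rewrite cRintegralZ; last exact: continuous_expRM.
  have Bk : 0 <= B * 2^-1 ^+ k by rewrite mulr_ge0// exprn_ge0// invr_ge0.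
  apply: le_trans (ler_wpM2l (ltW L0) (ler_wpM2l Bk (Rintegral_expR_le L2 t0))) _.
  by rewrite exprS le_eqVlt; apply/orP; left; apply/eqP; field; rewrite gt_eqF.
move=> t x t0T; apply/eqP; rewrite -normr_le0.
pose C := B * expR (2 * L * t).
have c1 : (C * 2^-1 ^+ k) @[k --> \oo] --> (0 : R).
  rewrite -[X in _ --> X](mulr0 C); apply: cvgM; first exact: cvg_cst.
  by apply: cvg_expr; rewrite ger0_norm ?invr_ge0// invf_lt1// ltr1n.
apply: (ler_cvg_to (cvg_cst (`|d t x|)) c1); apply: nearW => k.
by rewrite /C mulrAC; exact: H.
Qed.

Lemma Gronwall_exp (E : R -> R) (T c : R) : 0 <= T -> 0 <= c -> continuous E ->
  (forall t, 0 <= t <= T -> E t <= \int[mu]_(s in `[0, t]) (c * (1 + E s))) ->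
  forall t, 0 <= t <= T -> 1 + E t <= expR (c * t).
Proof.
move=> T0 c0 cE H t t0T; have /andP[t0 tT] := t0T.
have cg : continuous (fun s => 1 + E s) by apply: ctsD => //; exact: ctsC.
pose u := primitive (fun s => 1 + E s).
have du (s : R) : is_derive s 1 u (1 + E s) by exact: is_derive_primitive.
have uE s : 0 <= s -> u s = \int[mu]_(s in `[0, s]) (1 + E s).
  by move=> s0; rewrite -primitiveB// primitive0 subr0.
have HE s : 0 <= s <= T -> E s <= c * u s.
  by move=> s0T; have /andP[s0 _] := s0T; rewrite uE// -cRintegralZ//; exact: H.
(* As u' = 1 + E <= 1 + c u, the function w is nonincreasing, and w(0) = 1. *)
pose w s := expR (- c * s) * (1 + c * u s).
pose w' s := expR (- c * s) * (c * (1 + E s)) + (1 + c * u s) * (- c * expR (- c * s)).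
have dw (s : R) : is_derive s 1 w (w' s).
  have h := derM (is_derive_expRM (- c) s) (derD (der_cst s (1 : R)) (derZ c (du s))).
  by apply: der_eq h _; rewrite add0r.
have cu : continuous u by exact: der_continuous du.
have cw' : continuous w'.
  apply: ctsD; apply: ctsM; do ?exact: continuous_expRM.
  - by apply: ctsM => //; exact: ctsC.
  - by apply: ctsD; [exact: ctsC|apply: ctsM => //; exact: ctsC].
  - by apply: ctsM; [exact: ctsC|exact: continuous_expRM].
have : w t - w 0 <= 0.
  rewrite -(Rintegral_itv_FTC2 t0 cw' dw) -[leRHS](mul0r (t - 0)) -Rintegral_itv_cst//.
  apply: Rintegral_itv_le => //; first exact: ctsC.
  move=> s /andP[s0 st]; have sT : 0 <= s <= T by rewrite s0 (le_trans st).
  rewrite /w'; have -> : expR (- c * s) * (c * (1 + E s)) + (1 + c * u s) * (- c * expR (- c * s)) =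
    expR (- c * s) * c * (E s - c * u s) by ring.
  by rewrite mulr_ge0_le0 ?mulr_ge0 ?expR_ge0// subr_le0 HE.
rewrite /w mulr0 expR0 mul1r /u primitive0 mulr0 addr0 subr_le0 -/u => hw.
apply: (@le_trans _ _ (1 + c * u t)); first by rewrite lerD2l HE.
have e0 : 0 < expR (- c * t) by exact: expR_gt0.
by rewrite -(ler_pM2l e0) (le_trans hw)// -expRD mulNr addNr expR0.
Qed.

End Gronwall.

Section PeriodicFamilies.
Context {R : realType}.
Local Notation mu := (@lebesgue_measure R).
Local Notation tau := (pi *+ 2 : R).

Lemma periodic_reduce (x : R) : exists2 y : R, 0 <= y <= tau &
  forall f : R -> R, periodic f tau -> f x = f y.
Proof.
have t0 := @tau_gt0 R.
pose k := Num.floor (x / tau).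
exists (x - k%:~R * tau).
  have : k%:~R * tau <= x < (k + 1)%:~R * tau.
    by rewrite -ler_pdivlMr// -ltr_pdivrMr// floor_le/= floorD1_gt.
  rewrite intrD mulrDl mul1r => /andP[h1 h2]; apply/andP; split; lra.
move=> f pf; rewrite -[in LHS](subrK (k%:~R * tau) x); move: (x - _) => y.
exact: periodicz.
Qed.

Lemma jcont_bounded (f : R -> R -> R) (T : R) :
  continuous (fun p : R * R => f p.1 p.2) -> (forall t, periodic (f t) tau) ->
  exists2 B : R, 0 <= B & forall t x, 0 <= t <= T -> `|f t x| <= B.
Proof.
move=> cf pf.
have cK : compact (`[0, T]%classic `*` `[0, tau]%classic : set (R * R)).
  by apply: compact_setX; exact: segment_compact.
have /compact_bounded [M [Mr HM]] := continuous_compact (continuous_subspaceT cf) cK.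
exists (`|M| + 1); first by rewrite addr_ge0.
move=> t x t0T; have [y y0 ->] := periodic_reduce x; last exact: pf.
apply: (HM (`|M| + 1)); first by rewrite ltr_pwDr// ler_norm.
by exists (t, y) => //; split; rewrite /= in_itv.
Qed.

Lemma jcont_uniform_periodic (T : topologicalType) (f : T -> R -> R) (t : T) (e : R) :
  continuous (fun p : T * R => f p.1 p.2) -> (forall t, periodic (f t) tau) -> 0 < e ->
  \forall t' \near t, forall x, `|f t' x - f t x| <= e.
Proof.
move=> cf pf e0; have := jcont_uniform_near t 0 tau cf e0.
apply: filterS => t' H x; have [y y0 E] := periodic_reduce x.
by rewrite (E (f t'))// (E (f t))//; exact: H.
Qed.

End PeriodicFamilies.

Section Clamp.
Context {R : realType}.
Implicit Types M v w : R.

Definition clamp M v : R := Num.max (- M) (Num.min M v).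

Lemma clamp_id M v : `|v| <= M -> clamp M v = v.
Proof.
by rewrite ler_norml => /andP[h1 h2]; rewrite /clamp min_r// max_r.
Qed.

Lemma clamp_le M v : 0 <= M -> `|clamp M v| <= M.
Proof.
move=> M0; rewrite /clamp ler_norml le_max lexx/= ge_max; apply/andP; split.
  by rewrite (le_trans _ M0)// oppr_le0.
by rewrite ge_min lexx.
Qed.

Lemma clamp_le_norm M v : 0 <= M -> `|clamp M v| <= `|v|.
Proof.
move=> M0; have [h|h] := leP `|v| M; first by rewrite clamp_id.
by apply: le_trans (clamp_le v M0) _; exact: ltW.
Qed.

Lemma max_lip M v w : `|Num.max M v - Num.max M w| <= `|v - w|.
Proof.
have n1 := ler_norm (v - w); have := ler_norm (w - v); rewrite distrC => n2.
by case: (leP M v) => h1; case: (leP M w) => h2; rewrite ler_norml; apply/andP; split; lra.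
Qed.

Lemma min_lip M v w : `|Num.min M v - Num.min M w| <= `|v - w|.
Proof.
have n1 := ler_norm (v - w); have := ler_norm (w - v); rewrite distrC => n2.
by case: (leP M v) => h1; case: (leP M w) => h2; rewrite ler_norml; apply/andP; split; lra.
Qed.

Lemma clamp_lip M v w : `|clamp M v - clamp M w| <= `|v - w|.
Proof. exact: le_trans (max_lip _ _ _) (min_lip _ _ _). Qed.

Lemma continuous_clamp (T : topologicalType) (m v : T -> R) : continuous m ->
  continuous v -> continuous (fun t => clamp (m t) (v t)).
Proof.
move=> cm cv t.
apply: (@continuous_max R T (fun t => - m t) (fun t => Num.min (m t) (v t)) t).
  by apply: cvgN; exact: cm.
exact: (@continuous_min R T m v t (cm t) (cv t)).
Qed.

End Clamp.

Section TruncatedEquation.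
Context {R : realType}.
Local Notation mu := (@lebesgue_measure R).
Local Notation tau := (pi *+ 2 : R).
Variables (Z : R -> R -> R) (zb Mb : R -> R).
Hypothesis cZ : continuous (fun p : R * R => Z p.1 p.2).
Hypothesis pZ : forall t, periodic (Z t) tau.
Hypothesis czb : continuous zb.
Hypothesis zb_ge0 : forall t, 0 <= zb t.
Hypothesis zb_nd : forall s t, 0 <= s -> s <= t -> zb s <= zb t.
Hypothesis Z_le : forall t x, 0 <= t -> `|Z t x| <= zb t.
Hypothesis cMb : continuous Mb.
Hypothesis Mb_ge0 : forall t, 0 <= Mb t.
Hypothesis Mb_nd : forall s t, 0 <= s -> s <= t -> Mb s <= Mb t.

Let cfst : continuous (@fst R R).
Proof. by move=> p; exact: cvg_fst. Qed.

(** Only the v inside the square is truncated, the linear term being globally Lipschitz already. The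
    level [Mb s] depends on time, so that a single equation covers the whole half-line. *)
Definition truncated_source (n : R -> R -> R) (s x : R) : R :=
  let v := phi_op (n s) x in v + (clamp (Mb s) v + Z s x) ^+ 2.

Local Notation G := truncated_source.

Let nice (n : R -> R -> R) : Prop :=
  continuous (fun p : R * R => n p.1 p.2) /\ forall t, periodic (n t) tau.

Lemma jcont_truncated_source n : continuous (fun p : R * R => n p.1 p.2) ->
  continuous (fun p : R * R => G n p.1 p.2).
Proof.
move=> cn; have ck := jcont_phi_op (T := R) (f := n) cn.
apply: ctsD => //; apply: ctsX; apply: ctsD; last exact: cZ.
by apply: continuous_clamp => //; exact: cts_comp.
Qed.

Lemma truncated_source_periodic n : (forall t, periodic (n t) tau) ->
  forall t, periodic (G n t) tau.
Proof. by move=> pn t x; rewrite /G phi_op_periodic// pZ. Qed.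

Let nice_G n : nice n -> nice (G n).
Proof.
move=> [cn pn]; split; first exact: jcont_truncated_source.
exact: truncated_source_periodic.
Qed.

Let nice_int n : nice n -> nice (fun t x => \int[mu]_(s in `[0, t]) n s x).
Proof.
move=> [cn pn]; split; last by move=> t x; apply: eq_Rintegral => s _; rewrite pn.
have h := @jcont_integral_upto R R (fun x s => n s x) (jcont_swap cn).
exact: (@jcont_swap R (fun x t => \int[mu]_(s in `[0, t]) n s x) h).
Qed.

Let Lip (T : R) : R := 1 + 2 * (Mb T + zb T).

Let Lip_gt0 T : 0 < Lip T.
Proof. by rewrite ltr_pwDl// mulr_ge0// addr_ge0. Qed.

(** The linear term contributes 1. The difference of the squares factors, and the truncated values
    and Z bound the sum factor by 2 (Mb + zb), whatever the size of n and m. *)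
Lemma truncated_source_lip n m s x (B T : R) : continuous (n s) -> continuous (m s) ->
  0 <= s <= T -> (forall y, `|n s y - m s y| <= B) ->
  `|G n s x - G m s x| <= (1 + 2 * (Mb T + zb T)) * B.
Proof.
move=> cn cm /andP[s0 sT] nB.
have vw : `|phi_op (n s) x - phi_op (m s) x| <= B.
  by rewrite -phi_opB//; apply: phi_op_norm_le => //; exact: ctsB.
rewrite /G /=; move: vw; set v := phi_op (n s) x; set w := phi_op (m s) x => vw.
have c1 := le_trans (clamp_lip (Mb s) v w) vw.
have c2 := clamp_le v (Mb_ge0 s); have c3 := clamp_le w (Mb_ge0 s).
have z1 := Z_le x s0; have := zb_nd s0 sT => z2; have m2 := Mb_nd s0 sT.
move: c1 c2 c3; set cv := clamp _ v; set cw := clamp _ w => c1 c2 c3.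
have -> : v + (cv + Z s x) ^+ 2 - (w + (cw + Z s x) ^+ 2) =
  (v - w) + (cv - cw) * (cv + cw + 2 * Z s x) by ring.
have -> : (1 + 2 * (Mb T + zb T)) * B = B + B * (2 * (Mb T + zb T)) by ring.
apply: le_trans (ler_normD _ _) _; apply: lerD => //.
rewrite normrM; apply: ler_pM => //.
apply: le_trans (ler_normD _ _) _; have := ler_normD cv cw.
rewrite normrM ger0_norm//; lra.
Qed.

Fixpoint picard (k : nat) : R -> R -> R :=
  if k is k'.+1 then fun t x => \int[mu]_(s in `[0, t]) G (picard k') s x
  else fun _ _ => 0.

Let nice_picard k : nice (picard k).
Proof.
elim: k => [|k IHk]; last exact/nice_int/nice_G.
by split => //; exact: ctsC.
Qed.

Let nice_cont n s : nice n -> continuous (n s).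
Proof. by move=> [cn _]; exact: (jcont_section (t := s) cn). Qed.

Let nice_slice n x : nice n -> continuous (n ^~ x).
Proof. by move=> [cn _]; exact: (@jcont_section _ _ (fun x s => n s x) x (jcont_swap cn)). Qed.

Let phi_op0 x : phi_op (fun _ : R => 0 : R) x = 0.
Proof.
apply/eqP; rewrite -normr_le0; apply: phi_op_norm_le; first exact: ctsC.
by move=> y; rewrite normr0.
Qed.

Let pos (t : R) : R := Num.max 0 t.

(** [pos] freezes the estimate of [picard_step] at time 0 for t < 0, where all iterates vanish as
    integrals over an empty segment. The Weierstrass test then applies on the whole plane. *)
Let bound (t : R) : R := pos t * zb (pos t) ^+ 2 * expR (2 * Lip (pos t) * pos t).

(** The exponential weight yields a factor 1/2 per iteration on any [0, T], so no smallness of T is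
    required. The constant T zb(T)^2 bounds the first iterate, the time integral of Z^2. *)
Let picard_step k t x (T : R) : 0 <= t <= T ->
  `|picard k.+1 t x - picard k t x| <=
  (T * zb T ^+ 2) * 2^-1 ^+ k * expR (2 * Lip T * t).
Proof.
have L2 : 0 < 2 * Lip T by rewrite mulr_gt0.
elim: k t x => [|k IHk] t x t0T; have /andP[t0 tT] := t0T; have T0 := le_trans t0 tT.
  rewrite expr0 mulr1 /= subr0.
  apply: (@le_trans _ _ (T * zb T ^+ 2)); last first.
    rewrite ler_peMr//; first by rewrite mulr_ge0// sqr_ge0.
    by rewrite -[leLHS]expR0 ler_expR mulr_ge0// (ltW L2).
  apply: (@le_trans _ _ (zb T ^+ 2 * (t - 0))).
    apply: Rintegral_itv_norm_le => //.
      exact: (nice_slice (n := G (picard 0))) (nice_G (nice_picard 0)).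
    move=> s /andP[s0 st]; rewrite /G /= phi_op0 add0r clamp_id ?normr0// add0r normrX.
    rewrite lerXn2r ?nnegrE//; apply: le_trans (Z_le _ s0) _; apply: zb_nd => //.
    exact: le_trans st tT.
  by rewrite subr0 mulrC ler_wpM2r// sqr_ge0.
have c1 := nice_slice (x := x) (nice_G (nice_picard k.+1)).
have c2 := nice_slice (x := x) (nice_G (nice_picard k)).
rewrite -[picard k.+2 t x]/(\int[mu]_(s in `[0, t]) G (picard k.+1) s x).
rewrite -[X in _ - X]/(\int[mu]_(s in `[0, t]) G (picard k) s x).
rewrite -cRintegralB//; apply: le_trans (le_normr_Rintegral _ _) _ => //.
  by apply: continuous_integrable; exact: ctsB.
have ce (c : R) : continuous (fun s => c * expR (2 * Lip T * s)).
  by apply: ctsM; [exact: ctsC|exact: continuous_expRM].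
set C := T * zb T ^+ 2 * 2^-1 ^+ k in IHk.
have C0 : 0 <= C by rewrite /C !mulr_ge0 ?sqr_ge0// exprn_ge0// invr_ge0.
apply: (@le_trans _ _ (\int[mu]_(s in `[0, t]) ((Lip T * C) * expR (2 * Lip T * s)))).
  apply: Rintegral_itv_le => //; first by apply: cts_norm; exact: ctsB.
  move=> s /andP[s0 st]; have s0T : 0 <= s <= T by rewrite s0 (le_trans st).
  rewrite -mulrA; apply: truncated_source_lip => //.
  - exact: nice_cont (nice_picard k.+1).
  - exact: nice_cont (nice_picard k).
  - by move=> y; exact: IHk.
rewrite cRintegralZ; last exact: continuous_expRM.
have LC : 0 <= Lip T * C by rewrite mulr_ge0// ltW.
apply: le_trans (ler_wpM2l LC (Rintegral_expR_le L2 t0)) _.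
rewrite [2^-1 ^+ k.+1]exprS /C le_eqVlt; apply/orP; left; apply/eqP.
by move: (Lip T) (Lip_gt0 T) => l l0; field; rewrite gt_eqF.
Qed.

Let pos_ge0 t : 0 <= pos t.
Proof. by rewrite /pos le_max lexx. Qed.

Let cpos : continuous pos.
Proof.
by move=> t; apply: (@continuous_max R R (fun=> 0) (fun t => t) t); [exact: cvg_cst|exact: cvg_id].
Qed.

Let bound_ge0 t : 0 <= bound t.
Proof. by rewrite /bound !mulr_ge0 ?expR_ge0 ?sqr_ge0. Qed.

Let cbound : continuous (fun p : R * R => bound p.1).
Proof.
apply: (@cts_comp _ _ bound fst); last exact: cfst.
have cz : continuous (fun t => zb (pos t)) by exact: cts_comp.
have cM : continuous (fun t => Mb (pos t)) by exact: cts_comp.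
apply: ctsM.
  by apply: ctsM; [exact: cpos|exact: ctsX].
apply: cts_comp; first exact: continuous_expR.
apply: ctsM; last exact: cpos.
apply: ctsM; first exact: ctsC.
apply: ctsD; first exact: ctsC.
by apply: ctsM; [exact: ctsC|exact: ctsD].
Qed.

Let picard_diff k (p : R * R) : R := picard k.+1 p.1 p.2 - picard k p.1 p.2.

Let picard_diff_le k p : `|picard_diff k p| <= bound p.1 * 2^-1 ^+ k.
Proof.
case: p => t x; rewrite /picard_diff /bound /=.
have [t0|t0] := leP 0 t.
  rewrite /pos max_r//.
  have := @picard_step k t x t; rewrite t0 lexx => /(_ isT) h.
  by apply: le_trans h _; rewrite mulrAC.
have P0 j : picard j t x = 0 by case: j => [//|j] /=; rewrite Rintegral_itv_gt// ltW.
by rewrite -/(picard k.+1 t x) !P0 subrr normr0 mulr_ge0 ?exprn_ge0 ?invr_ge0//; exact: bound_ge0.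
Qed.

Let c_picard_diff k : continuous (picard_diff k).
Proof.
by apply: ctsB; [exact: (proj1 (nice_picard k.+1))|exact: (proj1 (nice_picard k))].
Qed.

Let half_cvg : cvgn (series (fun k => 2^-1 ^+ k : R)).
Proof.
rewrite exprn_geometric; apply/cvgP/cvg_geometric_series.
by rewrite ger0_norm ?invr_ge0// invf_lt1// ltr1n.
Qed.

Definition picard_limit (t x : R) : R := series_sum picard_diff (t, x).

Let half_ge0 k : 0 <= 2^-1 ^+ k :> R.
Proof. by rewrite exprn_ge0// invr_ge0. Qed.

Let picard_sum K p : \sum_(0 <= k < K) picard_diff k p = picard K p.1 p.2.
Proof. by rewrite telescope_sumr// subr0. Qed.

Let picard_approx K t x :
  `|picard_limit t x - picard K t x| <= bound t * series_tail (fun k => 2^-1 ^+ k) K.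
Proof.
have := series_sum_approx (fun p => bound_ge0 p.1) half_ge0 half_cvg picard_diff_le K (t, x).
by rewrite picard_sum.
Qed.

Let picard_cvg t x : picard K t x @[K --> \oo] --> picard_limit t x.
Proof.
rewrite (_ : (fun K => _) = fun K => \sum_(0 <= k < K) picard_diff k (t, x)).
  exact: (is_cvg_series_sum (fun p => bound_ge0 p.1) half_ge0 half_cvg picard_diff_le (x := (t, x))).
by apply/funext => K; rewrite picard_sum.
Qed.

Lemma jcont_picard_limit : continuous (fun p : R * R => picard_limit p.1 p.2).
Proof.
have := continuous_series_sum c_picard_diff cbound (fun p => bound_ge0 p.1) half_ge0 half_cvg picard_diff_le.
by rewrite (_ : (fun p => _) = series_sum picard_diff)//; apply/funext => -[].
Qed.

Lemma picard_limit_periodic t : periodic (picard_limit t) tau.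
Proof.
move=> x; rewrite /picard_limit /series_sum; congr (limn _); apply/funext => K.
by rewrite !picard_sum/=; exact: (proj2 (nice_picard K)).
Qed.

Let bound_nd s t : 0 <= s -> s <= t -> bound s <= bound t.
Proof.
move=> s0 st; have t0 := le_trans s0 st; rewrite /bound /pos !max_r//.
have z1 := zb_nd s0 st; have m1 := Mb_nd s0 st.
apply: ler_pM; rewrite ?expR_ge0 ?mulr_ge0 ?sqr_ge0//.
  by apply: ler_pM; rewrite ?sqr_ge0// lerXn2r ?nnegrE.
rewrite ler_expR; apply: ler_pM => //; first by rewrite mulr_ge0// ltW.
by rewrite /Lip; lra.
Qed.

Lemma picard_limitE t x : 0 <= t ->
  picard_limit t x = \int[mu]_(s in `[0, t]) truncated_source picard_limit s x.
Proof.
move=> t0; have nl : nice picard_limit.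
  by split; [exact: jcont_picard_limit|exact: picard_limit_periodic].
have c1 := nice_slice (x := x) (nice_G nl).
set I := \int[mu]_(s in _) _.
have H K : `|picard K.+1 t x - I| <= t * Lip t * bound t * series_tail (fun k => 2^-1 ^+ k) K.
  have c2 := nice_slice (x := x) (nice_G (nice_picard K)).
  rewrite /I -cRintegralB//.
  rewrite -[leRHS]mulrA -[leRHS]mulrA mulrC -[X in _ * X]subr0.
  apply: Rintegral_itv_norm_le => //; first exact: ctsB.
  move=> s /andP[s0 st]; apply: truncated_source_lip => //.
  - exact: nice_cont (nice_picard K).
  - exact: nice_cont nl.
  - by rewrite s0.
  - move=> y; rewrite distrC; apply: le_trans (picard_approx K s y) _.
    by apply: ler_wpM2r; [exact: series_tail_ge0|exact: bound_nd].
have c2 : (`|picard K.+1 t x - I|) @[K --> \oo] --> `|picard_limit t x - I|.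
  apply: cvg_norm; apply: cvgB; last exact: cvg_cst.
  by have := @picard_cvg t x; rewrite -(cvg_shiftS (fun K => picard K t x)).
have c3 : (t * Lip t * bound t * series_tail (fun k => 2^-1 ^+ k) K) @[K --> \oo] --> (0 : R).
  rewrite -[X in _ --> X](mulr0 (t * Lip t * bound t)); apply: cvgM; first exact: cvg_cst.
  exact: series_tail_cvg0.
apply/eqP; rewrite -subr_eq0 -normr_le0.
by apply: (ler_cvg_to c2 c3); exact: nearW.
Qed.

End TruncatedEquation.

(** * Energy estimate and global solutions *)

Section EnergyEstimate.
Context {R : realType}.
Local Notation mu := (@lebesgue_measure R).
Local Notation tau := (pi *+ 2 : R).

(** h(v) v_x is the derivative of a periodic function: a primitive of h evaluated at v. *)
Lemma mean_comp_derive (h v b : R -> R) : continuous h -> continuous b ->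
  periodic v tau -> (forall x : R, is_derive x 1 v (b x)) ->
  mean (fun x => h (v x) * b x) = 0.
Proof.
move=> ch cb pv dv; have cv := der_continuous dv.
apply: (@mean_derive _ (fun x => primitive h (v x))).
- by move=> x; rewrite pv.
- by apply: ctsM => //; exact: cts_comp.
- by move=> x; apply: der_comp => //; exact: is_derive_primitive.
Qed.

(* The rate of change of the H^1 energy of v, whose time derivative is phi(D) f:
   the terms v and h(v)^2 of f integrate to zero against v_x. *)
Lemma energy_rate_le (v b f zeta h : R -> R) (z : R) :
  continuous b -> continuous zeta -> continuous h -> 0 <= z ->
  periodic v tau -> periodic zeta tau ->
  (forall x : R, is_derive x 1 v (b x)) ->
  (forall x, `|zeta x| <= z) -> (forall w, `|h w| <= `|w|) ->
  (forall x, f x = v x + (h (v x) + zeta x) ^+ 2) ->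
  mean (fun x => 2 * (v x * phi_op f x) + 2 * (b x * (f x - green_op f x))) <=
  (2 * z + z ^+ 2) * (1 + mean (fun x => v x ^+ 2 + b x ^+ 2)).
Proof.
move=> cb cz ch z0 pv pz dv zz hh fE; have cv := der_continuous dv.
have ff : f = fun x => v x + (h (v x) + zeta x) ^+ 2 by apply/funext.
have chv : continuous (fun x => h (v x)) by exact: cts_comp.
have cf : continuous f by rewrite ff; apply: ctsD => //; apply: ctsX; exact: ctsD.
have pf : periodic f tau by move=> x; rewrite !fE pv pz.
have ck := continuous_phi_op cf pf; have cg := continuous_green_op cf pf.
have pk := phi_op_periodic pf; have pg := green_op_periodic pf.
have c2 (g : R -> R) : continuous g -> continuous (fun x => 2 * g x).
  by move=> ?; apply: ctsM => //; exact: ctsC.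
pose r x := 4 * (h (v x) * zeta x * b x) + 2 * (b x * zeta x ^+ 2).
have cr : continuous r.
  apply: ctsD; apply: ctsM; do ?exact: ctsC.
    by apply: ctsM => //; exact: ctsM.
  by apply: ctsM => //; exact: ctsX.
have -> : mean (fun x => 2 * (v x * phi_op f x) + 2 * (b x * (f x - green_op f x))) = mean r.
  (* q1 is the x-derivative of v (1 - d^2/dx^2)^{-1} f and q2 is (v + h(v)^2) v_x. Both have mean
     zero, and r is what is left of 2 v_x f. *)
  pose q1 x := v x * (- phi_op f x) + green_op f x * b x.
  pose q2 x := (v x + h (v x) ^+ 2) * b x.
  have cq1 : continuous q1 by apply: ctsD; apply: ctsM => //; exact: ctsN.
  have cq2 : continuous q2 by apply: ctsM => //; apply: ctsD => //; exact: ctsX.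
  rewrite (_ : (fun _ => _) = fun x => 2 * q2 x - 2 * q1 x + r x); last first.
    by apply/funext => x; rewrite /q1 /q2 /r fE; ring.
  rewrite meanD ?meanB ?meanZ//; do ?[exact: c2|by apply: ctsB; exact: c2].
  have -> : mean q1 = 0.
    apply: (@mean_derive _ (fun x => v x * green_op f x)) => //.
      by move=> x; rewrite pv pg.
    by move=> x; apply: derM => //; exact: is_derive_green_op.
  have -> : mean q2 = 0.
    apply: (@mean_comp_derive (fun w => w + h w ^+ 2)) => //.
    by apply: ctsD; [move=> w; exact: cvg_id|exact: ctsX].
  by rewrite mulr0 subrr add0r.
have cE : continuous (fun x => v x ^+ 2 + b x ^+ 2) by apply: ctsD; exact: ctsX.
have c1E : continuous (fun x => 1 + (v x ^+ 2 + b x ^+ 2)).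
  by apply: ctsD => //; exact: ctsC.
have -> : (2 * z + z ^+ 2) * (1 + mean (fun x => v x ^+ 2 + b x ^+ 2)) =
    mean (fun x => (2 * z + z ^+ 2) * (1 + (v x ^+ 2 + b x ^+ 2))).
  by rewrite (meanZ _ c1E) (meanD (@ctsC R R 1) cE) mean_cst.
apply: mean_le => //; first by apply: ctsM => //; exact: ctsC.
move=> x; rewrite /r.
(* The rate arises as 4 h(v) zeta v_x <= 2 z (v^2 + v_x^2) and 2 v_x zeta^2 <= z^2 (1 + v_x^2). *)
have a1 : h (v x) * zeta x * b x <= z * (`|v x| * `|b x|).
  apply: le_trans (ler_norm _) _; rewrite !normrM mulrAC [leRHS]mulrC.
  by apply: ler_pM => //; exact: ler_wpM2r.
have a2 : b x * zeta x ^+ 2 <= z ^+ 2 * `|b x|.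
  apply: le_trans (ler_norm _) _; rewrite normrM normrX mulrC.
  by apply: ler_wpM2r => //; rewrite lerXn2r ?nnegrE.
have b1 : 2 * (`|v x| * `|b x|) <= v x ^+ 2 + b x ^+ 2.
  have := sqr_ge0 (`|v x| - `|b x|).
  by rewrite sqrrB -!normrX !(ger0_norm (sqr_ge0 _)) => h0; lra.
have b2 : 2 * `|b x| <= 1 + b x ^+ 2.
  by have := sqr_ge0 (1 - `|b x|); rewrite sqrrB -!normrX (ger0_norm (sqr_ge0 _)) => h0; lra.
have v2 := sqr_ge0 (v x); have z2 := sqr_ge0 z.
have := ler_wpM2l z0 b1; have := ler_wpM2l z2 b2; have := mulr_ge0 z2 v2.
move=> e1 e2 e3; lra.
Qed.

(** The bound |v(y)| <= |v(w)| + int |v_x| is averaged over w. Using |g| <= 1 + g^2 in place of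
    Cauchy-Schwarz makes the result linear in 1 + energy, the quantity that Gronwall's lemma
    controls. *)
Lemma sup_le_energy (v b : R -> R) : continuous b -> periodic v tau ->
  (forall x : R, is_derive x 1 v (b x)) ->
  forall x, `|v x| <= (1 + tau) * (1 + mean (fun x => v x ^+ 2 + b x ^+ 2)).
Proof.
move=> cb pv dv x; have cv := der_continuous dv; have t0 := @tau_gt0 R.
have [y /andP[y0 yt] ->//] := periodic_reduce x.
have ca := cts_norm cb; have cav := cts_norm cv.
have H w : 0 <= w <= tau -> `|v y| <= `|v w| + tau * mean (fun x => `|b x|).
  move=> /andP[w0 wt].
  have E : tau * mean (fun x => `|b x|) = \int[mu]_(x in `[0, tau]) `|b x|.
    by rewrite /mean mulrA divff ?mul1r// gt_eqF.
  rewrite E; suff : `|v y - v w| <= \int[mu]_(x in `[0, tau]) `|b x|.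
    move=> h; have -> : v y = v w + (v y - v w) by rewrite addrC subrK.
    by apply: le_trans (ler_normD _ _) _; rewrite lerD2l.
  have sub a c : 0 <= a -> a <= c -> c <= tau ->
      `|v c - v a| <= \int[mu]_(x in `[0, tau]) `|b x|.
    move=> a0 ac ct; rewrite -(Rintegral_itv_FTC2 ac cb dv).
    apply: le_trans (le_normr_Rintegral _ _) _ => //; first exact: continuous_integrable.
    rewrite (Rintegral_itv_split ca (le_trans a0 ac) ct) (Rintegral_itv_split ca a0 ac).
    rewrite -addrA addrCA lerDl addr_ge0//; apply: Rintegral_ge0 => *; exact: normr_ge0.
  have [yw|yw] := leP y w; last by apply: sub => //; exact: ltW.
  by rewrite distrC; exact: sub.
have h1 : `|v y| <= mean (fun x => `|v x|) + tau * mean (fun x => `|b x|).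
  have cB := @ctsC R R (tau * mean (fun x => `|b x|)).
  rewrite -(mean_cst `|v y|) -[X in _ + X](mean_cst (tau * mean (fun x => `|b x|))) -meanD//.
  rewrite /mean ler_wpM2l ?invr_ge0 ?(ltW t0)//; apply: Rintegral_itv_le => //.
    exact: ctsC.
  by apply: ctsD => //; exact: ctsC.
have c2 : continuous (fun x => v x ^+ 2 + b x ^+ 2) by apply: ctsD; exact: ctsX.
have c3 : continuous (fun x => 1 + (v x ^+ 2 + b x ^+ 2)) by apply: ctsD => //; exact: ctsC.
have ab (g : R) : `|g| <= 1 + g ^+ 2.
  have := sqr_ge0 (1 - `|g|); rewrite sqrrB -!normrX (ger0_norm (sqr_ge0 g)).
  by have := sqr_ge0 g; lra.
have h2 : mean (fun x => `|v x|) <= 1 + mean (fun x => v x ^+ 2 + b x ^+ 2).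
  rewrite -[X in X + _](mean_cst 1) -meanD//; last exact: ctsC.
  apply: mean_le => // w; apply: le_trans (ab _) _.
  by rewrite lerD2l lerDl sqr_ge0.
have h3 : mean (fun x => `|b x|) <= 1 + mean (fun x => v x ^+ 2 + b x ^+ 2).
  rewrite -[X in X + _](mean_cst 1) -meanD//; last exact: ctsC.
  apply: mean_le => // w; apply: le_trans (ab _) _.
  by rewrite lerD2l lerDr sqr_ge0.
apply: le_trans h1 _; set e := 1 + _ in h2 h3 *.
have -> : (1 + tau) * e = e + tau * e by ring.
by apply: lerD => //; rewrite ler_wpM2l// ltW.
Qed.

End EnergyEstimate.

Lemma mean_Rintegral {R : realType} (F : R -> R -> R) t : 0 <= t ->
  continuous (fun p : R * R => F p.1 p.2) ->
  mean (fun x => \int[@lebesgue_measure R]_(s in `[0, t]) F s x) =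
  \int[@lebesgue_measure R]_(s in `[0, t]) mean (F s).
Proof.
move=> t0 cF; rewrite /mean cRintegralZ; last exact: (@jcont_integral _ _ F).
by congr (_ * _); rewrite (jcont_Fubini _ _ t0 cF).
Qed.

(** G is known only at nonnegative times. There it agrees with [primitive g], which is
    differentiable on the whole line, so that the square can be differentiated without one-sided
    derivatives at 0. *)
Lemma sqr_Rintegral {R : realType} (g G : R -> R) (t : R) : 0 <= t -> continuous g ->
  (forall s, 0 <= s -> G s = \int[@lebesgue_measure R]_(r in `[0, s]) g r) ->
  G t ^+ 2 = \int[@lebesgue_measure R]_(s in `[0, t]) (2 * (G s * g s)).
Proof.
move=> t0 cg GE; pose P := primitive g.
have GP s : 0 <= s -> G s = P s by move=> s0; rewrite GE// -primitiveB// primitive0 subr0.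
have dP (s : R) : is_derive s 1 P (g s) by exact: is_derive_primitive.
have cP := der_continuous dP.
have dP2 (s : R) : is_derive s 1 (fun s => P s * P s) (2 * (P s * g s)).
  by have h := derM (dP s) (dP s); apply: der_eq h _; ring.
have c2 : continuous (fun s => 2 * (P s * g s)).
  by apply: ctsM; [exact: ctsC|exact: ctsM].
transitivity (\int[@lebesgue_measure R]_(s in `[0, t]) (2 * (P s * g s))).
  by rewrite (Rintegral_itv_FTC2 t0 c2 dP2) GP// /P primitive0 mulr0 subr0 expr2.
by apply: eq_Rintegral => s; rewrite inE/= in_itv/= => /andP[s0 _]; rewrite GP.
Qed.

Section GlobalSolution.
Context {R : realType}.
Local Notation mu := (@lebesgue_measure R).
Local Notation tau := (pi *+ 2 : R).
Variables (Z : R -> R -> R) (zb : R -> R).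
Hypothesis cZ : continuous (fun p : R * R => Z p.1 p.2).
Hypothesis pZ : forall t, periodic (Z t) tau.
Hypothesis czb : continuous zb.
Hypothesis zb_ge0 : forall t, 0 <= zb t.
Hypothesis zb_nd : forall s t, 0 <= s -> s <= t -> zb s <= zb t.
Hypothesis Z_le : forall t x, 0 <= t -> `|Z t x| <= zb t.

(* The a priori bound for the sup norm; truncating the nonlinearity at this
   level does not change the solution. *)
Let rate t : R := 2 * zb t + zb t ^+ 2.
Let Mb t : R := (1 + tau) * expR (rate t * t).

Let rate_ge0 t : 0 <= rate t.
Proof. by rewrite addr_ge0 ?sqr_ge0// mulr_ge0. Qed.

Let crate : continuous rate.
Proof. by apply: ctsD; [apply: ctsM => //; exact: ctsC|exact: ctsX]. Qed.

Let cMb : continuous Mb.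
Proof.
apply: ctsM; first exact: ctsC.
apply: cts_comp; first exact: continuous_expR.
by apply: ctsM => //; move=> t; exact: cvg_id.
Qed.

Let tau1_ge0 : 0 <= 1 + tau.
Proof. by rewrite addr_ge0// ltW// tau_gt0. Qed.

Let Mb_ge0 t : 0 <= Mb t.
Proof. by rewrite mulr_ge0 ?expR_ge0. Qed.

Let rate_nd s t : 0 <= s -> s <= t -> rate s <= rate t.
Proof.
move=> s0 st; have h := zb_nd s0 st; rewrite /rate lerD ?ler_wpM2l//.
by rewrite lerXn2r ?nnegrE.
Qed.

Let Mb_nd s t : 0 <= s -> s <= t -> Mb s <= Mb t.
Proof.
by move=> s0 st; rewrite /Mb ler_wpM2l// ler_expR ler_pM// rate_nd.
Qed.

Let n := picard_limit Z Mb.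
Let N := truncated_source Z Mb n.
Let v t x : R := phi_op (n t) x.
(** This is v_x, by [is_derive_phi_op]. *)
Let b t x : R := n t x - green_op (n t) x.

Let cn : continuous (fun p : R * R => n p.1 p.2).
Proof. exact: (jcont_picard_limit cZ pZ czb zb_ge0 zb_nd Z_le cMb Mb_ge0 Mb_nd). Qed.

Let pn t : periodic (n t) tau.
Proof. exact: (picard_limit_periodic cZ pZ cMb). Qed.

Let nE t x : 0 <= t -> n t x = \int[mu]_(s in `[0, t]) N s x.
Proof. exact: (picard_limitE cZ pZ czb zb_ge0 zb_nd Z_le cMb Mb_ge0 Mb_nd). Qed.

Let cN : continuous (fun p : R * R => N p.1 p.2).
Proof. exact: (jcont_truncated_source cZ cMb cn). Qed.

Let pN t : periodic (N t) tau.
Proof. by apply: truncated_source_periodic. Qed.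

Let cnt t : continuous (n t) := jcont_section (t := t) cn.
Let cv : continuous (fun p : R * R => v p.1 p.2).
Proof. exact: (jcont_phi_op (T := R) (f := n) cn). Qed.

Let cb : continuous (fun p : R * R => b p.1 p.2).
Proof. by apply: ctsB => //; exact: (jcont_green_op (T := R) (f := n) cn). Qed.

Let cvt t : continuous (v t) := jcont_section (t := t) cv.
Let cbt t : continuous (b t) := jcont_section (t := t) cb.

Let pv t : periodic (v t) tau.
Proof. exact: phi_op_periodic. Qed.

Let dv t (x : R) : is_derive x 1 (v t) (b t x).
Proof. exact: is_derive_phi_op. Qed.

Let nfun t : 0 <= t -> n t = fun x => \int[mu]_(s in `[0, t]) N s x.
Proof. by move=> t0; apply/funext => x; exact: nE. Qed.

Let vE t x : 0 <= t -> v t x = \int[mu]_(s in `[0, t]) phi_op (N s) x.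
Proof. by move=> t0; rewrite /v nfun// phi_op_Rintegral. Qed.

Let bE t x : 0 <= t ->
  b t x = \int[mu]_(s in `[0, t]) (N s x - green_op (N s) x).
Proof.
move=> t0; have cg := jcont_green_op (T := R) (f := N) cN.
rewrite cRintegralB; [|exact: jcont_slice|exact: (jcont_slice (F := fun s => green_op (N s)))].
by rewrite /b nfun// green_op_Rintegral.
Qed.

Let E t : R := mean (fun x => v t x ^+ 2 + b t x ^+ 2).

Let cE : continuous E.
Proof.
apply: ctsM; first exact: ctsC.
apply: (@jcont_integral _ _ (fun t x => v t x ^+ 2 + b t x ^+ 2)).
by apply: ctsD; exact: ctsX.
Qed.

Let H s x : R := 2 * (v s x * phi_op (N s) x) + 2 * (b s x * (N s x - green_op (N s) x)).

Let cH : continuous (fun p : R * R => H p.1 p.2).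
Proof.
apply: ctsD; apply: ctsM; do ?exact: ctsC; apply: ctsM => //.
  exact: (jcont_phi_op (T := R) (f := N) cN).
by apply: ctsB => //; exact: (jcont_green_op (T := R) (f := N) cN).
Qed.

(** For fixed x both v and v_x are time integrals, so [sqr_Rintegral] turns the energy density into
    a time integral; averaging in x then commutes with it. No time derivative of v as a
    function-valued path is taken. *)
Let EE t : 0 <= t -> E t = \int[mu]_(s in `[0, t]) mean (H s).
Proof.
move=> t0; have c1 := jcont_slice (F := fun s => phi_op (N s)) (jcont_phi_op (T := R) (f := N) cN).
have c2 x : continuous (fun s => N s x - green_op (N s) x).
  apply: ctsB; first exact: jcont_slice.
  exact: (jcont_slice (F := fun s => green_op (N s)) (jcont_green_op (T := R) (f := N) cN)).
have -> : E t = mean (fun x => \int[mu]_(s in `[0, t]) H s x).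
  congr mean; apply/funext => x.
  rewrite (@sqr_Rintegral _ (fun s => phi_op (N s) x) (fun s => v s x))//; last by move=> s s0; exact: vE.
  rewrite (@sqr_Rintegral _ (fun s => N s x - green_op (N s) x) (fun s => b s x))//; last by move=> s s0; exact: bE.
  rewrite -cRintegralD//; (apply: ctsM; [exact: ctsC|apply: ctsM => //; exact: jcont_slice]).
exact: mean_Rintegral.
Qed.

Let E_rate s : 0 <= s -> mean (H s) <= rate s * (1 + E s).
Proof.
move=> s0; apply: (@energy_rate_le R (v s) (b s) (N s) (Z s) (clamp (Mb s))) => //.
- exact: (jcont_section (t := s) cZ).
- by apply: continuous_clamp; [exact: ctsC|move=> w; exact: cvg_id].
- by move=> x; exact: Z_le.
- by move=> w; exact: clamp_le_norm.
Qed.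

(** The rate varies with time but is nondecreasing, so on [0, t] it is replaced by its final value
    before Gronwall's lemma is applied. *)
Let E_bound t : 0 <= t -> 1 + E t <= expR (rate t * t).
Proof.
move=> t0; apply: (@Gronwall_exp R E t (rate t)) => //; last by rewrite t0 lexx.
move=> s /andP[s0 st]; rewrite EE//; apply: Rintegral_itv_le.
- apply: ctsM; first exact: ctsC.
  exact: (@jcont_integral _ _ H).
- by apply: ctsM; [exact: ctsC|apply: ctsD => //; exact: ctsC].
- move=> r /andP[r0 rs]; apply: le_trans (E_rate r0) _.
  have E0 : 0 <= E r.
    rewrite -(mean_cst 0); apply: mean_le; first exact: ctsC.
      by apply: ctsD; exact: ctsX.
    by move=> x; rewrite addr_ge0 ?sqr_ge0.
  by apply: ler_wpM2r; [rewrite addr_ge0|apply: rate_nd => //; exact: le_trans st].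
Qed.

(** [Mb] was defined as the composition of [sup_le_energy] with [E_bound]. Both hold for the
    truncated equation, so [clamp] acts as the identity on its solution, which therefore solves the
    original equation. *)
Let v_bound t x : 0 <= t -> `|v t x| <= Mb t.
Proof.
move=> t0; apply: le_trans (sup_le_energy (@cbt t) (@pv t) (@dv t) x) _.
by rewrite /Mb ler_wpM2l// E_bound.
Qed.

Theorem BBM_source_exists : exists n : R -> R -> R,
  [/\ continuous (fun p : R * R => n p.1 p.2), forall t, periodic (n t) tau &
   forall t x, 0 <= t -> n t x =
     \int[mu]_(s in `[0, t]) (phi_op (n s) x + (phi_op (n s) x + Z s x) ^+ 2)].
Proof.
exists n; split => // t x t0; rewrite nE//; apply: eq_Rintegral => s.
rewrite inE/= in_itv/= => /andP[s0 _].
by rewrite /N /truncated_source -/(v s x) clamp_id// v_bound.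
Qed.

Theorem BBM_source_unique (n1 n2 : R -> R -> R) :
  (forall t x, 0 <= t -> n1 t x =
     \int[mu]_(s in `[0, t]) (phi_op (n1 s) x + (phi_op (n1 s) x + Z s x) ^+ 2)) ->
  (forall t x, 0 <= t -> n2 t x =
     \int[mu]_(s in `[0, t]) (phi_op (n2 s) x + (phi_op (n2 s) x + Z s x) ^+ 2)) ->
  continuous (fun p : R * R => n1 p.1 p.2) -> (forall t, periodic (n1 t) tau) ->
  continuous (fun p : R * R => n2 p.1 p.2) -> (forall t, periodic (n2 t) tau) ->
  forall t x, 0 <= t -> n1 t x = n2 t x.
Proof.
move=> e1 e2 c1 p1 c2 p2 t x t0.
have [B1 B10 hB1] := @jcont_bounded R n1 t c1 p1.
have [B2 B20 hB2] := @jcont_bounded R n2 t c2 p2.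
have k1 := jcont_phi_op (T := R) (f := n1) c1; have k2 := jcont_phi_op (T := R) (f := n2) c2.
have s1 := jcont_slice (F := fun s => phi_op (n1 s)) k1.
have s2 := jcont_slice (F := fun s => phi_op (n2 s)) k2.
(* The Lipschitz constant of the untruncated source on the range of the two solutions; as phi(D)
   does not increase sup norms, B1 and B2 also bound the two functions inside the squares. *)
pose L := 1 + (B1 + B2 + 2 * zb t).
have L0 : 0 < L by rewrite ltr_pwDl// !addr_ge0// mulr_ge0.
suff : n1 t x - n2 t x = 0 by move/eqP; rewrite subr_eq0 => /eqP.
apply: (@Gronwall_zero R t L (B1 + B2) (fun t x => n1 t x - n2 t x)) => //.
- exact: addr_ge0.
- move=> s y st; apply: le_trans (ler_normB _ _) _.
  by apply: lerD; [exact: hB1|exact: hB2].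
- move=> h ch dh s y /andP[s0 st].
  have cNN (m : R -> R -> R) : (forall y, continuous (fun s => phi_op (m s) y)) ->
      continuous (fun r => phi_op (m r) y + (phi_op (m r) y + Z r y) ^+ 2).
    by move=> cm; apply: ctsD => //; apply: ctsX; apply: ctsD => //; exact: jcont_slice.
  rewrite e1// e2// -cRintegralB; [|exact: cNN..].
  apply: le_trans (le_normr_Rintegral _ _) _ => //.
    by apply: continuous_integrable; apply: ctsB; exact: cNN.
  rewrite -cRintegralZ//; apply: Rintegral_itv_le.
  + by apply: cts_norm; apply: ctsB; exact: cNN.
  + by apply: ctsM => //; exact: ctsC.
  move=> r /andP[r0 rs]; have rt := le_trans rs st.
  have r0t : 0 <= r <= t by rewrite r0.
  have cr1 := jcont_section (t := r) c1; have cr2 := jcont_section (t := r) c2.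
  have vw : `|phi_op (n1 r) y - phi_op (n2 r) y| <= h r.
    rewrite -phi_opB//; apply: phi_op_norm_le => //; first exact: ctsB.
    by move=> z; exact: dh.
  have b1 : `|phi_op (n1 r) y| <= B1 by apply: phi_op_norm_le => // z; exact: hB1.
  have b2 : `|phi_op (n2 r) y| <= B2 by apply: phi_op_norm_le => // z; exact: hB2.
  have z1 := Z_le y r0; have z2 := zb_nd r0 rt.
  move: vw b1 b2; set V := phi_op _ _; set W := phi_op _ _ => vw b1 b2.
  have -> : V + (V + Z r y) ^+ 2 - (W + (W + Z r y) ^+ 2) =
    (V - W) * (1 + (V + W + 2 * Z r y)) by ring.
  rewrite normrM mulrC; apply: ler_pM => //.
  apply: le_trans (ler_normD _ _) _; rewrite normr1 lerD2l.
  apply: le_trans (ler_normD _ _) _; rewrite normrM ger0_norm//.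
  have := ler_normD V W; lra.
- by rewrite t0 lexx.
Qed.

End GlobalSolution.

(** * Duhamel formula and paths in H^1 *)

Section Duhamel.
Context {R : realType}.
Local Notation mu := (@lebesgue_measure R).
Variables (al : R) (q1 q2 : R -> R).
Hypothesis cq1 : continuous q1.
Hypothesis cq2 : continuous q2.

Let co s : R := cos (al * s).
Let si s : R := sin (al * s).

Let cco : continuous co.
Proof. by apply: cts_comp; [exact: continuous_cos|exact: mulrl_continuous]. Qed.

Let csi : continuous si.
Proof. by apply: cts_comp; [exact: continuous_sin|exact: mulrl_continuous]. Qed.

Let dlin (s : R) := derZ al (is_derive_id s (1 : R)).

Let dco (s : R) : is_derive s 1 co (- (al * si s)).
Proof.
have h := @der_comp _ (fun s : R => al * s) cos s _ _ (is_derive_cos (al * s)) (dlin s).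
by apply: der_eq h _; rewrite /si mulr1 mulNr mulrC.
Qed.

Let dsi (s : R) : is_derive s 1 si (al * co s).
Proof.
have h := @der_comp _ (fun s : R => al * s) sin s _ _ (is_derive_sin (al * s)) (dlin s).
by apply: der_eq h _; rewrite /co mulr1 mulrC.
Qed.

Let a s := co s * q1 s + si s * q2 s.
Let b s := co s * q2 s - si s * q1 s.
Let ca : continuous a. Proof. by apply: ctsD; exact: ctsM. Qed.
Let cb : continuous b. Proof. by apply: ctsB; exact: ctsM. Qed.

(* Real and imaginary part of e^(i al t) \int_0^t e^(- i al s) (q1 + i q2)(s) ds. *)
Definition duhamel_re t : R := co t * primitive a t - si t * primitive b t.
Definition duhamel_im t : R := si t * primitive a t + co t * primitive b t.

Let d_re (t : R) : is_derive t 1 duhamel_re (- (al * duhamel_im t) + q1 t).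
Proof.
have h := derB (derM (dco t) (is_derive_primitive t ca)) (derM (dsi t) (is_derive_primitive t cb)).
apply: der_eq h _; rewrite /duhamel_im /a /b.
have := cos2Dsin2 (al * t); rewrite -/(co t) -/(si t) => cs.
by rewrite -[X in _ = _ + X]mul1r -cs; ring.
Qed.

Let d_im (t : R) : is_derive t 1 duhamel_im (al * duhamel_re t + q2 t).
Proof.
have h := derD (derM (dsi t) (is_derive_primitive t ca)) (derM (dco t) (is_derive_primitive t cb)).
apply: der_eq h _; rewrite /duhamel_re /a /b.
have := cos2Dsin2 (al * t); rewrite -/(co t) -/(si t) => cs.
by rewrite -[X in _ = _ + X]mul1r -cs; ring.
Qed.

Lemma continuous_duhamel_re : continuous duhamel_re.
Proof. exact: der_continuous d_re. Qed.

Lemma continuous_duhamel_im : continuous duhamel_im.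
Proof. exact: der_continuous d_im. Qed.

Lemma duhamel_re_ode t : 0 <= t -> duhamel_re t =
  \int[mu]_(s in `[0, t]) (- (al * duhamel_im s) + q1 s).
Proof.
move=> t0; rewrite (Rintegral_itv_FTC2 t0 _ d_re).
  by rewrite /duhamel_re !primitive0 !mulr0 subrr subr0.
apply: ctsD => //; apply: ctsN; apply: ctsM; first exact: ctsC.
exact: continuous_duhamel_im.
Qed.

Lemma duhamel_im_ode t : 0 <= t -> duhamel_im t =
  \int[mu]_(s in `[0, t]) (al * duhamel_re s + q2 s).
Proof.
move=> t0; rewrite (Rintegral_itv_FTC2 t0 _ d_im).
  by rewrite /duhamel_im !primitive0 !mulr0 addr0 subr0.
apply: ctsD => //; apply: ctsM; first exact: ctsC.
exact: continuous_duhamel_re.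
Qed.

Lemma Cintegral_duhamel t : 0 <= t ->
  Cintegral `[0, t] (fun s => cexp ((t - s)%:C%C * Complex 0 al) * Complex (q1 s) (q2 s)) =
  Complex (duhamel_re t) (duhamel_im t).
Proof.
move=> t0.
have P (g : R -> R) : continuous g -> primitive g t = \int[mu]_(s in `[0, t]) g s.
  by move=> cg; rewrite -primitiveB// primitive0 subr0.
have cZ (c : R) (g : R -> R) : continuous g -> continuous (fun s => c * g s).
  by move=> cg; apply: ctsM => //; exact: ctsC.
rewrite /Cintegral; congr Complex.
  rewrite /duhamel_re !P// -!cRintegralZ// -cRintegralB; do ?exact: cZ.
  apply: eq_Rintegral => s _; rewrite !cparts/= !mulr0 !mul0r subrr addr0 expR0 !mul1r.
  by rewrite [(t - s) * al]mulrC mulrBr cosB sinB -/(co t) -/(co s) -/(si t) -/(si s) /a /b; ring.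
rewrite /duhamel_im !P// -!cRintegralZ// -cRintegralD; do ?exact: cZ.
apply: eq_Rintegral => s _; rewrite !cparts/= !mulr0 !mul0r subrr addr0 expR0 !mul1r.
by rewrite [(t - s) * al]mulrC mulrBr cosB sinB -/(co t) -/(co s) -/(si t) -/(si s) /a /b; ring.
Qed.

(** The difference of two solutions obeys the homogeneous equation c' = i al c, a rotation, which
    preserves d1^2 + d2^2. *)
Lemma duhamel_ode_unique (c1 c2 : R -> R) : continuous c1 -> continuous c2 ->
  (forall t, 0 <= t -> c1 t = \int[mu]_(s in `[0, t]) (- (al * c2 s) + q1 s)) ->
  (forall t, 0 <= t -> c2 t = \int[mu]_(s in `[0, t]) (al * c1 s + q2 s)) ->
  forall t, 0 <= t -> c1 t = duhamel_re t /\ c2 t = duhamel_im t.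
Proof.
move=> cc1 cc2 e1 e2 t t0.
pose d1 t := c1 t - duhamel_re t; pose d2 t := c2 t - duhamel_im t.
have cd1 : continuous d1 by apply: ctsB => //; exact: continuous_duhamel_re.
have cd2 : continuous d2 by apply: ctsB => //; exact: continuous_duhamel_im.
have cZ (c : R) (g : R -> R) : continuous g -> continuous (fun s => c * g s).
  by move=> cg; apply: ctsM => //; exact: ctsC.
have g1 s : 0 <= s -> d1 s = \int[mu]_(r in `[0, s]) (- al * d2 r).
  move=> s0; rewrite /d1 e1// duhamel_re_ode// -cRintegralB.
  - by apply: eq_Rintegral => r _; rewrite /d2; ring.
  - by apply: ctsD => //; apply: ctsN; exact: cZ.
  - apply: ctsD => //; apply: ctsN; apply: cZ; exact: continuous_duhamel_im.
have g2 s : 0 <= s -> d2 s = \int[mu]_(r in `[0, s]) (al * d1 r).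
  move=> s0; rewrite /d2 e2// duhamel_im_ode// -cRintegralB.
  - by apply: eq_Rintegral => r _; rewrite /d1; ring.
  - by apply: ctsD => //; exact: cZ.
  - by apply: ctsD => //; apply: cZ; exact: continuous_duhamel_re.
have h1 := sqr_Rintegral t0 (cZ (- al) _ cd2) g1.
have h2 := sqr_Rintegral t0 (cZ al _ cd1) g2.
have : d1 t ^+ 2 + d2 t ^+ 2 = 0.
  have c21 : continuous (fun s => 2 * (d2 s * (al * d1 s))).
    by apply: ctsM; [exact: ctsC|apply: ctsM => //; apply: cZ].
  have c12 : continuous (fun s => 2 * (d1 s * (- al * d2 s))).
    by apply: ctsM; [exact: ctsC|apply: ctsM => //; apply: cZ].
  rewrite h1 h2 -cRintegralD//.
  rewrite (@eq_Rintegral _ _ _ mu _ (fun=> 0)); last by move=> s _; ring.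
  by rewrite Rintegral_itv_cst// mul0r.
move=> /eqP; rewrite paddr_eq0 ?sqr_ge0// !sqrf_eq0 !subr_eq0 => /andP[/eqP ? /eqP ?].
by split.
Qed.

End Duhamel.

Section TrigonometricSeries.
Context {R : realType}.
Local Notation mu := (@lebesgue_measure R).
Local Notation tau := (pi *+ 2 : R).
Implicit Types (f g : R -> R) (a : nat -> R[i]).

(* The real trigonometric polynomial with coefficients a_n and conj(a_n) at n
   and -n, for 0 < n < K, and Re a_0 at 0. *)
Definition tpoly a (K : nat) (x : R) : R :=
  complex.Re (a 0%N) + \sum_(1 <= n < K) tmode (a n) n x.

(** Coefficients of a real function: those at negative frequencies are conjugates of the given
    ones. *)
Definition hermitian a (m : int) : R[i] :=
  if m is Posz n then a n else conjc (a `|m|%N).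

Lemma continuous_tpoly a K : continuous (tpoly a K).
Proof.
apply: ctsD; first exact: ctsC.
by apply: continuous_sum => n; exact: continuous_tmode.
Qed.

Lemma tpoly_periodic a K : periodic (tpoly a K) tau.
Proof. by move=> x; rewrite /tpoly; congr (_ + _); apply: eq_bigr => n _; rewrite tmode_periodic. Qed.

Lemma fourier_cst (c : R) m : fourier (fun=> c) m = Complex (c * (m == 0)%:R) 0.
Proof.
rewrite fourierE; last by apply: torus_L1_continuous => //; exact: ctsC.
rewrite !meanZ; [|exact: continuous_sinn|exact: continuous_cosn].
by rewrite mean_cosn mean_sinn mulr0 oppr0.
Qed.

Lemma fourier_tpoly a K m : complex.Im (a 0%N) = 0 -> (`|m| < K)%N ->
  fourier (tpoly a K) m = hermitian a m.
Proof.
move=> a0 mK; rewrite fourierD; first last.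
- by apply: torus_L1_sum => n; exact: torus_L1_tmode.
- by apply: torus_L1_continuous => //; exact: ctsC.
rewrite fourier_cst fourier_sum; last by move=> n; exact: torus_L1_tmode.
have [->|m0] := eqVneq m 0.
  rewrite /= mulr1 big1_seq ?addr0; first by apply: complex_ext.
  move=> n; rewrite mem_index_iota lt0n => /andP[_ /andP[/negbTE n0 _]].
  by rewrite fourier_tmode oppr0 eqz_nat n0 subrr addr0 !mulr0; exact: complex_ext.
rewrite mulr0 (bigD1_seq `|m|%N)/=; last 2 first.
- by rewrite mem_index_iota mK andbT absz_gt0.
- exact: iota_uniq.
rewrite big1_seq => [|n /andP[nm]]; last first.
  rewrite mem_index_iota => /andP[n1 _]; rewrite fourier_tmode.
  have -> : (n%:Z == m) = false by apply: contraNF nm => /eqP <-.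
  have -> : (n%:Z == - m) = false.
    by apply: contraNF nm => /eqP nm; rewrite -[m]opprK -nm abszN.
  by rewrite subrr addr0 !mulr0.
rewrite addr0 fourier_tmode; case: m m0 mK => n n0 nK /=.
  rewrite eqxx.
  have -> : (n%:Z == - n%:Z) = false.
    by apply/negbTE; move: n0; case: n nK => // n _ _.
  by apply: complex_ext => /=; rewrite ?add0r ?subr0 ?addr0 mulr1.
rewrite NegzE opprK eqxx.
by case: (a n.+1) => x y; apply: complex_ext => /=; rewrite !add0r ?mulr1// mulrN1.
Qed.

(** Approximation is asked only of some arbitrarily long partial sums. This covers both complete
    partial sums and those cut at powers of 2. *)
Lemma fourier_tseries a f : continuous f -> periodic f tau -> complex.Im (a 0%N) = 0 ->
  (forall (e : R) (m : nat), 0 < e -> exists2 K : nat, (m < K)%N &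
     forall x, `|f x - tpoly a K x| <= e) ->
  fourier f = hermitian a.
Proof.
move=> cf pf a0 H; apply/funext => m; apply: fourier_limit => // e e0.
have [K mK HK] := H e `|m|%N e0.
exists (tpoly a K); split => //; first exact: continuous_tpoly.
  exact: tpoly_periodic.
exact: fourier_tpoly.
Qed.

Lemma sum_inv_sqr_le (K : nat) : \sum_(1 <= n < K) (1 + n%:R ^+ 2)^-1 <= 2 :> R.
Proof.
(* Induction against a telescoping majorant, whose increment 2 / (x (x + 1)) exceeds 1 / (1 +
   x^2). *)
have H k : \sum_(1 <= n < k.+1) (1 + n%:R ^+ 2)^-1 <= 2 - 2 / k.+1%:R :> R.
  elim: k => [|k IHk]; first by rewrite big_geq// divr1 subrr.
  rewrite big_nat_recr//=; apply: le_trans (lerD IHk (lexx _)) _.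
  have k0 : 0 < k.+1%:R :> R by rewrite ltr0n.
  rewrite -[k.+2%:R]natr1; set x : R := k.+1%:R in k0 *.
  have x1 : 1 <= x by rewrite /x ler1n.
  rewrite -subr_ge0.
  have -> : 2 - 2 / (x + 1) - (2 - 2 / x + (1 + x ^+ 2)^-1) =
    (2 + x ^+ 2 - x) / (x * (x + 1) * (1 + x ^+ 2)).
    by field; rewrite !gt_eqF// ?ltr_pwDr// ?sqr_ge0// ltr_pwDl// sqr_ge0.
  apply: divr_ge0; last by rewrite !mulr_ge0 ?addr_ge0 ?sqr_ge0 ?(ltW k0).
  rewrite (_ : _ - x = (x - 1) ^+ 2 + x + 1); last by ring.
  by rewrite !addr_ge0// ?sqr_ge0// ltW.
case: K => [|K]; first by rewrite big_geq.
by apply: le_trans (H K) _; rewrite gerDl oppr_le0 divr_ge0.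
Qed.

(* Sobolev embedding of H^1 into the continuous functions; AM-GM
   [2 |c_n| <= C/(1+n^2) + (1+n^2)|c_n|^2/C] replaces Cauchy-Schwarz. *)
Lemma H1_representative f : Hspace 1 f -> exists F : R -> R,
  [/\ continuous F, periodic F tau, ae_equal f F &
    forall C : R, 0 < C -> (Hnorm 1 f <= C%:E)%E -> forall x, `|F x| <= 7 * C].
Proof.
move=> [Lf Hf]; have [h0 Hh] := Hnorm_sum_le Hf; set h := fine _ in h0 Hh.
have hE : Hnorm 1 f = h%:E by rewrite fineK// ge0_fin_numE// Hnorm_ge0.
pose a (n : nat) := fourier f n.
have jap n : japanese n `^ 1 ^+ 2 = 1 + n%:~R ^+ 2 :> R.
  rewrite powRr1 ?sqrtr_ge0// sqr_sqrtr// addr_ge0 ?sqr_ge0//.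
(* Here 3/2 is half of 2 + 1: the bound 2 of [sum_inv_sqr_le] plus 1 from the norm. A mode costs 4
   |c_n|, which gives 6 C, and the mean adds C: hence the constant 7. *)
have S K C : 0 < C -> h <= C -> \sum_(1 <= n < K) Normc.normc (a n) <= 3 / 2 * C.
  move=> C0 hC.
  have am n : Normc.normc (a n) <= 2^-1 * (C * (1 + n%:R ^+ 2)^-1 + C^-1 * ((1 + n%:R ^+ 2) * Normc.normc (a n) ^+ 2)).
    set z := Normc.normc _; set j : R := 1 + n%:R ^+ 2.
    have j0 : 0 < j by rewrite ltr_pwDl// sqr_ge0.
    rewrite -subr_ge0.
    have -> : 2^-1 * (C * j^-1 + C^-1 * (j * z ^+ 2)) - z = (C - j * z) ^+ 2 / (2 * C * j).
      by field; rewrite !gt_eqF.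
    by rewrite divr_ge0 ?sqr_ge0// !mulr_ge0// ltW.
  apply: le_trans (ler_sum _ (fun n _ => am n)) _.
  rewrite -mulr_sumr big_split/= -!mulr_sumr.
  have s2 : \sum_(1 <= n < K) ((1 + n%:R ^+ 2) * Normc.normc (a n) ^+ 2) <= C ^+ 2.
    have := Hh [seq Posz n | n <- index_iota 1 K] _.
    rewrite map_inj_uniq ?iota_uniq; last by move=> x y [].
    move=> /(_ isT); rewrite big_map => hh.
    apply: (@le_trans _ _ (h ^+ 2)); last by rewrite lerXn2r ?nnegrE// ltW.
    apply: le_trans hh; rewrite le_eqVlt; apply/orP; left; apply/eqP.
    by apply: eq_bigr => n _; rewrite normc_bessel exprMn jap.
  have s3 := ler_wpM2l (ltW C0) (sum_inv_sqr_le K).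
  have Ci : 0 <= C^-1 by rewrite invr_ge0 ltW.
  have s4 := ler_wpM2l Ci s2.
  have s5 : C^-1 * C ^+ 2 = C by rewrite expr2 mulKf// gt_eqF.
  by lra.
pose m (n : nat) : R := if n is 0%N then 0 else 4 * Normc.normc (a n).
pose g (n : nat) (x : R) : R := if n is 0%N then 0 else tmode (a n) n x.
have m0 n : 0 <= m n by case: n => // n; rewrite mulr_ge0// normc_ge0.
have mS K C : 0 < C -> h <= C -> series m K <= 6 * C.
  move=> C0 hC; rewrite /series/=; case: K => [|K].
    by rewrite big_geq// mulr_ge0// ltW.
  rewrite big_nat_recl// add0r.
  have := S K.+1 C C0 hC; rewrite big_add1/= => h1.
  rewrite -mulr_sumr; lra.
have h1 : 0 < h + 1 by rewrite ltr_pwDr.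
have cm : cvgn (series m).
  apply: nondecreasing_is_cvgn.
    by apply: nondecreasing_series => n _ _; exact: m0.
  by exists (6 * (h + 1)) => _ [K _ <-]; apply: mS => //; rewrite lerDl.
have cg n : continuous (g n) by case: n => [|n]; [exact: ctsC|exact: continuous_tmode].
have gm n x : `|g n x| <= 1 * m n.
  by rewrite mul1r; case: n => [|n]; [rewrite normr0|exact: tmode_norm_le].
have c1 : continuous (fun _ : R => 1 : R) by exact: ctsC.
have o0 (x : R) : 0 <= 1 :> R by [].
have ap := series_sum_approx o0 m0 cm gm.
have cs := continuous_series_sum cg c1 o0 m0 cm gm.
pose F x := complex.Re (a 0%N) + series_sum g x.
have cF : continuous F by apply: ctsD => //; exact: ctsC.
have pF : periodic F tau.
  move=> x; rewrite /F /series_sum; congr (_ + limn _); apply/funext => K.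
  by apply: eq_bigr => -[|n] _ //=; rewrite tmode_periodic.
have gK K x : tpoly a K.+1 x = complex.Re (a 0%N) + \sum_(0 <= n < K.+1) g n x.
  rewrite /tpoly [in RHS]big_nat_recl// add0r; congr (_ + _).
  by rewrite big_add1.
have a0 : complex.Im (a 0%N) = 0.
  have := fourier_conj 0 Lf; rewrite oppr0 -/(a 0%N) => /(congr1 (@complex.Im R)).
  rewrite [complex.Im (conjc _)](_ : _ = - complex.Im (a 0%N)); last by case: (a 0%N).
  by move/eqP; rewrite -addr_eq0 -mulr2n mulrn_eq0 => /eqP.
have fF : fourier F = hermitian a.
  apply: fourier_tseries => // e k e0.
  have /cvgrPdist_le /(_ _ e0) [K _ HK] := series_tail_cvg0 cm.
  exists (maxn K k).+1; first by rewrite ltnS leq_maxr.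
  move=> x; rewrite gK /F opprD addrACA subrr add0r.
  apply: le_trans (ap _ x) _; rewrite mul1r.
  have /= := HK (maxn K k).+1 (leq_trans (leq_maxl K k) (leqnSn _)).
  by rewrite sub0r normrN; apply: le_trans; exact: ler_norm.
have fE : fourier f = fourier F.
  rewrite fF; apply/funext => -[n|n] //=.
  by rewrite NegzE fourier_conj.
have LF := torus_L1_continuous cF pF.
exists F; split => //; first exact: fourier_inj_ae.
move=> C C0; rewrite hE lee_fin => hC x; rewrite /F.
apply: le_trans (ler_normD _ _) _.
have r0 : `|complex.Re (a 0%N)| <= C.
  apply: le_trans (Re_le_normc _) _; rewrite -(@ler_pXn2r _ 2)// ?nnegrE ?normc_ge0 ?(ltW C0)//.
  apply: (@le_trans _ _ (h ^+ 2)); last by rewrite lerXn2r ?nnegrE// ltW.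
  have := Hh [:: 0] isT; rewrite big_seq1 normc_bessel exprMn jap.
  by rewrite expr0n/= addr0 mul1r.
have s0 : `|series_sum g x| <= 6 * C.
  have := ap 0%N x; rewrite big_geq// subr0 mul1r => h2; apply: le_trans h2 _.
  rewrite /series_tail {2}/series/= big_geq// subr0.
  by apply: limr_le => //; apply: nearW => K; exact: mS.
by clear o0 ap; lra.
Qed.

End TrigonometricSeries.

(** * Mild solutions, one Fourier coefficient at a time *)

Section MildSource.
Context {R : realType}.
Local Notation mu := (@lebesgue_measure R).
Local Notation tau := (pi *+ 2 : R).
Implicit Types (F N w : R -> R -> R).

Lemma jcont_of_uniform F : (forall t, continuous (F t)) ->
  (forall t e, 0 < e -> \forall t' \near t, forall x, `|F t' x - F t x| <= e) ->
  continuous (fun p : R * R => F p.1 p.2).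
Proof.
move=> cF uF [t x]; apply/cvgrPdist_le => e e0 /=.
have e2 : 0 < e / 2 by rewrite divr_gt0.
have h1 : \forall p \near (t, x), forall y, `|F p.1 y - F t y| <= e / 2.
  exact: (@cvg_fst _ _ (nbhs t) (nbhs x) _ _ (uF t _ e2)).
have /cvgrPdist_le /(_ _ e2) h2 := cF t x.
have h3 : \forall p \near (t, x), `|F t x - F t p.2| <= e / 2.
  exact: (@cvg_snd _ _ (nbhs t) (nbhs x) _ _ h2).
apply: filterS2 h1 h3 => -[t' x'] /= /(_ x') h h'.
rewrite distrC in h; apply: le_trans (ler_distD (F t x') _ _) _.
by rewrite [e]splitr lerD.
Qed.

Lemma fourier_source F N n t : 0 <= t ->
  continuous (fun p : R * R => F p.1 p.2) -> (forall s, periodic (F s) tau) ->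
  continuous (fun p : R * R => N p.1 p.2) -> (forall s, periodic (N s) tau) ->
  fourier (phi_op (fun x => \int[mu]_(s in `[0, t]) (N s x + F s x))) n =
  phi n * Cintegral `[0, t] (fun s => fourier (N s) n + fourier (F s) n).
Proof.
move=> t0 cF pF cN pN.
have cNF : continuous (fun p : R * R => N p.1 p.2 + F p.1 p.2) by exact: ctsD.
have cs x : continuous (fun s => N s x + F s x).
  exact: (@jcont_section _ _ (fun x s => N s x + F s x) x (jcont_swap (f := fun s x => N s x + F s x) cNF)).
have pI : periodic (fun x => \int[mu]_(s in `[0, t]) (N s x + F s x)) tau.
  by move=> x; apply: eq_Rintegral => s _; rewrite pN pF.
rewrite fourier_phi_op//; last first.
  exact: (@jcont_integral _ _ (fun x s => N s x + F s x) 0 t (jcont_swap (f := fun s x => N s x + F s x) cNF)).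
rewrite (@fourier_Rintegral _ (fun s x => N s x + F s x))//; last by move=> s x; rewrite pN pF.
congr (_ * Cintegral _ _); apply/funext => s.
by rewrite fourierD//; apply: torus_L1_continuous => //; exact: jcont_section.
Qed.

Let al (n : int) : R := - n%:~R / (1 + n%:~R ^+ 2).

Let phi_mulC (n : int) (x y : R) : phi n * Complex x y = Complex (- (al n * y)) (al n * x).
Proof. by apply: complex_ext; rewrite !cparts/= /al; ring. Qed.

Let phi_mul (n : int) (z : R[i]) : phi n * z =
  Complex (- (al n * complex.Im z)) (al n * complex.Re z).
Proof. by case: z => x y; rewrite phi_mulC. Qed.

Let eq_Rintegral_itv (f g : R -> R) t : (forall s, 0 <= s -> f s = g s) ->
  \int[mu]_(s in `[0, t]) f s = \int[mu]_(s in `[0, t]) g s.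
Proof.
by move=> fg; apply: eq_Rintegral => s; rewrite inE/= in_itv/= => /andP[s0 _]; exact: fg.
Qed.

Section Fixed.
Variables (F : R -> R -> R).
Hypothesis cF : continuous (fun p : R * R => F p.1 p.2).
Hypothesis pF : forall s, periodic (F s) tau.
Variable n : int.

Let q1 s : R := - (al n * complex.Im (fourier (F s) n)).
Let q2 s : R := al n * complex.Re (fourier (F s) n).

Let cq : continuous q1 /\ continuous q2.
Proof.
have [cr ci] := continuous_fourier n cF pF; split.
  by apply: ctsN; apply: ctsM => //; exact: ctsC.
by apply: ctsM => //; exact: ctsC.
Qed.

Lemma duhamel_source t : 0 <= t ->
  duhamel (fun=> 0) (fun s => phiD (fourier (F s))) t n =
  Complex (duhamel_re (al n) q1 q2 t) (duhamel_im (al n) q1 q2 t).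
Proof.
move=> t0; have [c1 c2] := cq.
rewrite /duhamel /semigroup /phiD /multiplier mulr0 add0r -Cintegral_duhamel//.
by congr Cintegral; apply/funext => s; rewrite phi_mul.
Qed.

Let Cint_parts (a : R -> R -> R) t : 0 <= t ->
  continuous (fun p : R * R => a p.1 p.2) -> (forall s, periodic (a s) tau) ->
  phi n * Cintegral `[0, t] (fun s => fourier (a s) n + fourier (F s) n) =
  Complex (\int[mu]_(s in `[0, t]) (- (al n * complex.Im (fourier (a s) n)) + q1 s))
          (\int[mu]_(s in `[0, t]) (al n * complex.Re (fourier (a s) n) + q2 s)).
Proof.
move=> t0 ca pa; have [cr ci] := continuous_fourier n cF pF.
have [ar ai] := continuous_fourier n ca pa.
rewrite /Cintegral phi_mulC; congr Complex.
  rewrite -mulNr -cRintegralZ.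
    by apply: eq_Rintegral => s _; rewrite ImD /q1; ring.
  rewrite (_ : (fun x => _) = (fun s => complex.Im (fourier (a s) n) + complex.Im (fourier (F s) n))).
    exact: ctsD.
  by apply/funext => s; rewrite ImD.
rewrite -cRintegralZ.
  by apply: eq_Rintegral => s _; rewrite ReD /q2; ring.
rewrite (_ : (fun x => _) = (fun s => complex.Re (fourier (a s) n) + complex.Re (fourier (F s) n))).
  exact: ctsD.
by apply/funext => s; rewrite ReD.
Qed.

(** The n-th coefficient of phi(D) N solves c' = phi(n) (c + F_n) in integrated form, and so does
    the Duhamel integral; this linear equation has only one solution. *)
Lemma source_mild N : continuous (fun p : R * R => N p.1 p.2) ->
  (forall s, periodic (N s) tau) ->
  (forall t x, 0 <= t -> N t x = \int[mu]_(s in `[0, t]) (phi_op (N s) x + F s x)) ->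
  forall t, 0 <= t -> fourier (phi_op (N t)) n =
    duhamel (fun=> 0) (fun s => phiD (fourier (F s))) t n.
Proof.
move=> cN pN NE.
have cK := jcont_phi_op (T := R) (f := N) cN.
have pK s : periodic (phi_op (N s)) tau by exact: phi_op_periodic.
have [ar ai] := continuous_fourier (F := fun s => phi_op (N s)) n cK pK.
have [c1 c2] := cq.
have E t : 0 <= t -> fourier (phi_op (N t)) n =
    phi n * Cintegral `[0, t] (fun s => fourier (phi_op (N s)) n + fourier (F s) n).
  move=> t0; rewrite (_ : N t = fun x => \int[mu]_(s in `[0, t]) (phi_op (N s) x + F s x)).
    exact: (@fourier_source F (fun s => phi_op (N s)) n t t0 cF pF cK pK).
  by apply/funext => x; exact: NE.
move=> t t0; rewrite duhamel_source//.
have [] := @duhamel_ode_unique _ (al n) q1 q2 c1 c2 _ _ ar ai _ _ t t0.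
- by move=> s s0; rewrite [in LHS]E// (Cint_parts (a := fun s => phi_op (N s))).
- by move=> s s0; rewrite [in LHS]E// (Cint_parts (a := fun s => phi_op (N s))).
- by move=> h1 h2; apply: complex_ext.
Qed.

(** Conversely, the Duhamel integral satisfies the integrated equation ([duhamel_re_ode],
    [duhamel_im_ode]), whose right side is the coefficient of phi(D) applied to the accumulated
    source. *)
Lemma mild_fourier_source w : continuous (fun p : R * R => w p.1 p.2) ->
  (forall s, periodic (w s) tau) ->
  (forall t, 0 <= t -> fourier (w t) n =
    duhamel (fun=> 0) (fun s => phiD (fourier (F s))) t n) ->
  forall t, 0 <= t ->
  fourier (w t) n = fourier (phi_op (fun x => \int[mu]_(s in `[0, t]) (w s x + F s x))) n.
Proof.
move=> cw pw wE t t0; rewrite fourier_source// Cint_parts//.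
have {}wE s : 0 <= s -> fourier (w s) n =
    Complex (duhamel_re (al n) q1 q2 s) (duhamel_im (al n) q1 q2 s).
  by move=> s0; rewrite wE// duhamel_source.
have [c1 c2] := cq.
rewrite [LHS]wE//; congr Complex.
  by rewrite duhamel_re_ode//; apply: eq_Rintegral_itv => s s0; rewrite wE.
by rewrite duhamel_im_ode//; apply: eq_Rintegral_itv => s s0; rewrite wE.
Qed.

End Fixed.

Lemma mild_source F w : continuous (fun p : R * R => F p.1 p.2) ->
  (forall s, periodic (F s) tau) -> continuous (fun p : R * R => w p.1 p.2) ->
  (forall s, periodic (w s) tau) ->
  mild_solution (fun=> 0) (fun s => phiD (fourier (F s))) w ->
  forall t, 0 <= t -> w t = phi_op (fun x => \int[mu]_(s in `[0, t]) (w s x + F s x)).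
Proof.
move=> cF pF cw pw H t t0.
have cI : continuous (fun x => \int[mu]_(s in `[0, t]) (w s x + F s x)).
  apply: (@jcont_integral _ _ (fun x s => w s x + F s x) 0 t).
  by apply: (jcont_swap (f := fun s x => w s x + F s x)); exact: ctsD.
have pI : periodic (fun x => \int[mu]_(s in `[0, t]) (w s x + F s x)) tau.
  by move=> x; apply: eq_Rintegral => s _; rewrite pw pF.
have e : fourier (w t) = fourier (phi_op (fun x => \int[mu]_(s in `[0, t]) (w s x + F s x))).
  by apply/funext => n; apply: mild_fourier_source => // s s0; rewrite H.
exact: (fourier_continuous_inj (jcont_section cw) (pw t) (continuous_phi_op cI pI) (phi_op_periodic pI) e).
Qed.

End MildSource.

(** * Paths in Sobolev spaces *)

Section SobolevPaths.
Context {R : realType}.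
Local Notation mu := (@lebesgue_measure R).
Local Notation tau := (pi *+ 2 : R).
Implicit Types (f g w : R -> R).

Lemma cvge0_near (T : Type) (D : set_system T) (FD : Filter D) (N : T -> \bar R) :
  (forall t, (0 <= N t)%E) ->
  (forall e : R, 0 < e -> \forall t \near D, (N t <= e%:E)%E) ->
  N t @[t --> D] --> 0%E.
Proof.
move=> N0 H; apply/fine_cvgP; split.
  apply: filterS (H 1 ltr01) => t h; rewrite ge0_fin_numE//.
  exact: le_lt_trans h (ltry _).
apply/cvgrPdist_le => e e0; apply: filterS (H e e0) => t h /=.
rewrite sub0r normrN ger0_norm ?fine_ge0// -lee_fin fineK// ge0_fin_numE//.
exact: le_lt_trans h (ltry _).
Qed.

Lemma ae_torus_L1 f g : torus_L1 g -> periodic f tau -> measurable_fun setT f ->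
  ae_equal f g -> torus_L1 f.
Proof.
move=> [pg mg ig] pf mf fg; split => //.
apply/integrableP; split.
  by apply/measurable_EFinP; apply: measurable_funS mf.
have /integrableP[_] := ig; apply: le_lt_trans; rewrite le_eqVlt; apply/orP; left.
apply/eqP; apply: ae_eq_integral => //.
- by do 2 apply: measurableT_comp => //; apply: measurable_funS mf.
- by do 2 apply: measurableT_comp => //; apply: measurable_funS mg.
- apply: filterS fg; first exact: (ae_filter_ringOfSetsType mu).
  by move=> x /= -> _.
Qed.

(** Bessel's inequality for w. It is applied with w = n to f = phi(D) n, and with w = <D>^s Z to f =
    Z. *)
Lemma Hnorm_dominated s f w B : continuous w -> periodic w tau -> 
  (forall x, `|w x| <= B) ->
  (forall n, Normc.normc (bessel s (fourier f) n) <= Normc.normc (fourier w n)) ->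
  (Hnorm s f <= B%:E)%E.
Proof.
move=> cw pw wB H; have B0 : 0 <= B by exact: le_trans (wB 0).
apply: Hnorm_le => // r ur.
apply: (@le_trans _ _ (\sum_(n <- r) Normc.normc (fourier w n) ^+ 2)).
  by apply: ler_sum => n _; rewrite lerXn2r ?nnegrE ?normc_ge0.
apply: le_trans (Bessel_inequality cw pw ur) _.
rewrite -[leRHS](@mean_cst R); apply: mean_le.
- exact: ctsX.
- exact: ctsC.
- by move=> x; rewrite -real_normK ?num_real// lerXn2r// nnegrE.
Qed.

(** The multiplier <n> |phi(n)| = |n| / <n> is at most 1. *)
Lemma Hnorm_phi_op_le f B : continuous f -> periodic f tau ->
  (forall x, `|f x| <= B) -> (Hnorm 1 (phi_op f) <= B%:E)%E.
Proof.
move=> cf pf fB; apply: (Hnorm_dominated cf pf fB) => n.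
rewrite normc_bessel (fourier_phi_op n cf pf) Normc.normcM mulrA ler_piMl ?normc_ge0//.
rewrite powRr1 ?sqrtr_ge0//.
have j0 : 0 < 1 + n%:~R ^+ 2 :> R by rewrite ltr_pwDl// sqr_ge0.
rewrite -(@ler_pXn2r _ 2)// ?nnegrE ?mulr_ge0 ?normc_ge0 ?sqrtr_ge0//.
rewrite exprMn normc_sqr sqr_sqrtr ?(ltW j0)//= expr1n expr0n add0r.
rewrite exprMn sqrrN exprVn; move: (n%:~R ^+ 2) j0 => x j0.
rewrite (_ : _ * _ = x / (1 + x)); last by field; rewrite gt_eqF.
by rewrite ler_pdivrMr// mul1r lerDr.
Qed.

Lemma continuous_path_phi_op (N : R -> R -> R) :
  continuous (fun p : R * R => N p.1 p.2) -> (forall s, periodic (N s) tau) ->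
  C_H 1 (fun t => phi_op (N t)).
Proof.
move=> cN pN t t0.
have cs s : continuous (N s) := jcont_section (t := s) cN.
split.
  split; first by apply: torus_L1_continuous; [exact: continuous_phi_op|exact: phi_op_periodic].
  have [B B0 hB] := @jcont_bounded R N t cN pN.
  apply: le_lt_trans (@Hnorm_phi_op_le _ B _ _ _) (ltry _) => // x.
  by apply: hB; rewrite t0 lexx.
apply: cvge0_near => [t'|e e0]; first exact: Hnorm_ge0.
apply: cvg_within; apply: filterS (jcont_uniform_periodic t cN pN e0) => t' H.
rewrite (_ : _ \- _ = phi_op (fun x => N t' x - N t x)); last first.
  by apply/funext => x; rewrite phi_opB.
apply: Hnorm_phi_op_le => //; first exact: ctsB.
by move=> x; rewrite pN pN.
Qed.

End SobolevPaths.

Section SobolevPaths.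
Context {R : realType}.
Local Notation mu := (@lebesgue_measure R).
Local Notation tau := (pi *+ 2 : R).
Implicit Types (f g : R -> R).

Lemma Hnorm_mono (s r : R) f : s <= r -> (Hnorm s f <= Hnorm r f)%E.
Proof.
move=> sr; have [fin|] := ltP (Hnorm r f) +oo%E; last by rewrite leye_eq => /eqP ->; exact: leey.
have [h0 H] := Hnorm_sum_le fin.
have hE : Hnorm r f = (fine (Hnorm r f))%:E by rewrite fineK// ge0_fin_numE// Hnorm_ge0.
rewrite hE; apply: Hnorm_le => // l ul; apply: le_trans (H l ul).
apply: ler_sum => n _; rewrite !normc_bessel lerXn2r ?nnegrE ?mulr_ge0 ?powR_ge0 ?normc_ge0//.
by rewrite ler_wpM2r ?normc_ge0// ler_powR// japanese_ge1.
Qed.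

Lemma normcD_sqr_le (z w : R[i]) :
  Normc.normc (z + w) ^+ 2 <= 2 * (Normc.normc z ^+ 2 + Normc.normc w ^+ 2).
Proof.
rewrite !normc_sqr !cparts; case: z w => a b [c d] /=.
have := sqr_ge0 (a - c); have := sqr_ge0 (b - d); rewrite -subr_ge0 => h1 h2.
rewrite -subr_ge0 (_ : _ - _ = (a - c) ^+ 2 + (b - d) ^+ 2); last by ring.
by rewrite addr_ge0 ?sqr_ge0.
Qed.

(** The inequality |z + w|^2 <= 2 (|z|^2 + |w|^2), summed over frequencies, replaces Minkowski's;
    the lost constant is harmless for convergence to 0. *)
Lemma HnormD_le (s A B : R) f g : torus_L1 f -> torus_L1 g -> 0 <= A -> 0 <= B ->
  (Hnorm s f <= A%:E)%E -> (Hnorm s g <= B%:E)%E ->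
  (Hnorm s (fun x => f x + g x)%R <= (2 * (A + B))%:E)%E.
Proof.
move=> Lf Lg A0 B0 fA gB.
have H h C : 0 <= C -> (Hnorm s h <= C%:E)%E -> forall r : seq int, uniq r ->
    \sum_(n <- r) Normc.normc (bessel s (fourier h) n) ^+ 2 <= C ^+ 2.
  move=> C0 hC r ur; have fin : (Hnorm s h < +oo)%E := le_lt_trans hC (ltry _).
  have [h0 hh] := Hnorm_sum_le fin; apply: le_trans (hh r ur) _.
  rewrite lerXn2r ?nnegrE// -lee_fin fineK// ge0_fin_numE// Hnorm_ge0//.
apply: Hnorm_le => [|r ur]; first by rewrite mulr_ge0// addr_ge0.
have e n : Normc.normc (bessel s (fourier (fun x => f x + g x)) n) ^+ 2 <=
    2 * (Normc.normc (bessel s (fourier f) n) ^+ 2 + Normc.normc (bessel s (fourier g) n) ^+ 2).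
  by rewrite /bessel /multiplier (fourierD n Lf Lg) mulrDr; exact: normcD_sqr_le.
apply: le_trans (ler_sum _ (fun n _ => e n)) _.
rewrite -mulr_sumr big_split/=.
have := H _ _ A0 fA r ur; have := H _ _ B0 gB r ur => hg hf.
apply: (@le_trans _ _ (2 * (A ^+ 2 + B ^+ 2))); first by rewrite ler_wpM2l// lerD.
rewrite -subr_ge0 (_ : _ - _ = 2 * A ^+ 2 + 2 * B ^+ 2 + 8 * (A * B)); last by ring.
by rewrite !addr_ge0// ?mulr_ge0 ?sqr_ge0.
Qed.

Let FW (t : R) : Filter (within `[0, +oo[%classic (nbhs t)).
Proof. exact: within_filter. Qed.

Lemma cvge0P (T : Type) (D : set_system T) (FD : Filter D) (N : T -> \bar R) :
  N t @[t --> D] --> 0%E ->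
  forall e : R, 0 < e -> \forall t \near D, (N t <= e%:E)%E.
Proof.
move=> /fine_cvgP[fin /cvgrPdist_le H] e e0; apply: filterS2 fin (H e e0) => t ft /=.
rewrite sub0r normrN => h; rewrite -[N t]fineK// lee_fin.
exact: le_trans (ler_norm _) h.
Qed.

Lemma C_H_add (s : R) (a b : R -> R -> R) : s <= 1 -> C_H s a -> C_H 1 b ->
  C_H s (fun t x => a t x + b t x).
Proof.
move=> s1 Ca Cb t t0; have [[La Ha] ca] := Ca t t0; have [[Lb Hb] cb] := Cb t t0.
have {}Hb := le_lt_trans (Hnorm_mono (b t) s1) Hb.
have fE h : (Hnorm s h < +oo)%E -> (Hnorm s h <= (fine (Hnorm s h))%:E)%E.
  by move=> fin; rewrite fineK// ge0_fin_numE// Hnorm_ge0.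
split.
  split; first exact: torus_L1D.
  apply: le_lt_trans (HnormD_le La Lb _ _ (fE _ Ha) (fE _ Hb)) (ltry _);
    by rewrite fine_ge0// Hnorm_ge0.
apply: cvge0_near => [t'|e e0]; first exact: Hnorm_ge0.
have e4 : 0 < e / 4 by rewrite divr_gt0.
have h0 : \forall t' \near within `[0, +oo[%classic (nbhs t), 0 <= t'.
  by rewrite near_withinE; apply: nearW => t' /=; rewrite in_itv/= andbT.
have := cvge0P (FW t) cb e4; have := cvge0P (FW t) ca e4.
apply: filterS3 h0 => t' t'0 ha hb.
have [[La' _] _] := Ca t' t'0; have [[Lb' _] _] := Cb t' t'0.
have {}hb := le_trans (Hnorm_mono (b t' \- b t) s1) hb.
rewrite (_ : _ \- _ = (fun x => (a t' \- a t) x + (b t' \- b t) x)); last first.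
  by apply/funext => x /=; ring.
have := HnormD_le (torus_L1B La' La) (torus_L1B Lb' Lb) (ltW e4) (ltW e4) ha hb.
by rewrite (_ : 2 * (e / 4 + e / 4) = e)//; field.
Qed.

(** A continuous representative is chosen at each t >= 0 and frozen at t = 0 for negative times. The
    difference of two of them represents the difference of the path, so the embedding bound turns
    continuity in H^1 into continuity in sup norm. *)
Lemma H1_path_representative (v : R -> R -> R) : C_H 1 v -> exists w : R -> R -> R,
  [/\ continuous (fun p : R * R => w p.1 p.2), forall t, periodic (w t) tau &
    path_equal v w].
Proof.
move=> Cv.
have rep t : exists F : R -> R, 0 <= t ->
    [/\ continuous F, periodic F tau & ae_equal (v t) F].
  have [t0|t0] := leP 0 t; last by exists (fun=> 0).
  by have [F [cF pF eF _]] := H1_representative (Cv t t0).1; exists F.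
have [F HF] := choice rep.
pose w (t : R) := F (Num.max 0 t).
have w0 (t : R) : 0 <= Num.max 0 t by rewrite le_max lexx.
have cw t : continuous (w t) by have [] := HF _ (w0 t).
have pw t : periodic (w t) tau by have [] := HF _ (w0 t).
exists w; split => //; last first.
  move=> t t0; have [_ _] := HF t t0.
  by rewrite /w (max_idPr t0).
apply: jcont_of_uniform => // t e e0.
have e8 : 0 < e / 7 by rewrite divr_gt0.
have := cvge0P (FW _) (Cv _ (w0 t)).2 e8; rewrite near_withinE => h.
have mc : {for t, continuous (fun s : R => Num.max 0 s)}.
  by apply: continuous_max; [exact: cst_continuous|exact: cvg_id].
pose V s := v (Num.max 0 s).
have h2 : \forall t' \near t, `[0, +oo[%classic (Num.max 0 t') ->
  (Hnorm 1 (V t' \- V t)%R <= (e / 7)%:E)%E := mc _ h.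
apply: filterS h2 => t' /= h' x.
have {}h' : (Hnorm 1 (V t' \- V t)%R <= (e / 7)%:E)%E.
  by apply: h'; rewrite in_itv/= w0.
have [[L1 _] _] := Cv _ (w0 t'); have [[L0 _] _] := Cv _ (w0 t).
have Hd : Hspace 1 (V t' \- V t).
  by split; [exact: torus_L1B|exact: le_lt_trans h' (ltry _)].
have [G [cG pG eG HG]] := H1_representative Hd.
have GE : G = fun x => w t' x - w t x.
  apply: ae_equal_continuous => //; first exact: ctsB.
  apply: ae_equal_trans (ae_equal_sym eG) _.
  have [_ _ e1] := HF _ (w0 t'); have [_ _ e2] := HF _ (w0 t).
  exact: (ae_equal_comp2 (fun x y => x - y) e1 e2).
have := HG _ e8 h' x; rewrite GE => h3; apply: le_trans h3 _.
by rewrite mulrC divfK.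
Qed.

End SobolevPaths.

(** * Well-posedness for a given continuous Z *)

Section DeterministicTheory.
Context {R : realType}.
Local Notation mu := (@lebesgue_measure R).
Local Notation tau := (pi *+ 2 : R).
Variables (Z : R -> R -> R) (zb : R -> R).
Hypothesis cZ : continuous (fun p : R * R => Z p.1 p.2).
Hypothesis pZ : forall t, periodic (Z t) tau.
Hypothesis czb : continuous zb.
Hypothesis zb_ge0 : forall t, 0 <= zb t.
Hypothesis zb_nd : forall s t, 0 <= s -> s <= t -> zb s <= zb t.
Hypothesis Z_le : forall t x, 0 <= t -> `|Z t x| <= zb t.

Let sq (w : R -> R -> R) s x := (w s x + Z s x) ^+ 2.

Let jcont_sq w : continuous (fun p : R * R => w p.1 p.2) ->
  continuous (fun p : R * R => sq w p.1 p.2).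
Proof. by move=> cw; apply: ctsX; exact: ctsD. Qed.

Let sq_periodic w : (forall t, periodic (w t) tau) -> forall t, periodic (sq w t) tau.
Proof. by move=> pw t x; rewrite /sq pw pZ. Qed.

Lemma remainder_exists : exists v : R -> R -> R,
  [/\ continuous (fun p : R * R => v p.1 p.2), forall t, periodic (v t) tau,
    C_H 1 v, solves_remainder Z v &
    forall w, continuous (fun p : R * R => w p.1 p.2) ->
      (forall t, periodic (w t) tau) -> solves_remainder Z w ->
      forall t, 0 <= t -> w t = v t].
Proof.
have [n [cn pn nE]] := BBM_source_exists cZ pZ czb zb_ge0 zb_nd Z_le.
pose v t := phi_op (n t).
have cv : continuous (fun p : R * R => v p.1 p.2) := jcont_phi_op (T := R) (f := n) cn.
have pv t : periodic (v t) tau by exact: phi_op_periodic.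
exists v; split => //.
- exact: continuous_path_phi_op.
- move=> t t0; apply/funext => k.
  exact: (@source_mild _ (sq v) (jcont_sq cv) (sq_periodic pv) k n cn pn nE t t0).
move=> w cw pw ws t t0.
have ms := mild_source (jcont_sq cw) (sq_periodic pw) cw pw ws.
(* By [mild_source] any continuous mild solution w equals phi(D) n', and this n' solves the source
   equation, where uniqueness is known. *)
pose n' t x := \int[mu]_(s in `[0, t]) (w s x + sq w s x).
have cs : continuous (fun p : R * R => w p.1 p.2 + sq w p.1 p.2).
  by apply: ctsD => //; exact: jcont_sq.
have cn' : continuous (fun p : R * R => n' p.1 p.2).
  apply: (jcont_swap (f := fun x t => n' t x)).
  apply: (@jcont_integral_upto _ _ (fun x s => w s x + sq w s x)).
  exact: (jcont_swap (f := fun s x => w s x + sq w s x)).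
have pn' s : periodic (n' s) tau.
  by move=> x; apply: eq_Rintegral => r _; rewrite pw sq_periodic.
have n'E r x : 0 <= r -> n' r x =
    \int[mu]_(s in `[0, r]) (phi_op (n' s) x + (phi_op (n' s) x + Z s x) ^+ 2).
  move=> r0; apply: eq_Rintegral => s; rewrite inE/= in_itv/= => /andP[s0 _].
  by rewrite -/(n' s) -(ms s s0).
rewrite (ms t t0) -/(n' t) /v; congr phi_op; apply/funext => x.
exact: (BBM_source_unique cZ zb_ge0 zb_nd Z_le n'E nE cn' pn' cn pn).
Qed.

(** For v(t) merely in L^1 the square is integrable because it agrees almost everywhere with a
    continuous function. *)
Lemma fourier_sq_representative v w t : torus_L1 (v t) -> ae_equal (v t) (w t) ->
  continuous (fun p : R * R => w p.1 p.2) -> (forall t, periodic (w t) tau) ->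
  fourier (fun x => (v t x + Z t x) ^+ 2) = fourier (fun x => (w t x + Z t x) ^+ 2).
Proof.
move=> [pv mv _] vw cw pw.
have cZt : continuous (Z t) := jcont_section cZ.
have ae : ae_equal (fun x => (v t x + Z t x) ^+ 2) (fun x => (w t x + Z t x) ^+ 2).
  have zz : ae_equal (Z t) (Z t) by exact: aeW.
  exact: (ae_equal_comp2 (fun x y => (x + y) ^+ 2) vw zz).
have Lw : torus_L1 (fun x => (w t x + Z t x) ^+ 2).
  by apply: torus_L1_continuous; [exact: (jcont_section (jcont_sq cw))|exact: sq_periodic].
apply: fourier_ae => //; apply: ae_torus_L1 Lw _ _ ae.
  by move=> x; rewrite pv pZ.
apply: measurable_funX; apply: measurable_funD => //.
exact: continuous_measurable_fun.
Qed.

Section ForcedEquation.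
Variables (zeta : fseries R) (s : R).
Hypothesis s1 : s <= 1.
Hypothesis ZC : C_H s Z.
Hypothesis convZ : is_stochastic_convolution zeta Z.

Lemma duhamel_eq (w0 : fseries R) (N N' : R -> fseries R) t :
  (forall r, 0 <= r -> N r = N' r) -> duhamel w0 N t = duhamel w0 N' t.
Proof.
move=> NN'; apply/funext => n; rewrite /duhamel; congr (_ + _).
apply: complex_ext; apply: eq_Rintegral => r; rewrite inE/= in_itv/= => /andP[r0 _].
  by rewrite /semigroup /multiplier NN'.
by rewrite /semigroup /multiplier NN'.
Qed.

Lemma CintegralB (f g : R -> R[i]) t :
  continuous (fun r => complex.Re (f r)) -> continuous (fun r => complex.Im (f r)) ->
  continuous (fun r => complex.Re (g r)) -> continuous (fun r => complex.Im (g r)) ->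
  Cintegral `[0, t] (fun r => f r - g r) = Cintegral `[0, t] f - Cintegral `[0, t] g.
Proof.
move=> c1 c2 c3 c4; apply: complex_ext; rewrite !cparts [LHS]/= -cRintegralB//.
  by apply: eq_Rintegral => r _; rewrite !cparts.
by apply: eq_Rintegral => r _; rewrite !cparts.
Qed.

(** Additivity of the integral rests on integrability of both parts, which comes from continuity in
    time of the coefficients. *)
Lemma duhamel_subr (q : R -> R[i]) (c : R[i]) n t :
  continuous (fun r => complex.Re (q r)) -> continuous (fun r => complex.Im (q r)) ->
  Cintegral `[0, t] (fun r => cexp ((t - r)%:C%C * phi n) * (phi n * q r - phi n * c)) =
  Cintegral `[0, t] (fun r => cexp ((t - r)%:C%C * phi n) * (phi n * q r)) -
  Cintegral `[0, t] (fun r => cexp ((t - r)%:C%C * phi n) * (phi n * c)).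
Proof.
move=> c1 c2.
have cR (z : R -> R[i]) : continuous (fun r => complex.Re (z r)) -> continuous (fun r => complex.Im (z r)) ->
    continuous (fun r => complex.Re (cexp ((t - r)%:C%C * phi n) * (phi n * z r))) /\
    continuous (fun r => complex.Im (cexp ((t - r)%:C%C * phi n) * (phi n * z r))).
  move=> cr ci; set al : R := - n%:~R / (1 + n%:~R ^+ 2).
  have ca : continuous (fun r : R => (t - r) * al).
    by apply: ctsM; [apply: ctsB; [exact: ctsC|move=> ?; exact: cvg_id]|exact: ctsC].
  have cc := cts_comp (@continuous_cos R) ca; have cS := cts_comp (@continuous_sin R) ca.
  have ci' : continuous (fun r => - (al * complex.Im (z r))).
    by apply: ctsN; apply: ctsM => //; exact: ctsC.
  have cr' : continuous (fun r => al * complex.Re (z r)).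
    by apply: ctsM => //; exact: ctsC.
  split.
    rewrite (_ : (fun r => _) = fun r => cos ((t - r) * al) * - (al * complex.Im (z r)) -
      sin ((t - r) * al) * (al * complex.Re (z r))).
      by apply: ctsB; exact: ctsM.
    apply/funext => r; rewrite !cparts/= !mulr0 !mul0r ?subr0 ?addr0 ?add0r ?sub0r expR0 !mul1r.
    by rewrite /al.
  rewrite (_ : (fun r => _) = fun r => cos ((t - r) * al) * (al * complex.Re (z r)) +
      sin ((t - r) * al) * - (al * complex.Im (z r))).
    by apply: ctsD; exact: ctsM.
  apply/funext => r; rewrite !cparts/= !mulr0 !mul0r ?subr0 ?addr0 ?add0r ?sub0r expR0 !mul1r.
  by rewrite /al.
have [q1 q2] := cR q c1 c2.
have [d1 d2] := cR (fun=> c) (@ctsC _ _ _) (@ctsC _ _ _).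
rewrite -CintegralB//; congr Cintegral; apply/funext => r; exact: mulrBr.
Qed.

(** The part of the Duhamel integral due to - phi(D) zeta is the coefficient of Z. This links the
    full equation for Z + w with the remainder equation for w. *)
Lemma fourier_forced (w : R -> R -> R) t : 0 <= t ->
  continuous (fun p : R * R => w p.1 p.2) -> (forall t, periodic (w t) tau) ->
  duhamel (fun=> 0) (fun t n => phiD (fourier (sq w t)) n - phiD zeta n) t =
  (fun n => duhamel (fun=> 0) (fun t => phiD (fourier (sq w t))) t n + fourier (Z t) n).
Proof.
move=> t0 cw pw; apply/funext => n.
have [cr ci] := continuous_fourier n (jcont_sq cw) (sq_periodic pw).
rewrite convZ// /duhamel /semigroup /phiD /multiplier !mulr0 !add0r.
exact: duhamel_subr.
Qed.

Theorem BBM_well_posed : exists v : R -> R -> R,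
  (C_H 1 v /\ solves_remainder Z v) /\
  (forall v' : R -> R -> R, C_H 1 v' -> solves_remainder Z v' -> path_equal v' v) /\
  exists u : R -> R -> R,
    (C_H s u /\ solves_SBBM zeta u /\ path_equal u (fun t x => Z t x + v t x)) /\
    (forall u' : R -> R -> R, C_H s u' -> solves_SBBM zeta u' ->
       (exists v' : R -> R -> R, C_H 1 v' /\
          path_equal u' (fun t x => Z t x + v' t x)) ->
       path_equal u' u).
Proof.
have [v [cv pv Cv sv uv]] := remainder_exists.
have uniq_v (v' : R -> R -> R) : C_H 1 v' -> solves_remainder Z v' -> path_equal v' v.
  move=> Cv' sv'; have [w [cw pw vw]] := H1_path_representative Cv'.
  have sw : solves_remainder Z w.
    move=> t t0; have [[Lv _] _] := Cv' t t0.
    rewrite -(fourier_ae Lv (torus_L1_continuous (jcont_section cw) (pw t)) (vw t t0)).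
    rewrite (sv' t t0); apply: duhamel_eq => r r0; have [[Lr _] _] := Cv' r r0.
    by rewrite (fourier_sq_representative Lr (vw r r0) cw pw).
  by move=> t t0; rewrite -(uv w cw pw sw t t0); exact: vw.
exists v; split => //; split => //.
have LZ t : torus_L1 (Z t) := torus_L1_continuous (jcont_section cZ) (pZ t).
have comm (w : R -> R -> R) t : (fun x => (Z t x + w t x) ^+ 2) = sq w t.
  by apply/funext => x; rewrite /sq addrC.
exists (fun t x => Z t x + v t x); split.
  split; first exact: C_H_add.
  split; last by move=> t t0; exact: aeW.
  move=> t t0.
  apply: (@etrans _ _ (duhamel (fun=> 0) (fun t n => phiD (fourier (sq v t)) n - phiD zeta n) t));
    last by apply: duhamel_eq => r _; rewrite comm.
  rewrite fourier_forced//; apply/funext => n.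
  have Lv := torus_L1_continuous (jcont_section cv) (pv t).
  by rewrite (fourierD n (LZ t) Lv) addrC sv.
move=> u' Cu' su' [v' [Cv' uv']].
have [w [cw pw vw]] := H1_path_representative Cv'.
have Lw t : torus_L1 (w t) := torus_L1_continuous (jcont_section cw) (pw t).
have u'w t : 0 <= t -> ae_equal (u' t) (fun x => Z t x + w t x).
  move=> t0; apply: ae_equal_trans (uv' t t0) _.
  have zz : ae_equal (Z t) (Z t) by exact: aeW.
  exact: (ae_equal_comp2 (fun x y => x + y) zz (vw t t0)).
have squ t : 0 <= t -> fourier (fun x => u' t x ^+ 2) = fourier (sq w t).
  move=> t0; have [[[pu mu' _] _] _] := Cu' t t0.
  have ae : ae_equal (fun x => u' t x ^+ 2) (sq w t).
    rewrite -comm; exact: (ae_equal_comp2 (fun x _ => x ^+ 2) (u'w t t0) (u'w t t0)).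
  have Ls : torus_L1 (sq w t).
    by apply: torus_L1_continuous; [exact: (jcont_section (jcont_sq cw))|exact: sq_periodic].
  apply: fourier_ae => //; apply: ae_torus_L1 Ls _ _ ae.
    by move=> x; rewrite pu.
  exact: measurable_funX.
(* The coefficient of Z(t) stands on both sides of the equation for Z + w and cancels. *)
have sw : solves_remainder Z w.
  move=> t t0; have [[Lu _] _] := Cu' t t0.
  have := su' t t0.
  rewrite (fourier_ae Lu (torus_L1D (LZ t) (Lw t)) (u'w t t0)).
  rewrite (_ : duhamel _ _ t = duhamel (fun=> 0) (fun t n => phiD (fourier (sq w t)) n - phiD zeta n) t).
    rewrite fourier_forced// => e; apply/funext => n.
    have := congr1 (fun c : fseries R => c n) e.
    by rewrite (fourierD n (LZ t) (Lw t)) addrC => /addIr.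
  by apply: duhamel_eq => r r0; rewrite (squ r r0).
move=> t t0; apply: ae_equal_trans (u'w t t0) _.
by rewrite (uv w cw pw sw t t0); exact: aeW.
Qed.

End ForcedEquation.

End DeterministicTheory.

(** * Gaussian moments and independence *)

Section TransferOfIntegrals.
Import HBNNSimple.
Context {R : realType} d (Y : measurableType d).
Local Open Scope ereal_scope.

Let weighted_approx (F : Y -> R) (mF : measurable_fun setT (EFin \o F))
    d1 (X : measurableType d1) (mu : {measure set X -> \bar R}) (w : X -> R) (phi : X -> Y) :
  measurable_fun setT w -> (forall x, (0 <= w x)%R) -> measurable_fun setT phi ->
  (forall y, (0 <= F y)%R) ->
  let h := nnsfun_approx measurableT mF in
  \int[mu]_x (w x * F (phi x))%:E =
  limn (fun k => \sum_(r \in range (h k))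
    r%:E * \int[mu]_x (w x * \1_(h k @^-1` [set r]) (phi x))%:E).
Proof.
move=> mw w0 mphi F0 h.
have hcvg x : (w x * h k (phi x))%:E @[k --> \oo] --> (w x * F (phi x))%:E.
  under eq_fun do rewrite EFinM.
  rewrite EFinM; apply: cvgeZl => //.
  by apply: (cvg_nnsfun_approx measurableT mF) => // y _; rewrite lee_fin.
rewrite (_ : (fun x => (w x * F (phi x))%:E) = fun x => limn (fun k => (w x * h k (phi x))%:E)); last first.
  by apply/funext => x; apply/esym/cvg_lim => //; exact: hcvg.
rewrite monotone_convergence//; last 3 first.
- move=> k; apply/measurable_EFinP; apply: measurable_funM => //.
  exact: measurableT_comp.
- by move=> k x _; rewrite lee_fin mulr_ge0.
- move=> x _ k l kl; rewrite lee_fin ler_wpM2l//.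
  exact/lefP/nd_nnsfun_approx.
congr (limn _); apply/funext => k.
have mI r : measurable_fun setT (fun x => (w x * \1_(h k @^-1` [set r]) (phi x))%:E).
  apply/measurable_EFinP; apply: measurable_funM => //.
  by apply: measurableT_comp => //; exact: measurable_indic.
have I0 r x : (0 <= w x * \1_(h k @^-1` [set r]) (phi x))%R by rewrite mulr_ge0.
have r0 r : r \in range (h k) -> (0 <= r)%R by rewrite inE => -[y _ <-].
have E0 r x : 0 <= r%:E * (w x * \1_(h k @^-1` [set r]) (phi x))%:E.
  rewrite -EFinM lee_fin mulrCA; apply: mulr_ge0 => //.
  have := @nnfun_muleindic_ge0 _ _ _ (h k) r (phi x); rewrite lee_fin; exact.
transitivity (\int[mu]_x (\sum_(r \in range (h k))
    r%:E * (w x * \1_(h k @^-1` [set r]) (phi x))%:E)).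
  apply: eq_integral => x _; rewrite [in LHS]fimfunE.
  rewrite mulr_fsumr// -fsumEFin//; apply: eq_fsbigr => r _.
  by rewrite -EFinM mulrCA.
rewrite ge0_integral_fsum//; last by move=> r; exact: measurable_funeM.
apply: eq_fsbigr => r rh; rewrite ge0_integralZl//; last by rewrite lee_fin r0.
by move=> x _; rewrite lee_fin.
Qed.

(** Both integrals are limits of the same combinations of set integrals, by simple functions on the
    common target Y. It gives the density formula for normal laws, expectations under the law of a
    complex Gaussian, and the passage from independent events to products of functions. *)
Lemma eq_integral_of_sets d1 (X1 : measurableType d1) d2 (X2 : measurableType d2)
    (mu1 : {measure set X1 -> \bar R}) (mu2 : {measure set X2 -> \bar R})
    (w1 : X1 -> R) (w2 : X2 -> R) (phi1 : X1 -> Y) (phi2 : X2 -> Y) :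
  measurable_fun setT w1 -> (forall x, (0 <= w1 x)%R) -> measurable_fun setT phi1 ->
  measurable_fun setT w2 -> (forall x, (0 <= w2 x)%R) -> measurable_fun setT phi2 ->
  (forall A, measurable A ->
    \int[mu1]_x (w1 x * \1_A (phi1 x))%:E = \int[mu2]_x (w2 x * \1_A (phi2 x))%:E) ->
  forall F : Y -> R, measurable_fun setT F -> (forall y, (0 <= F y)%R) ->
  \int[mu1]_x (w1 x * F (phi1 x))%:E = \int[mu2]_x (w2 x * F (phi2 x))%:E.
Proof.
move=> mw1 w10 m1 mw2 w20 m2 H F /measurable_EFinP mF F0.
rewrite (weighted_approx mF)// (weighted_approx mF)//; congr (limn _).
apply/funext => k; apply: eq_fsbigr => r _; congr (_ * _); exact: H.
Qed.

End TransferOfIntegrals.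

Section Independence.
Context {R : realType} {d : measure_display} {Omega : measurableType d}.
Variable P : probability Omega R.
Context {d' : measure_display} {T : measurableType d'}.
Variables (I : choiceType) (X : I -> Omega -> T).
Hypothesis mX : forall i, measurable_fun setT (X i).
Hypothesis indepX : mutually_independent P X.
Variables (F : I -> T -> R) (M : I -> R).
Hypothesis mF : forall i, measurable_fun setT (F i).
Hypothesis F0 : forall i x, 0 <= F i x.
Hypothesis FM : forall i, (\int[P]_w (F i (X i w))%:E = (M i)%:E)%E.

Let mprod (l : seq I) (G : I -> T -> R) : (forall i, measurable_fun setT (G i)) ->
  measurable_fun setT (fun w => \prod_(i <- l) G i (X i w)).
Proof.
by move=> mG; apply: measurable_prod => i _; exact: measurableT_comp.
Qed.

Let M0 i : 0 <= M i.
Proof. by rewrite -lee_fin -FM; apply: integral_ge0 => w _; rewrite lee_fin. Qed.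

Let mXA (A : I -> set T) i : (forall i, measurable (A i)) -> measurable (X i @^-1` A i).
Proof. by move=> mA; rewrite -[X in measurable X]setTI; exact: mX. Qed.

Let prodP (l : seq I) (A : I -> set T) : (forall i, measurable (A i)) ->
  (\prod_(i <- l) P (X i @^-1` A i) = (\prod_(i <- l) fine (P (X i @^-1` A i)))%:E)%E.
Proof.
move=> mA; elim: l => [|i l IH]; first by rewrite !big_nil.
rewrite !big_cons IH EFinM fineK//; apply: fin_num_measure; exact: mXA.
Qed.

(* Indicators are exchanged for the functions F i one index at a time. *)
Let partial_product (l1 l2 : seq I) (A : I -> set T) : uniq (l1 ++ l2) ->
  (forall i, measurable (A i)) ->
  (\int[P]_w ((\prod_(i <- l1) F i (X i w)) * \prod_(i <- l2) \1_(A i) (X i w))%:E =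
   ((\prod_(i <- l1) M i) * \prod_(i <- l2) fine (P (X i @^-1` A i)))%:E)%E.
Proof.
elim: l1 l2 A => [|j l1 IH] l2 A u mA.
  under eq_integral do rewrite big_nil mul1r.
  rewrite big_nil mul1r -prodP//.
  rewrite (_ : (fun w => _) = (fun w => (\1_(\bigcap_(i in [set` [fset i in l2]%fset]) (X i @^-1` A i)) w)%:E)).
    rewrite integral_indic//; last first.
      by apply: fin_bigcap_measurable => // i _; exact: mXA.
    rewrite setIT; apply: etrans (indepX _ mA) _.
    by apply: perm_big; apply: uniq_perm => // i; rewrite !inE.
  apply/funext => w; congr EFin.
  have [H|H] := pselect (forall i, i \in l2 -> A i (X i w)).
    rewrite big1_seq.
      by rewrite indicE mem_set// => i /=; rewrite !inE; exact: H.
    by move=> i /= il; rewrite indicE mem_set//; exact: H.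
  rewrite indicE memNset; last by apply: contra_not H => h i il; apply: h; rewrite /= !inE.
  apply/eqP; rewrite prodf_seq_eq0; apply/hasP.
  have /existsNP[i /not_implyP[il Ai]] := H.
  by exists i => //=; rewrite indicE memNset.
have /= uj := u; move: uj => /andP[jl ul].
(* The index j joins the indicator list with an arbitrary set C. The induction hypothesis then says
   that, integrated against events of [X j], the weight [w1] acts like the constant c, and the
   transfer lemma replaces the indicator of C by [F j]. *)
pose B (C : set T) i := if i == j then C else A i.
have mB C : measurable C -> forall i, measurable (B C i) by move=> mC i; rewrite /B; case: ifP.
have Bl C i : i \in l2 -> B C i = A i.
  move=> il; rewrite /B; case: eqP => // e; move: jl.
  by rewrite mem_cat negb_or -e il andbF.
pose w1 w := (\prod_(i <- l1) F i (X i w)) * \prod_(i <- l2) \1_(A i) (X i w).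
pose c := (\prod_(i <- l1) M i) * \prod_(i <- l2) fine (P (X i @^-1` A i)).
have c0 : 0 <= c by apply: mulr_ge0; apply: prodr_ge0 => i _ //; exact: fine_ge0.
have mw1 : measurable_fun setT w1.
  apply: measurable_funM; first exact: mprod.
  exact: (mprod l2 (fun i => @measurable_indic _ _ _ setT _ (mA i))).
have w10 x : 0 <= w1 x by apply: mulr_ge0; apply: prodr_ge0.
have E C : measurable C ->
  (\int[P]_w (w1 w * \1_C (X j w))%:E = \int[P]_w (c * \1_C (X j w))%:E)%E.
  move=> mC; have u' : uniq (l1 ++ j :: l2).
    by rewrite -cat1s uniq_catCA/= jl.
  have := IH (j :: l2) (B C) u' (mB C mC).
  have BC : B C j = C by rewrite /B eqxx.
  rewrite [X in _ = (_ * X)%:E -> _]big_cons BC => e.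
  transitivity (c * fine (P (X j @^-1` C)))%:E.
    rewrite (_ : c * _ = (\prod_(i <- l1) M i) * (fine (P (X j @^-1` C)) * \prod_(i <- l2) fine (P (X i @^-1` B C i)))).
      rewrite -e; apply: eq_integral => w _; congr EFin.
      rewrite big_cons /w1 BC -mulrA [X in _ * X]mulrC; congr (_ * (_ * _)).
      by apply: eq_big_seq => i il; rewrite Bl.
    rewrite /c -mulrA; congr (_ * _); rewrite mulrC; congr (_ * _).
    by apply: eq_big_seq => i il; rewrite Bl.
  have mXC : measurable (X j @^-1` C) by rewrite -[X in measurable X]setTI; exact: mX.
  under [RHS]eq_integral do rewrite EFinM.
  rewrite ge0_integralZl//.
  - rewrite EFinM; congr (_ * _)%E.
    rewrite (_ : (fun x => _) = (fun x => (\1_(X j @^-1` C) x)%:E))//.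
    by rewrite integral_indic// setIT fineK// fin_num_measure.
  - by apply/measurable_EFinP; apply: measurableT_comp => //; exact: measurable_indic.
have := @eq_integral_of_sets _ _ T _ _ _ _ P P w1 (cst c) (X j) (X j) mw1 w10 (mX j)
  (@measurable_cst _ _ _ _ _ _) (fun=> c0) (mX j) E (F j) (mF j) (F0 j).
under [X in X = _]eq_integral do rewrite /w1 mulrAC [_ * F j _]mulrC.
under [X in _ = X]eq_integral do rewrite EFinM [cst _ _]/=.
rewrite ge0_integralZl//; last 2 first.
- by apply/measurable_EFinP; exact: measurableT_comp.
- by move=> w _; rewrite lee_fin.
rewrite FM -EFinM mulrC mulrA big_cons => <-.
by apply: eq_integral => w _; rewrite big_cons.
Qed.

Lemma expectation_prod (l : seq I) : uniq l ->
  (\int[P]_w (\prod_(i <- l) F i (X i w))%:E = (\prod_(i <- l) M i)%:E)%E.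
Proof.
move=> ul; have := @partial_product l [::] (fun=> setT).
rewrite cats0 !big_nil => /(_ ul (fun=> measurableT)); rewrite mulr1 => <-.
by apply: eq_integral => w _; rewrite big_nil mulr1.
Qed.

End Independence.

Section GaussianMoments.
Context {R : realType}.
Local Notation mu := (@lebesgue_measure R).

Lemma integral_normal_prob (m s : R) (F : R -> R) : measurable_fun setT F ->
  (forall x, 0 <= F x) ->
  (\int[normal_prob m s]_x (F x)%:E = \int[mu]_x (normal_pdf m s x * F x)%:E)%E.
Proof.
move=> mF F0.
have := @eq_integral_of_sets R _ (measurableTypeR R) _ _ _ _ (normal_prob m s) mu (cst 1) (normal_pdf m s) id id
  (@measurable_cst _ _ _ _ _ _) (fun=> ler01) (@measurable_id _ _ _) (measurable_normal_pdf m s)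
  (@normal_pdf_ge0 _ m s) (@measurable_id _ _ _) _ F mF F0.
under [X in (_ -> X = _) -> _]eq_integral do rewrite /= mul1r.
apply => A mA.
under eq_integral do rewrite /= mul1r.
rewrite integral_indic// setIT /normal_prob [LHS]integral_mkcond.
by apply: eq_integral => x _; rewrite epatch_indic EFinM.
Qed.

(** Completing the square: e^(a x) times the density is e^(a^2 s^2 / 2) times the density of mean a
    s^2. *)
Lemma normal_mgf (s a : R) : s != 0 ->
  (\int[normal_prob 0 s]_x (expR (a * x))%:E = (expR (a ^+ 2 * s ^+ 2 / 2))%:E)%E.
Proof.
move=> s0.
have me : measurable_fun setT (fun x : R => expR (a * x)).
  by apply: measurableT_comp => //; exact: mulrl_measurable.
rewrite (integral_normal_prob _ _ me (fun x => expR_ge0 (a * x))).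
transitivity (\int[mu]_x ((expR (a ^+ 2 * s ^+ 2 / 2))%:E * (normal_pdf (a * s ^+ 2) s x)%:E))%E.
  apply: eq_integral => x _; rewrite -EFinM; congr EFin.
  rewrite !normal_pdfE// /normal_fun -[LHS]mulrA [RHS]mulrCA -!expRD; congr (_ * expR _).
  by field.
rewrite ge0_integralZl//.
- by rewrite integral_normal_pdf mule1.
- by apply/measurable_EFinP; exact: measurable_normal_pdf.
- by move=> x _; rewrite lee_fin normal_pdf_ge0.
Qed.

Context {d : measure_display} {Omega : measurableType d}.
Variable P : probability Omega R.

(** The factor 1/4 is half the variance 1/2 of each of the two independent parts. *)
Lemma complex_gaussian_mgf (g : Omega -> R[i]) (a b : R) :
  standard_complex_gaussian P g -> measurable_fun setT (re_im g) ->
  (\int[P]_w (expR (a * complex.Re (g w) + b * complex.Im (g w)))%:E =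
   (expR ((a ^+ 2 + b ^+ 2) / 4))%:E)%E.
Proof.
move=> lawg mg; pose F (p : R * R) := expR (a * p.1 + b * p.2).
have mF : measurable_fun setT F.
  apply: measurableT_comp => //; apply: measurable_funD.
    by apply: measurable_funM => //; exact: measurable_fst.
  by apply: measurable_funM => //; exact: measurable_snd.
have F0 p : 0 <= F p by exact: expR_ge0.
pose s := Num.sqrt (2^-1 : R); pose N := normal_prob 0 s.
have s0 : s != 0 by rewrite gt_eqF// sqrtr_gt0.
have mgf c : (\int[N]_x (expR (c * x))%:E = (expR (c ^+ 2 / 4))%:E)%E.
  rewrite normal_mgf// sqr_sqrtr//; by congr (expR _)%:E; field.
have := @eq_integral_of_sets R _ (measurableTypeR R * measurableTypeR R)%type _ _ _ _ P (normal_prob 0 s \x normal_prob 0 s)%E (cst 1) (cst 1) (re_im g) id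
  (@measurable_cst _ _ _ _ _ _) (fun=> ler01) mg (@measurable_cst _ _ _ _ _ _) (fun=> ler01)
  (@measurable_id _ _ _) _ F mF F0.
under [X in (_ -> X = _) -> _]eq_integral do rewrite /= mul1r.
under [X in (_ -> _ = X) -> _]eq_integral do rewrite /= mul1r.
move=> ->; last first.
  move=> A mA.
  under eq_integral do rewrite /= mul1r.
  under [RHS]eq_integral do rewrite /= mul1r.
  transitivity (P (re_im g @^-1` A)); last first.
    by rewrite [RHS]integral_indic// setIT lawg.
  rewrite (_ : (fun x => _) = (fun x => (\1_(re_im g @^-1` A) x)%:E))//.
  rewrite integral_indic// ?setIT// -[X in measurable X]setTI; exact: mg.
have mFE : measurable_fun setT (EFin \o F) by apply/measurable_EFinP.
rewrite (@fubini_tonelli1 _ _ _ _ _ (normal_prob 0 s) (normal_prob 0 s) _ mFE)//.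
transitivity (\int[N]_x ((expR (a * x))%:E * (expR (b ^+ 2 / 4))%:E))%E.
  apply: eq_integral => x _; rewrite /fubini_F /= /F /=.
  under eq_integral do rewrite expRD EFinM.
  rewrite ge0_integralZl//.
  - by rewrite mgf.
  - by apply/measurable_EFinP; apply: measurableT_comp => //; exact: mulrl_measurable.
rewrite ge0_integralZr//.
- by rewrite mgf -EFinM -expRD -mulrDl.
- by apply/measurable_EFinP; apply: measurableT_comp => //; exact: mulrl_measurable.
Qed.

End GaussianMoments.

(** * Almost sure bounds on the noise *)

Section BorelCantelli.
Context {R : realType} {d : measure_display} {Omega : measurableType d}.
Variable P : probability Omega R.

(** The sum of all q k has expectation at most C, so it is finite almost surely, and it bounds each
    of its terms. *)
Lemma ae_bounded_of_summable_expectation (q : nat -> Omega -> R) (C : R) :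
  (forall k, measurable_fun setT (q k)) -> (forall k w, 0 <= q k w) ->
  (forall k, (\int[P]_w (q k w)%:E <= (C / (2 ^ (k + 1))%:R)%:E)%E) ->
  exists S : set Omega, [/\ measurable S, P S = 1%E &
    forall w, S w -> exists2 A : R, 0 <= A & forall k, q k w <= A].
Proof.
move=> mq q0 qC.
pose Q w := (\sum_(0 <= k <oo) (q k w)%:E)%E.
have mQ : measurable_fun setT Q.
  apply: (@ge0_emeasurable_sum _ _ _ setT (fun k w => (q k w)%:E) xpredT).
    by move=> k w _ _; rewrite lee_fin.
  by move=> k _; exact/measurable_EFinP.
have Q0 w : (0 <= Q w)%E by apply: nneseries_ge0 => k _ _; rewrite lee_fin.
have iQ : (\int[P]_w Q w <= C%:E)%E.
  rewrite integral_nneseries//; last 2 first.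
  - by move=> k; exact/measurable_EFinP.
  - by move=> k w _; rewrite lee_fin.
  apply: le_trans (lee_nneseries _ (fun k _ => qC k)) _.
    by move=> k _ _; apply: integral_ge0 => w _; rewrite lee_fin.
  have /cvg_lim := @cvg_geometric_eseries_half R C 0.
  by rewrite expr0 divr1 => <-.
have mS : measurable [set w | (Q w < +oo)%E].
  by rewrite -[X in measurable X]setTI; exact: emeasurable_fun_infty_o.
have intQ : P.-integrable setT Q.
  apply/integrableP; split => //; under eq_integral do rewrite gee0_abs//.
  exact: le_lt_trans iQ (ltry _).
exists [set w | (Q w < +oo)%E]; split => //; last first.
  move=> w Sw; exists (fine (Q w)); first exact: fine_ge0.
  move=> k; rewrite -lee_fin fineK; last by rewrite ge0_fin_numE.
  apply: le_trans (@nneseries_lim_ge _ (fun k => (q k w)%:E) xpredT 0 k.+1 _); last first.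
    by move=> n _ _; rewrite lee_fin.
  by rewrite big_nat_recr//= leeDr// sume_ge0// => i _; rewrite lee_fin.
have mSC : measurable (~` [set w | (Q w < +oo)%E]) by exact: measurableC.
have : P (~` [set w | (Q w < +oo)%E]) = 0%E.
  apply/negligibleP => //; have := integrable_ae measurableT intQ.
  apply: negligibleS => w /= h; apply: contra_not h => /(_ I).
  by rewrite ge0_fin_numE.
rewrite probability_setC//; have : P [set w | (Q w < +oo)%E] \is a fin_num by exact: fin_num_measure.
case: (P _) => // p _ /eqP; rewrite -EFinB eqe subr_eq0 => /eqP <- //.
Qed.

End BorelCantelli.

Section ExponentialMoments.
Context {R : realType} {d : measure_display} {Omega : measurableType d}.
Variable P : probability Omega R.

Lemma expectation_sum_le (f : nat -> Omega -> R) (m n : nat) (c0 c : R) : 0 <= c0 ->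
  (forall j, measurable_fun setT (f j)) -> (forall j w, 0 <= f j w) ->
  (forall j, (m <= j < n)%N -> (\int[P]_w (f j w)%:E <= c%:E)%E) ->
  (\int[P]_w (c0 * \sum_(m <= j < n) f j w)%:E <= (c0 * ((n - m)%:R * c))%:E)%E.
Proof.
move=> c00 mf f0 H; under eq_integral do rewrite EFinM -sumEFin.
rewrite ge0_integralZl//; last 2 first.
- by apply: emeasurable_sum => j; apply/measurable_EFinP.
- by move=> w _; apply: sume_ge0 => j _; rewrite lee_fin.
rewrite [leRHS]EFinM lee_wpmul2l ?lee_fin// ge0_integral_sum//; last 2 first.
- by move=> j; apply/measurable_EFinP.
- by move=> j w _; rewrite lee_fin.
rewrite big_nat_cond; apply: (@le_trans _ _ (\sum_(m <= j < n | (m <= j < n)%N && true) c%:E)%E).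
  by apply: lee_sum => j /andP[jn _]; exact: H.
by rewrite -big_nat_cond sumEFin big_const_nat iter_addr_0 mulr_natl.
Qed.

(** Markov's inequality read along one sample: e^|y| <= B^k A <= e^(m k) A < e^(m k + A), the last
    step by A < 1 + A <= e^A. *)
Lemma norm_le_of_expR (y A B m : R) (k : nat) : 0 <= A -> 0 <= B -> B <= expR m ->
  expR y + expR (- y) <= B ^+ k * A -> `|y| <= A + m * k%:R.
Proof.
move=> A0 B0 Bm H; rewrite leNgt; apply/negP => lt.
have : expR `|y| <= expR y + expR (- y).
  by case: (ger0P y) => _; rewrite ?lerDl ?lerDr expR_ge0.
apply/negP; rewrite -ltNge; apply: le_lt_trans H _.
apply: lt_trans (_ : expR (A + m * k%:R) < _); last by rewrite ltr_expR.
rewrite expRD [ltRHS]mulrC expRM_natr.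
apply: (@le_lt_trans _ _ (expR m ^+ k * A)).
  by rewrite ler_wpM2r// lerXn2r// ?nnegrE// expR_ge0.
rewrite ltr_pM2l ?exprn_gt0 ?expR_gt0//.
by apply: lt_le_trans (expR_ge1Dx A); rewrite ltrDr.
Qed.

End ExponentialMoments.

Section RandomBlocks.
Context {R : realType} {d : measure_display} {Omega : measurableType d}.
Local Notation tau := (pi *+ 2 : R).
Variable P : probability Omega R.
Variable g : int -> Omega -> R[i].
Hypothesis hg : white_noise_coefficients P g.
Variables (sigma eps : R).
Hypothesis eps0 : 0 < eps.
Hypothesis sigma_le : sigma <= 2^-1 - eps.

(** The standard deviation of the k-th block at a point is of order r^k. *)
Let r : R := 2 `^ (- eps).
Let al (n : nat) : R := - n%:~R / (1 + n%:~R ^+ 2).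
Let b (n : nat) : R := japanese n `^ sigma * al n.
(* The k-th dyadic block of the derivative at t = 0 of <D>^sigma Z, up to sign. *)
Definition noise_block k (c : fseries R) (x : R) : R :=
  \sum_(2 ^ k <= n < 2 ^ k.+1) tmode (bessel sigma (phiD c) n) n x.

Let r_gt0 : 0 < r. Proof. exact: powR_gt0. Qed.

Let re n w : R := complex.Re (g n w).
Let im n w : R := complex.Im (g n w).

Lemma noise_blockE k w x : noise_block k (white_noise g w) x =
  \sum_(2 ^ k <= n < 2 ^ k.+1) (- (2 * b n * sinn n x) * re n w + - (2 * b n * cosn n x) * im n w).
Proof.
apply: eq_bigr => n _; rewrite /tmode /bessel /phiD /multiplier !cparts/= /b /al /re /im /white_noise.
ring.
Qed.

(** In powers of <n> >= 2^k: b_n^2 <= <n>^(2 sigma - 2) <= <n>^(- 1 - 2 eps). The factor 2^(-k) pays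
    for the 2^k modes of the block. *)
Lemma block_coefficient n k : (2 ^ k <= n)%N -> b n ^+ 2 <= (2 ^+ k)^-1 * (r ^+ k) ^+ 2.
Proof.
move=> kn; set j : R := japanese n.
have j1 : 1 <= j := japanese_ge1 n.
have j0 : 0 < j by exact: lt_le_trans ltr01 j1.
have jE : j ^+ 2 = 1 + n%:R ^+ 2 by rewrite sqr_sqrtr// addr_ge0// sqr_ge0.
have n2 : 2 ^+ k <= n%:R :> R by rewrite -natrX ler_nat.
have kj : 2 ^+ k <= j.
  rewrite -(@ler_pXn2r _ 2)// ?nnegrE ?exprn_ge0 ?(ltW j0)// jE.
  apply: le_trans (_ : n%:R ^+ 2 <= _); last by rewrite lerDr.
  by rewrite lerXn2r// ?nnegrE ?exprn_ge0.
have p0 : 0 < 2 ^+ k :> R by rewrite exprn_gt0.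
rewrite /b exprMn.
have a2 : al n ^+ 2 <= j `^ (- 2).
  rewrite powRN powR_mulrn ?(ltW j0)// jE /al exprMn sqrrN exprVn.
  have i0 : 0 < 1 + n%:R ^+ 2 :> R by rewrite ltr_pwDl// sqr_ge0.
  rewrite ler_pdivrMr ?exprn_gt0// expr2 [X in _ <= _ * X]expr2 mulKf ?gt_eqF//.
  by rewrite -expr2 lerDr.
apply: (@le_trans _ _ (j `^ (sigma + sigma - 2))).
  rewrite !powRD ?(gt_eqF j0) ?implybT// -expr2.
  by rewrite ler_wpM2l// sqr_ge0.
apply: (@le_trans _ _ (j `^ (- (1 + 2 * eps)))).
  by rewrite ler_powR//; move: sigma_le; lra.
apply: (@le_trans _ _ ((2 ^+ k) `^ (- (1 + 2 * eps)))).
  rewrite !powRN lef_pV2 ?posrE ?powR_gt0//.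
  rewrite ge0_ler_powR// ?nnegrE ?(ltW j0) ?(ltW p0)//; by rewrite addr_ge0// mulr_ge0// ltW.
rewrite opprD powRD ?(gt_eqF p0) ?implybT// powRN powRr1 ?(ltW p0)//.
rewrite ler_wpM2l ?invr_ge0 ?(ltW p0)//.
rewrite -exprM -(powR_mulrn (k * 2) (ltW r_gt0)) -(powR_mulrn k (@ler0n _ 2)) /r -!powRrM natrM.
by rewrite le_eqVlt; apply/orP; left; apply/eqP; congr (_ `^ _); ring.
Qed.

Lemma block_coefficient_sum k : \sum_(2 ^ k <= n < 2 ^ k.+1) b n ^+ 2 <= (r ^+ k) ^+ 2.
Proof.
apply: (@le_trans _ _ (\sum_(2 ^ k <= n < 2 ^ k.+1) (2 ^+ k)^-1 * (r ^+ k) ^+ 2)).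
  rewrite big_nat_cond [leRHS]big_nat_cond; apply: ler_sum => n /andP[/andP[kn _] _].
  exact: block_coefficient.
rewrite big_const_nat iter_addr_0 expnS mul2n -addnn addnK -mulrnAl -mulr_natr natrX.
by rewrite mulVf ?mul1r// gt_eqF// exprn_gt0.
Qed.

(** The independent family starts with the real variable g_0, whose law differs from the others;
    vanishing weights make its factor equal to 1. *)
Let exp_re_im_mgf (a c : nat -> R) (l : seq nat) : a 0%N = 0 -> c 0%N = 0 -> uniq l ->
  (\int[P]_w (expR (\sum_(n <- l) (a n * re n w + c n * im n w)))%:E =
   (expR (\sum_(n <- l) (a n ^+ 2 + c n ^+ 2) / 4))%:E)%E.
Proof.
move=> a0 c0 ul.
have := @expectation_prod _ _ _ P _ _ nat (fun n => re_im (g n%:Z)) (fun n => wnc_measurable hg n)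
  (wnc_independent hg) (fun n p => expR (a n * p.1 + c n * p.2))
  (fun n => expR ((a n ^+ 2 + c n ^+ 2) / 4)) _ _ _ l ul.
rewrite -expR_sum => <-.
- by apply: eq_integral => w _; rewrite expR_sum.
- move=> n; apply: measurableT_comp => //; apply: measurable_funD.
    by apply: measurable_funM => //; exact: measurable_fst.
  by apply: measurable_funM => //; exact: measurable_snd.
- by move=> n p; exact: expR_ge0.
case=> [|n]; last first.
  by apply: (complex_gaussian_mgf (g := g n.+1%:Z)); [apply: (wnc_law hg)|exact: (wnc_measurable hg)].
rewrite a0 c0 expr0n/= addr0 mul0r expR0.
under eq_integral do rewrite !mul0r addr0 expR0.
apply: etrans (integral_cst P measurableT 1%E) _.
by rewrite mul1e; exact: probability_setT.
Qed.

Lemma noise_block_mgf k x theta :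
  (\int[P]_w (expR (theta * noise_block k (white_noise g w) x))%:E <=
   (expR (theta ^+ 2 * (r ^+ k) ^+ 2))%:E)%E.
Proof.
have b0 : b 0%N = 0 by rewrite /b /al oppr0 mul0r mulr0.
pose a n := theta * - (2 * b n * sinn n x); pose c n := theta * - (2 * b n * cosn n x).
have := @exp_re_im_mgf a c (index_iota (2 ^ k) (2 ^ k.+1)) _ _ (iota_uniq _ _).
rewrite /a /c b0 !(mulr0, mul0r, oppr0) => /(_ erefl erefl) e.
rewrite (_ : (\int[P]_w _)%E = (expR (\sum_(2 ^ k <= n < 2 ^ k.+1) theta ^+ 2 * b n ^+ 2))%:E).
  by rewrite lee_fin ler_expR -mulr_sumr ler_wpM2l ?sqr_ge0// block_coefficient_sum.
transitivity (\int[P]_w (expR (\sum_(n <- index_iota (2 ^ k) (2 ^ k.+1)) (theta * - (2 * b n * sinn n x) * re n w + theta * - (2 * b n * cosn n x) * im n w)))%:E)%E.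
  apply: eq_integral => w _; congr (expR _)%:E; rewrite noise_blockE mulr_sumr.
  by apply: eq_bigr => n _; rewrite mulrDr !mulrA.
rewrite e; congr (expR _)%:E; apply: eq_bigr => n _.
(* By cos^2 + sin^2 = 1, the variance of the block does not depend on x. *)
have := cos2Dsin2 (n%:~R * x); rewrite -/(cosn n x) -/(sinn n x) => cs.
move: (cosn n x) (sinn n x) cs => u v cs.
rewrite (_ : _ / 4 = theta ^+ 2 * b n ^+ 2 * (u ^+ 2 + v ^+ 2)); last by field.
by rewrite cs mulr1.
Qed.

(** A block has 2^k modes of frequency about 2^k, so its Lipschitz constant is of order 4^k, up to
    r^k and a factor linear in k; the grid is finer than that requires. *)
Let grid_size k : nat := (32 ^ k)%N.
Let grid k j : R := j%:R * (tau / (grid_size k)%:R).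

Let X k w j := noise_block k (white_noise g w) (grid k j).

(** The weights are 2^(-k) divided by the numbers 32^k and 2^k of terms. Each term has expectation
    O(1), since r^(-k) normalizes the block, so the expectation of q k is O(2^(-k)). *)
Let q k w : R :=
  (64 ^+ k)^-1 * \sum_(0 <= j < grid_size k) (expR (r ^- k * X k w j) + expR (- r ^- k * X k w j)) +
  (4 ^+ k)^-1 * \sum_(2 ^ k <= n < 2 ^ k.+1)
    (expR (re n w) + expR (- re n w) + (expR (im n w) + expR (- im n w))).

Let mre n : measurable_fun setT (re n).
Proof. exact: (measurableT_comp measurable_fst (wnc_measurable hg n)). Qed.

Let mim n : measurable_fun setT (im n).
Proof. exact: (measurableT_comp measurable_snd (wnc_measurable hg n)). Qed.

Let mX k j : measurable_fun setT (fun w => X k w j).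
Proof.
rewrite (_ : (fun w => _) = fun w => \sum_(2 ^ k <= n < 2 ^ k.+1)
  (- (2 * b n * sinn n (grid k j)) * re n w + - (2 * b n * cosn n (grid k j)) * im n w)).
  by apply: measurable_sum => n; apply: measurable_funD; apply: measurable_funM.
by apply/funext => w; rewrite /X noise_blockE.
Qed.

Let mexp (f : Omega -> R) : measurable_fun setT f -> measurable_fun setT (fun w => expR (f w)).
Proof. by move=> mf; apply: measurableT_comp. Qed.

Let mexpM (c : R) (f : Omega -> R) : measurable_fun setT f -> measurable_fun setT (fun w => expR (c * f w)).
Proof. by move=> mf; apply: mexp; apply: measurable_funM. Qed.

Let mexpN (f : Omega -> R) : measurable_fun setT f -> measurable_fun setT (fun w => expR (- f w)).
Proof. by move=> mf; apply: mexp; apply: measurableT_comp. Qed.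

Let mG k j : measurable_fun setT (fun w => expR (r ^- k * X k w j) + expR (- r ^- k * X k w j)).
Proof. by apply: measurable_funD; apply: mexpM. Qed.

Let mH n : measurable_fun setT (fun w => expR (re n w) + expR (- re n w) + (expR (im n w) + expR (- im n w))).
Proof. by apply: measurable_funD; apply: measurable_funD; do ?[exact: mexp|exact: mexpN]. Qed.

Let mq k : measurable_fun setT (q k).
Proof.
apply: measurable_funD; (apply: measurable_funM; first exact: measurable_cst);
  by apply: measurable_sum => j.
Qed.

Let q_terms_ge0 k w : 0 <= \sum_(0 <= j < grid_size k) (expR (r ^- k * X k w j) + expR (- r ^- k * X k w j)).
Proof. by apply: sumr_ge0 => j _; rewrite addr_ge0 ?expR_ge0. Qed.

Let e1 : R := expR 1.

Let EG k j : (\int[P]_w (expR (r ^- k * X k w j) + expR (- r ^- k * X k w j))%:E <= (2 * e1)%:E)%E.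
Proof.
have H theta : theta ^+ 2 = (r ^- k) ^+ 2 -> (\int[P]_w (expR (theta * X k w j))%:E <= e1%:E)%E.
  move=> th; apply: le_trans (noise_block_mgf k _ theta) _.
  by rewrite th -exprMn mulVf ?expr1n// gt_eqF// exprn_gt0.
under eq_integral do rewrite EFinD.
rewrite ge0_integralD//=; last 2 first.
- by apply/measurable_EFinP; exact: mexpM.
- by apply/measurable_EFinP; exact: mexpM.
by rewrite mulr2n mulrDl !mul1r EFinD leeD// H// sqrrN.
Qed.

Let EH n : (0 < n)%N ->
  (\int[P]_w (expR (re n w) + expR (- re n w) + (expR (im n w) + expR (- im n w)))%:E <= (4 * e1)%:E)%E.
Proof.
move=> n0.
have H a c : a ^+ 2 + c ^+ 2 = 1 -> (\int[P]_w (expR (a * re n w + c * im n w))%:E <= e1%:E)%E.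
  move=> ac; rewrite (complex_gaussian_mgf (g := g n%:Z))//.
  - by rewrite ac lee_fin ler_expR; lra.
  - by apply: (wnc_law hg); case: n n0.
  - exact: (wnc_measurable hg).
have Hr : (\int[P]_w (expR (re n w))%:E <= e1%:E)%E.
  by have := H 1 0; under eq_integral do rewrite mul1r mul0r addr0; apply; rewrite expr1n expr0n addr0.
have HNr : (\int[P]_w (expR (- re n w))%:E <= e1%:E)%E.
  by have := H (-1) 0; under eq_integral do rewrite mulN1r mul0r addr0; apply; rewrite sqrrN expr1n expr0n addr0.
have Hi : (\int[P]_w (expR (im n w))%:E <= e1%:E)%E.
  by have := H 0 1; under eq_integral do rewrite mul1r mul0r add0r; apply; rewrite expr1n expr0n add0r.
have HNi : (\int[P]_w (expR (- im n w))%:E <= e1%:E)%E.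
  by have := H 0 (-1); under eq_integral do rewrite mulN1r mul0r add0r; apply; rewrite sqrrN expr1n expr0n add0r.
under eq_integral do rewrite !EFinD.
have m1 : measurable_fun setT (fun w => (expR (re n w))%:E) by apply/measurable_EFinP; exact: mexp.
have m2 : measurable_fun setT (fun w => (expR (- re n w))%:E) by apply/measurable_EFinP; exact: mexpN.
have m3 : measurable_fun setT (fun w => (expR (im n w))%:E) by apply/measurable_EFinP; exact: mexp.
have m4 : measurable_fun setT (fun w => (expR (- im n w))%:E) by apply/measurable_EFinP; exact: mexpN.
rewrite ge0_integralD//=; last 4 first.
- by move=> w _; rewrite adde_ge0// lee_fin expR_ge0.
- exact: emeasurable_funD.
- by move=> w _; rewrite adde_ge0// lee_fin expR_ge0.
- exact: emeasurable_funD.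
rewrite (ge0_integralD _ _ _ m1 _ m2)//=.
rewrite (ge0_integralD _ _ _ m3 _ m4)//=.
rewrite (_ : 4 * e1 = (e1 + e1) + (e1 + e1)); last by ring.
rewrite !EFinD; exact: (leeD (leeD Hr HNr) (leeD Hi HNi)).
Qed.

Let Eq k : (\int[P]_w (q k w)%:E <= ((12 * e1) / (2 ^ (k + 1))%:R)%:E)%E.
Proof.
have p0 : 0 < 2 ^+ k :> R by rewrite exprn_gt0.
have c1 : 0 <= (64 ^+ k)^-1 :> R by rewrite invr_ge0 exprn_ge0.
have c2 : 0 <= (4 ^+ k)^-1 :> R by rewrite invr_ge0 exprn_ge0.
have G0 j w : 0 <= expR (r ^- k * X k w j) + expR (- r ^- k * X k w j) by rewrite addr_ge0 ?expR_ge0.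
have H0 n w : 0 <= expR (re n w) + expR (- re n w) + (expR (im n w) + expR (- im n w)).
  by rewrite !addr_ge0 ?expR_ge0.
have h1 := expectation_sum_le (m := 0) (n := grid_size k) c1 (mG k) G0 (fun j _ => EG k j).
have h2 := expectation_sum_le (m := 2 ^ k) (n := 2 ^ k.+1) c2 (fun n : nat => mH n) (fun n : nat => H0 n) _.
under eq_integral do rewrite /q EFinD.
rewrite ge0_integralD//=; last 4 first.
- by move=> w _; rewrite lee_fin mulr_ge0// sumr_ge0.
- apply/measurable_EFinP; apply: measurable_funM; first exact: measurable_cst.
  by apply: measurable_sum => j.
- by move=> w _; rewrite lee_fin mulr_ge0// sumr_ge0.
- apply/measurable_EFinP; apply: measurable_funM; first exact: measurable_cst.
  by apply: measurable_sum => j.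
apply: le_trans (leeD h1 (h2 P (4 * e1) _)) _.
  by move=> n /andP[kn _]; apply: EH; apply: leq_trans kn; rewrite expn_gt0.
rewrite -EFinD lee_fin subn0 expnS mul2n -addnn addnK addn1 expnS natrM !natrX.
have p32 : 0 < 32 ^+ k :> R by rewrite exprn_gt0.
rewrite (_ : 64 ^+ k = 2 ^+ k * 32 ^+ k :> R); last by rewrite -exprMn -natrM.
rewrite (_ : 4 ^+ k = 2 ^+ k * 2 ^+ k :> R); last by rewrite -exprMn -natrM.
rewrite le_eqVlt; apply/orP; left; apply/eqP.
by move: (2 ^+ k) (32 ^+ k) p0 p32 => y z y0 z0; field; rewrite !gt_eqF.
Qed.

Let q_ge0 k w : 0 <= q k w.
Proof.
apply: addr_ge0; apply: mulr_ge0; rewrite ?invr_ge0 ?exprn_ge0//.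
by apply: sumr_ge0 => n _; rewrite !addr_ge0 ?expR_ge0.
Qed.

Let sum_nat_ge (m n j : nat) (f : nat -> R) : (forall i, 0 <= f i) -> (m <= j < n)%N ->
  f j <= \sum_(m <= i < n) f i.
Proof.
move=> f0 jn; rewrite (bigD1_seq j)/= ?mem_index_iota ?iota_uniq// lerDl.
by apply: sumr_ge0.
Qed.

Let expR_natE (m : nat) : 2 ^+ m <= expR m%:R :> R.
Proof.
rewrite -[m%:R]mul1r expRM_natr lerXn2r// ?nnegrE ?expR_ge0//.
by have := expR_ge1Dx (1 : R).
Qed.

(** Taking logarithms of the weights makes the bounds linear in k: the slopes 2 and 6 come from 4 <=
    e^2 and 64 <= e^6. The factor 2 in the first bound adds real and imaginary parts. *)
Lemma random_blocks_bound : exists S : set Omega, [/\ measurable S, P S = 1%E &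
  forall w, S w -> exists2 A : R, 0 <= A & forall k : nat,
    (forall n : nat, (2 ^ k <= n < 2 ^ k.+1)%N ->
       Normc.normc (white_noise g w n) <= 2 * (A + 2 * k%:R)) /\
    (forall j : nat, (j < 32 ^ k)%N ->
       `|noise_block k (white_noise g w) (j%:R * (tau / (32 ^ k)%:R))| <= r ^+ k * (A + 6 * k%:R))].
Proof.
have [S [mS PS H]] := ae_bounded_of_summable_expectation mq q_ge0 Eq.
exists S; split => // w /H[A A0 qA]; exists A => // k.
have h64 : 0 < 64 ^+ k :> R by rewrite exprn_gt0.
have h4 : 0 < 4 ^+ k :> R by rewrite exprn_gt0.
have H0 (n : nat) : 0 <= expR (re n w) + expR (- re n w) + (expR (im n w) + expR (- im n w)).
  by rewrite !addr_ge0 ?expR_ge0.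
have := qA k; rewrite /q => qk.
have B6 : 64 <= expR 6 :> R by apply: le_trans (expR_natE 6); rewrite -natrX.
have B2 : 4 <= expR 2 :> R by apply: le_trans (expR_natE 2); rewrite -natrX.
split.
  move=> n nk.
  have hn : expR (re n w) + expR (- re n w) + (expR (im n w) + expR (- im n w)) <= 4 ^+ k * A.
    rewrite -ler_pdivrMl//; apply: le_trans qk.
    apply: (@le_trans _ _ ((4 ^+ k)^-1 * \sum_(2 ^ k <= n < 2 ^ k.+1)
      (expR (re n w) + expR (- re n w) + (expR (im n w) + expR (- im n w))))).
      rewrite ler_wpM2l ?invr_ge0 ?(ltW h4)//.
      exact: (@sum_nat_ge _ _ n (fun n : nat => expR (re n w) + expR (- re n w) + (expR (im n w) + expR (- im n w)))).
    by rewrite lerDr mulr_ge0// invr_ge0 ltW.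
  have h1 : `|re n w| <= A + 2 * k%:R.
    apply: (norm_le_of_expR A0 _ B2) => //; apply: le_trans hn.
    by rewrite lerDl addr_ge0 ?expR_ge0.
  have h2 : `|im n w| <= A + 2 * k%:R.
    apply: (norm_le_of_expR A0 _ B2) => //; apply: le_trans hn.
    by rewrite lerDr addr_ge0 ?expR_ge0.
  by apply: le_trans (normc_le_ReIm _) _; rewrite mulr2n mulrDl mul1r lerD.
move=> j jk.
have hj : expR (r ^- k * X k w j) + expR (- (r ^- k * X k w j)) <= 64 ^+ k * A.
  rewrite -ler_pdivrMl//; apply: le_trans qk.
  apply: (@le_trans _ _ ((64 ^+ k)^-1 * \sum_(0 <= j < grid_size k)
     (expR (r ^- k * X k w j) + expR (- r ^- k * X k w j)))).
    rewrite ler_wpM2l ?invr_ge0 ?(ltW h64)// -mulNr.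
    exact: (@sum_nat_ge _ _ j (fun j => expR (r ^- k * X k w j) + expR (- r ^- k * X k w j))).
  by rewrite lerDl mulr_ge0// ?invr_ge0 ?(ltW h4)// sumr_ge0.
have := norm_le_of_expR A0 _ B6 hj; rewrite normrM ger0_norm ?invr_ge0 ?exprn_ge0 ?(ltW r_gt0)//.
by rewrite ler_pdivrMl ?exprn_gt0// => /(_ (ler0n _ _)).
Qed.

End RandomBlocks.

(** * The stochastic convolution *)

Section TrigonometricEstimates.
Context {R : realType}.
Local Notation tau := (pi *+ 2 : R).

Lemma mean_value_le (f df : R -> R) (a b B : R) :
  (forall x : R, is_derive x 1 f (df x)) ->
  (forall x, Num.min a b <= x <= Num.max a b -> `|df x| <= B) ->
  `|f b - f a| <= B * `|b - a|.
Proof.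
move=> fd; wlog ab : a b / a <= b => [H|] dB.
  have [ab|/ltW ba] := leP a b; first exact: H.
  by rewrite distrC [X in _ <= _ * X]distrC; apply: H => // x; rewrite minC maxC; exact: dB.
have cf : continuous f := der_continuous fd.
have [x xab ->] := MVT_segment ab (fun x _ => fd x) (continuous_subspaceT cf).
rewrite normrM ler_wpM2r// dB// (min_idPl ab) (max_idPr ab).
by move: xab; rewrite in_itv.
Qed.

Lemma cos_lipschitz (a b : R) : `|cos b - cos a| <= `|b - a|.
Proof.
rewrite -[leRHS]mul1r; apply: (mean_value_le (df := fun x => - sin x)) => x.
by rewrite normrN sin_max.
Qed.

Lemma sin_lipschitz (a b : R) : `|sin b - sin a| <= `|b - a|.
Proof.
rewrite -[leRHS]mul1r; apply: (mean_value_le (df := cos)) => x.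
by rewrite cos_max.
Qed.

Let between0 (x y : R) : Num.min 0 y <= x <= Num.max 0 y -> `|x| <= `|y|.
Proof.
case: (leP 0 y) => y0 /andP[h1 h2].
  by rewrite !ger0_norm.
by rewrite !ler0_norm ?(ltW y0)// lerN2.
Qed.

(** With [sub_sin_le] this bounds e^(i y) - 1 - i y quadratically: the error of the first-order
    expansion of S(t). *)
Lemma one_sub_cos_le (y : R) : `|1 - cos y| <= y ^+ 2.
Proof.
rewrite -{1}[1](@cos0 R) distrC -real_normK ?num_real// expr2 -{3}[y]subr0.
apply: (mean_value_le (df := fun x => - sin x)) => x xy.
rewrite normrN; apply: le_trans (between0 xy).
by have := sin_lipschitz 0 x; rewrite sin0 !subr0.
Qed.

Lemma sub_sin_le (y : R) : `|y - sin y| <= y ^+ 2.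
Proof.
have : `|(y - sin y) - (0 - sin 0)| <= `|y| * `|y - 0|.
  apply: (mean_value_le (f := fun y => y - sin y) (df := fun x => 1 - cos x)) => x.
  move=> xy; apply: le_trans (between0 xy).
  by have := cos_lipschitz x 0; rewrite cos0 sub0r normrN.
by rewrite sin0 !subr0 -expr2 real_normK ?num_real.
Qed.

Lemma tmodeD (z w : R[i]) n x : tmode (z + w) n x = tmode z n x + tmode w n x.
Proof. by rewrite /tmode !cparts; ring. Qed.

Lemma tmodeZ (a : R) (z : R[i]) n x : tmode (a%:C%C * z) n x = a * tmode z n x.
Proof. by rewrite /tmode !cparts/=; ring. Qed.

Lemma tmode_lipschitz (z : R[i]) (n : nat) x y :
  `|tmode z n x - tmode z n y| <= 4 * (n%:R * Normc.normc z) * `|x - y|.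
Proof.
rewrite /tmode -mulrBr normrM ger0_norm//.
set u := complex.Re z; set v := complex.Im z.
rewrite (_ : _ - _ - _ = u * (cosn n x - cosn n y) - v * (sinn n x - sinn n y)); last by ring.
have hc : `|cosn n x - cosn n y| <= n%:R * `|x - y|.
  by apply: le_trans (cos_lipschitz _ _) _; rewrite -mulrBr normrM ger0_norm.
have hs : `|sinn n x - sinn n y| <= n%:R * `|x - y|.
  by apply: le_trans (sin_lipschitz _ _) _; rewrite -mulrBr normrM ger0_norm.
apply: (@le_trans _ _ (2 * (Normc.normc z * (n%:R * `|x - y|) + Normc.normc z * (n%:R * `|x - y|)))).
  rewrite ler_wpM2l//; apply: le_trans (ler_normB _ _) _; rewrite !normrM.
  by apply: lerD; apply: ler_pM => //; [exact: Re_le_normc|exact: Im_le_normc].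
by rewrite le_eqVlt; apply/orP; left; apply/eqP; ring.
Qed.

End TrigonometricEstimates.

(** * Summation of the noise blocks for one sample *)

Section NoiseSeries.
Context {R : realType}.
Local Notation tau := (pi *+ 2 : R).
Variables (c : fseries R) (sigma eps A : R).
Hypothesis eps0 : 0 < eps.
Hypothesis sigma_le : sigma <= 2^-1 - eps.
Hypothesis A0 : 0 <= A.
Let r : R := 2 `^ (- eps).
Hypothesis c_le : forall (k n : nat), (2 ^ k <= n < 2 ^ k.+1)%N ->
  Normc.normc (c n) <= 2 * (A + 2 * k%:R).
Hypothesis grid_le : forall (k j : nat), (j < 32 ^ k)%N ->
  `|noise_block sigma k c (j%:R * (tau / (32 ^ k)%:R))| <= r ^+ k * (A + 6 * k%:R).

Let al (n : nat) : R := - n%:~R / (1 + n%:~R ^+ 2).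
Let b (n : nat) : R := japanese n `^ sigma * al n.

Let r0 : 0 < r. Proof. exact: powR_gt0. Qed.
Let rk0 k : 0 <= r ^+ k. Proof. by rewrite exprn_ge0// ltW. Qed.

Let r1 : r < 1.
Proof.
rewrite /r powRN invf_lt1 ?powR_gt0//.
have : 1 `^ eps < 2 `^ eps :> R by apply: gt0_ltr_powR; rewrite ?nnegrE// ltr1n.
by rewrite powR1.
Qed.

Let b_le (k n : nat) : (2 ^ k <= n)%N -> `|b n| <= r ^+ k.
Proof.
move=> kn; rewrite -(@ler_pXn2r _ 2)// ?nnegrE// real_normK ?num_real//.
apply: le_trans (block_coefficient eps0 sigma_le kn) _.
rewrite ler_piMl ?sqr_ge0// invf_le1 ?exprn_gt0//.
by rewrite exprn_ege1// ler1n.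
Qed.

Let al_le (k n : nat) : (2 ^ k <= n)%N -> `|al n| <= (2 ^+ k)^-1.
Proof.
move=> kn; have n2 : 2 ^+ k <= n%:R :> R by rewrite -natrX ler_nat.
have n0 : 0 < n%:R :> R by apply: lt_le_trans n2; rewrite exprn_gt0.
have j0 : 0 < 1 + n%:R ^+ 2 :> R by rewrite ltr_pwDl// sqr_ge0.
rewrite /al mulNr normrN ger0_norm; last by rewrite divr_ge0// ltW.
apply: (@le_trans _ _ (n%:R^-1)); last by rewrite lef_pV2 ?posrE// exprn_gt0.
by rewrite ler_pdivrMr// ler_pdivlMl// -expr2 lerDr.
Qed.

Let normc_coef n : Normc.normc (bessel sigma (phiD c) n%:Z) = `|b n| * Normc.normc (c n).
Proof.
rewrite normc_bessel /phiD /multiplier Normc.normcM mulrA; congr (_ * _).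
by rewrite /b normrM [X in _ = X * _]ger0_norm ?powR_ge0// /phi /Normc.normc expr0n/= add0r sqrtr_sqr.
Qed.

Lemma noise_block_periodic k : periodic (noise_block sigma k c) tau.
Proof. by move=> x; apply: eq_bigr => n _; rewrite tmode_periodic. Qed.

Let near_grid k (x : R) : 0 <= x <= tau -> exists2 j : nat, (j < 32 ^ k)%N &
  `|x - j%:R * (tau / (32 ^ k)%:R)| <= tau / (32 ^ k)%:R.
Proof.
move=> /andP[x0 xt]; have N0 : (0 < 32 ^ k)%N by rewrite expn_gt0.
move: (32 ^ k)%N N0 => N N0.
have h0 : 0 < tau / N%:R by rewrite divr_gt0 ?tau_gt0// ltr0n.
set h := tau / N%:R in h0 *.
have Nh : N%:R * h = tau by rewrite /h mulrCA divff ?mulr1// gt_eqF// ltr0n.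
(* The grid omits the endpoint tau, so points of the last cell are assigned to its left end N -
   1. *)
have [xN|xN] := ltP x ((N.-1)%:R * h); last first.
  exists N.-1; first by rewrite prednK.
  rewrite ger0_norm ?subr_ge0// lerBlDl.
  by rewrite (le_trans xt)// -Nh -[in N%:R](prednK N0) -natr1 mulrDl mul1r.
have xh0 : 0 <= x / h by rewrite divr_ge0// ltW.
exists (Num.truncn (x / h)).
  rewrite truncn_lt_nat// ltr_pdivrMr//; apply: lt_le_trans xN _.
  by rewrite ler_wpM2r ?(ltW h0)// ler_nat leq_pred.
have l1 : (Num.truncn (x / h))%:R * h <= x by rewrite -ler_pdivlMr// truncn_le.
have l2 : x < ((Num.truncn (x / h)).+1)%:R * h by rewrite -ltr_pdivrMr// truncnS_gt.
rewrite ger0_norm ?subr_ge0// lerBlDl; apply: ltW.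
by move: l2; rewrite -natr1 mulrDl mul1r.
Qed.

(** 16 tau bounds the variation between a point and the grid, 1 the value on the grid. *)
Let K0 : R := 16 * tau + 1.
Let tau0 : 0 <= tau. Proof. exact: ltW (@tau_gt0 R). Qed.
Let K00 : 0 <= K0. Proof. by rewrite addr_ge0// mulr_ge0. Qed.

Lemma noise_block_sup k x : `|noise_block sigma k c x| <= K0 * (r ^+ k * (A + 6 * k%:R)).
Proof.
have [y y0 E] := periodic_reduce x; rewrite (E _ (@noise_block_periodic k)).
have [j jk hj] := near_grid k y0.
set xj := j%:R * _ in hj *.
have lip : `|noise_block sigma k c y - noise_block sigma k c xj| <= 16 * tau * (r ^+ k * (A + 6 * k%:R)).
  rewrite -sumrB; apply: le_trans (ler_norm_sum _ _ _) _.
  apply: (@le_trans _ _ (\sum_(2 ^ k <= n < 2 ^ k.+1)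
      (4 * (2 * 2 ^+ k * (r ^+ k * (2 * (A + 6 * k%:R)))) * (tau / 32 ^+ k)))).
    rewrite big_nat_cond [leRHS]big_nat_cond; apply: ler_sum => n /andP[nk _].
    have /andP[kn kn'] := nk.
    apply: le_trans (tmode_lipschitz _ _ _ _) _.
    apply: ler_pM => //; first by rewrite !mulr_ge0 ?normc_ge0.
      rewrite ler_wpM2l// ler_pM ?normc_ge0//.
        by rewrite -natrX -natrM ler_nat -expnS ltnW.
      rewrite normc_coef ler_pM ?normc_ge0// ?b_le//.
      apply: le_trans (c_le nk) _; rewrite ler_wpM2l// lerD2l ler_wpM2r// ler_nat//.
    by rewrite -natrX.
  rewrite big_const_nat iter_addr_0 expnS mul2n -addnn addnK -[leLHS]mulr_natr natrX.
  have p2 : 0 < 2 ^+ k :> R by rewrite exprn_gt0.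
  (* One factor 2^k cancels the number of modes and the other their frequency; 8^(-k) is left
     over. *)
  have -> : 32 ^+ k = 2 ^+ k * (2 ^+ k * 8 ^+ k) :> R by rewrite -!exprMn -!natrM.
  have p8 : 1 <= 8 ^+ k :> R by rewrite exprn_ege1// ler1n.
  set B := r ^+ k * (A + 6 * k%:R).
  have B0 : 0 <= B by rewrite mulr_ge0// addr_ge0// mulr_ge0.
  rewrite (_ : _ * 2 ^+ k = 16 * tau * B / 8 ^+ k).
    by rewrite ler_pdivrMr ?(lt_le_trans ltr01)// ler_peMr// mulr_ge0// mulr_ge0.
  rewrite /B; move: (2 ^+ k) p2 (8 ^+ k) p8 => p p0 e e1.
  by field; rewrite !gt_eqF// (lt_le_trans ltr01).
rewrite -[noise_block _ _ _ y](subrK (noise_block sigma k c xj)).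
apply: le_trans (ler_normD _ _) _; rewrite /K0 mulrDl mul1r.
by apply: lerD => //; exact: grid_le.
Qed.

(* Evaluating the Duhamel integral gives Z(t) = (1 - S(t)) zeta. *)
Definition evolved_noise (t : R) (n : nat) : R[i] :=
  bessel sigma (fun m => (1 - cexp (t%:C%C * phi m)) * c m) n.

Let f k (p : R * R) : R := \sum_(2 ^ k <= n < 2 ^ k.+1) tmode (evolved_noise p.1 n) n p.2.

(** The second-order remainder in 1 - e^(i y) = - i y + rho(y). *)
Let rho (y : R) : R[i] := Complex (1 - cos y) (y - sin y).

Let evolvedE t n : evolved_noise t n =
  (- t)%:C%C * bessel sigma (phiD c) n + rho (t * al n) * bessel sigma c n.
Proof.
rewrite /evolved_noise /bessel /phiD /multiplier.
have -> : 1 - cexp (t%:C%C * phi n) = (- t)%:C%C * phi n + rho (t * al n).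
  apply: complex_ext; rewrite !cparts/= !mul0r !mulr0 ?addr0 ?add0r ?subr0 ?oppr0 expR0 !mul1r.
    by rewrite add0r /al.
  by rewrite -/(al n); ring.
by ring.
Qed.

Let rho_le y : Normc.normc (rho y) <= 2 * y ^+ 2.
Proof.
apply: le_trans (normc_le_ReIm _) _; rewrite mulr2n mulrDl mul1r.
by apply: lerD; [exact: one_sub_cos_le|exact: sub_sin_le].
Qed.

(** The linear term is - t times the noise block, where the probabilistic bound applies. The
    remainder is summed in absolute value: its quadratic factor supplies an extra |phi(n)| <=
    2^(-k), which compensates the 2^k modes. *)
Let f_le k p : `|f k p| <= (`|p.1| + p.1 ^+ 2) * ((K0 + 16) * (r ^+ k * (A + 6 * k%:R))).
Proof.
set B := r ^+ k * (A + 6 * k%:R); have B0 : 0 <= B by rewrite mulr_ge0// addr_ge0// mulr_ge0.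
case: p => t x /=.
have -> : f k (t, x) = - t * noise_block sigma k c x +
    \sum_(2 ^ k <= n < 2 ^ k.+1) tmode (rho (t * al n) * bessel sigma c n) n x.
  rewrite /noise_block mulr_sumr -big_split/=; apply: eq_bigr => n _.
  by rewrite evolvedE tmodeD tmodeZ.
have h1 : `|- t * noise_block sigma k c x| <= `|t| * (K0 * B).
  by rewrite normrM normrN ler_wpM2l// noise_block_sup.
have h2 : `|\sum_(2 ^ k <= n < 2 ^ k.+1) tmode (rho (t * al n) * bessel sigma c n) n x| <= t ^+ 2 * (16 * B).
  apply: le_trans (ler_norm_sum _ _ _) _.
  apply: (@le_trans _ _ (\sum_(2 ^ k <= n < 2 ^ k.+1) t ^+ 2 * (16 * B) / 2 ^+ k)).
    rewrite big_nat_cond [leRHS]big_nat_cond; apply: ler_sum => n /andP[nk _].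
    have /andP[kn _] := nk.
    apply: le_trans (tmode_norm_le _ _ _) _.
    rewrite Normc.normcM normc_bessel.
    apply: (@le_trans _ _ (4 * (2 * (t * al n) ^+ 2 * (japanese n `^ sigma * Normc.normc (c n))))).
      by rewrite ler_wpM2l// ler_wpM2r// mulr_ge0 ?powR_ge0 ?normc_ge0.
    rewrite (_ : 4 * _ = t ^+ 2 * (8 * (`|b n| * `|al n| * Normc.normc (c n)))); last first.
      rewrite /b normrM ger0_norm ?powR_ge0// exprMn -[al n ^+ 2]real_normK ?num_real//; ring.
    rewrite -[leRHS]mulrA ler_wpM2l ?sqr_ge0//.
    rewrite (_ : 16 * B / 2 ^+ k = 8 * (r ^+ k * (2 ^+ k)^-1 * (2 * (A + 6 * k%:R)))); last by rewrite /B; ring.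
    rewrite ler_wpM2l// ler_pM ?mulr_ge0 ?normc_ge0//.
      by rewrite ler_pM// ?b_le// al_le.
    by apply: le_trans (c_le nk) _; rewrite ler_wpM2l// lerD2l ler_wpM2r// ler_nat.
  rewrite big_const_nat iter_addr_0 expnS mul2n -addnn addnK -[leLHS]mulr_natr natrX.
  by rewrite divfK// gt_eqF// exprn_gt0.
apply: le_trans (ler_normD _ _) _; apply: le_trans (lerD h1 h2) _.
have t0 := normr_ge0 t; have t2 := sqr_ge0 t.
rewrite -subr_ge0 (_ : _ - _ = `|t| * (16 * B) + t ^+ 2 * (K0 * B)); last by ring.
by apply: addr_ge0; apply: mulr_ge0 => //; apply: mulr_ge0.
Qed.

Let bound (p : R * R) : R := `|p.1| + p.1 ^+ 2.
Let m k : R := (K0 + 16) * (r ^+ k * (A + 6 * k%:R)).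

Let bound_ge0 p : 0 <= bound p. Proof. by rewrite addr_ge0// sqr_ge0. Qed.
Let m0 k : 0 <= m k. Proof. by rewrite !mulr_ge0 ?addr_ge0// mulr_ge0. Qed.

Let cbound : continuous bound.
Proof.
have c1 : continuous (fun p : R * R => p.1) by move=> p; exact: cvg_fst.
by apply: ctsD; [exact: cts_norm|exact: ctsX].
Qed.

(** The linear factor is absorbed by half of the decay, r^k becoming (sqrt r)^k. *)
Let cm : cvgn (series m).
Proof.
have r01 : 0 < r < 1 by rewrite r0 r1.
have [C [C0 HC]] := geometric_linear_le r01.
have s0 : 0 <= Num.sqrt r by exact: sqrtr_ge0.
have s1 : Num.sqrt r < 1 by rewrite -sqrtr1 ltr_sqrt.
apply: (@series_le_cvg _ _ (geometric ((K0 + 16) * (A + 6 * C)) (Num.sqrt r))) => //.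
- by move=> k; rewrite !mulr_ge0 ?addr_ge0 ?exprn_ge0// mulr_ge0// ltW.
- move=> k; rewrite /m /geometric/= -mulrA ler_wpM2l//; first exact: addr_ge0.
  rewrite [leLHS]mulrDr [leRHS]mulrDl; apply: lerD.
    rewrite mulrC ler_wpM2l//.
    rewrite -[in leLHS](sqr_sqrtr (ltW r0)) -exprM mul2n -addnn exprD ler_piMl ?exprn_ge0//.
    by rewrite exprn_ile1// ltW.
  by rewrite mulrCA -mulrA ler_wpM2l// mulrC.
- by apply: is_cvg_geometric_series; rewrite ger0_norm.
Qed.

Let evolved_parts t n : evolved_noise t n = Complex
  (japanese n `^ sigma * ((1 - cos (t * al n)) * complex.Re (c n) + sin (t * al n) * complex.Im (c n)))
  (japanese n `^ sigma * ((1 - cos (t * al n)) * complex.Im (c n) - sin (t * al n) * complex.Re (c n))).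
Proof.
apply: complex_ext; rewrite /evolved_noise /bessel /multiplier !cparts/= !mul0r !mulr0 !subr0 ?addr0 expR0 !mul1r /al; ring.
Qed.

Let cf k : continuous (f k).
Proof.
have c1 : continuous (fun p : R * R => p.1) by move=> p; exact: cvg_fst.
have c2 : continuous (fun p : R * R => p.2) by move=> p; exact: cvg_snd.
apply: continuous_sum => n.
have ca : continuous (fun p : R * R => p.1 * al n) by apply: ctsM => //; exact: ctsC.
have cc := cts_comp (@continuous_cos R) ca; have cs := cts_comp (@continuous_sin R) ca.
have k1 := cts_comp (continuous_cosn (n := n)) c2; have k2 := cts_comp (continuous_sinn (n := n)) c2.
rewrite /tmode (_ : (fun x => _) = fun p : R * R => 2 * (
  japanese n `^ sigma * ((1 - cos (p.1 * al n)) * complex.Re (c n) + sin (p.1 * al n) * complex.Im (c n)) * cosn n p.2 -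
  japanese n `^ sigma * ((1 - cos (p.1 * al n)) * complex.Im (c n) - sin (p.1 * al n) * complex.Re (c n)) * sinn n p.2)).
  apply: ctsM; first exact: ctsC.
  apply: ctsB; apply: ctsM => //; apply: ctsM; do ?exact: ctsC.
    by apply: ctsD; apply: ctsM; do ?[exact: ctsC|exact: cs]; apply: ctsB; do ?[exact: ctsC|exact: cc].
  by apply: ctsB; apply: ctsM; do ?[exact: ctsC|exact: cs]; apply: ctsB; do ?[exact: ctsC|exact: cc].
by apply/funext => p; rewrite evolved_parts.
Qed.

Lemma evolved_noise0 t : evolved_noise t 0 = 0.
Proof. by rewrite evolved_parts /al oppr0 mul0r mulr0 cos0 sin0 subrr !mul0r !addr0 subr0 mulr0. Qed.

(** The dyadic blocks start at n = 1; the constant mode is absent because phi(0) = 0. *)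
Let tpoly_blocks t x K : tpoly (evolved_noise t) (2 ^ K) x = \sum_(0 <= k < K) f k (t, x).
Proof.
rewrite /tpoly evolved_noise0 add0r; elim: K => [|K IH]; first by rewrite !big_geq.
rewrite (@big_cat_nat _ _ _ (2 ^ K))//= ?expn_gt0 ?leq_exp2l//.
by rewrite IH big_nat_recr.
Qed.

Lemma evolved_noise_series : exists (Z : R -> R -> R) (M : R),
  [/\ 0 <= M, continuous (fun p : R * R => Z p.1 p.2), forall t, periodic (Z t) tau,
    forall t x, `|Z t x| <= (`|t| + t ^+ 2) * M &
    forall t (e : R), 0 < e -> \forall K \near \oo,
      forall x, `|Z t x - tpoly (evolved_noise t) (2 ^ K) x| <= e].
Proof.
have ap := series_sum_approx bound_ge0 m0 cm f_le.
pose Z t x := series_sum f (t, x).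
exists Z, (series_tail m 0); split.
- exact: (series_tail_ge0 m0 cm).
- have := continuous_series_sum cf cbound bound_ge0 m0 cm f_le.
  by rewrite (_ : (fun p => _) = series_sum f)//; apply/funext => -[].
- move=> t x; rewrite /Z /series_sum; congr (limn _); apply/funext => K.
  by apply: eq_bigr => k _; apply: eq_bigr => n _ /=; rewrite tmode_periodic.
- by move=> t x; have := ap 0%N (t, x); rewrite big_geq// subr0.
move=> t e e0.
have eb : 0 < e / (bound (t, 0) + 1) by rewrite divr_gt0// ltr_pwDr.
have /cvgrPdist_le /(_ _ eb) := series_tail_cvg0 cm.
apply: filterS => K; rewrite sub0r normrN => h x.
rewrite tpoly_blocks; apply: le_trans (ap K (t, x)) _.
apply: (@le_trans _ _ ((bound (t, 0) + 1) * (e / (bound (t, 0) + 1)))); last first.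
  by rewrite mulrC divfK// gt_eqF// ltr_pwDr.
apply: ler_pM; rewrite ?(series_tail_ge0 m0 cm)//; first by rewrite /bound/= lerDl.
exact: le_trans (ler_norm _) h.
Qed.

Hypothesis c_conj : forall n : int, c (- n) = conjc (c n).

Lemma hermitian_evolved t (n : int) :
  hermitian (evolved_noise t) n = bessel sigma (fun m => (1 - cexp (t%:C%C * phi m)) * c m) n.
Proof.
case: n => n //; rewrite NegzE [LHS]/=.
have jN : japanese (- n.+1%:Z) = japanese n.+1 :> R by rewrite /japanese mulrNz sqrrN.
rewrite evolved_parts /bessel /multiplier c_conj jN.
have -> : phi (- n.+1%:Z) = Complex 0 (- al n.+1) :> R[i].
  by apply: complex_ext; rewrite //= mulrNz sqrrN /al mulNr.
have -> : cexp (t%:C%C * Complex 0 (- al n.+1)) = Complex (cos (t * al n.+1)) (- sin (t * al n.+1)).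
  rewrite /cexp; apply: complex_ext; rewrite /= !mul0r !mulr0 subrr !addr0 expR0 mul1r mulrN.
    by rewrite cosN.
  by rewrite sinN.
case: (c n.+1) => u v; apply: complex_ext; rewrite !cparts/=; ring.
Qed.

Lemma fourier_evolved (Z : R -> R) t : continuous Z -> periodic Z tau ->
  (forall e : R, 0 < e -> \forall K \near \oo,
      forall x, `|Z x - tpoly (evolved_noise t) (2 ^ K) x| <= e) ->
  fourier Z = bessel sigma (fun m => (1 - cexp (t%:C%C * phi m)) * c m).
Proof.
move=> cZ pZ H; apply/funext => n; rewrite -hermitian_evolved.
rewrite (@fourier_tseries _ (evolved_noise t))//.
  by rewrite evolved_noise0.
move=> e k e0; have [K _ HK] := H e e0.
exists (2 ^ maxn K k)%N.
  by apply: leq_ltn_trans (leq_maxr K k) _; exact: ltn_expl.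
by move=> x; apply: HK => /=; exact: leq_maxl.
Qed.

End NoiseSeries.

Section TrigonometricPolynomials.
Context {R : realType}.
Local Notation tau := (pi *+ 2 : R).
Implicit Types a : nat -> R[i].

Lemma is_derive_tpoly a K (x : R) :
  is_derive x 1 (tpoly a K) (tpoly (fun n => Complex 0 n%:R * a n) K x).
Proof.
have dm n : is_derive x 1 (tmode (a n) n%:Z) (tmode (Complex 0 n%:R * a n) n x).
  have h := derZ 2 (derB (derZ (complex.Re (a n)) (is_derive_cosn n x))
    (derZ (complex.Im (a n)) (is_derive_sinn n x))).
  by apply: der_eq h _; rewrite /tmode !cparts/=; ring.
have h := derD (der_cst x (complex.Re (a 0%N))) (@der_sum _ _ (index_iota 1 K) xpredT _ _ x dm).
apply: der_eq h _; rewrite /tpoly add0r [X in X + _](_ : _ = 0) ?add0r//.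
by rewrite cparts/= !mul0r subrr.
Qed.

(** Differentiation maps trigonometric polynomials to trigonometric polynomials, multiplying the
    coefficients by i n. *)
Lemma torus_smooth_tpoly a K : torus_smooth (tpoly a K).
Proof.
split; first exact: tpoly_periodic.
have D a' x : derivable (tpoly a' K) x 1 by have [] := is_derive_tpoly a' K x.
suff H k : exists a', derive1n k (tpoly a K) = tpoly a' K.
  by move=> k x; have [a' ->] := H k.
elim: k => [|k [a' e]]; first by exists a.
exists (fun n => Complex 0 n%:R * a' n); rewrite derive1nS e.
by apply/funext => x; rewrite derive1E; have [_ ->] := is_derive_tpoly a' K x.
Qed.

Lemma fourier_tpoly_high a K m : (0 < K <= `|m|)%N -> fourier (tpoly a K) m = 0.
Proof.
move=> /andP[K0 Km]; rewrite fourierD; first last.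
- by apply: torus_L1_sum => n; exact: torus_L1_tmode.
- by apply: torus_L1_continuous => //; exact: ctsC.
rewrite fourier_cst fourier_sum; last by move=> n; exact: torus_L1_tmode.
have -> : (m == 0) = false by apply/negbTE; rewrite -absz_gt0 (leq_trans K0).
rewrite mulr0 add0r big1_seq// => n /andP[_].
rewrite mem_index_iota => /andP[n1 nK]; rewrite fourier_tmode.
have -> : (n%:Z == m) = false.
  by apply: contraTF nK => /eqP e; rewrite -leqNgt -[n]absz_nat e.
have -> : (n%:Z == - m) = false.
  by apply: contraTF nK => /eqP e; rewrite -leqNgt -[n]absz_nat e abszN.
by rewrite subrr addr0 !mulr0.
Qed.

Lemma bessel_tpoly (s : R) a K : complex.Im (a 0%N) = 0 -> (0 < K)%N ->
  bessel s (fourier (tpoly a K)) =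
  fourier (tpoly (fun n => (japanese n `^ s)%:C%C * a n) K).
Proof.
move=> a0 K0; apply/funext => m; rewrite /bessel /multiplier.
have [mK|Km] := ltnP `|m|%N K; last by rewrite !fourier_tpoly_high ?K0// mulr0.
rewrite !fourier_tpoly//; last by rewrite cparts/= mul0r addr0 a0 mulr0.
case: m mK => n _ //; rewrite NegzE.
have -> : japanese (- n.+1%:Z) = japanese n.+1 :> R by rewrite /japanese mulrNz sqrrN.
by rewrite /hermitian /=; case: (a n.+1) => u v; apply: complex_ext; rewrite !cparts/=; ring.
Qed.

End TrigonometricPolynomials.

Section StochasticConvolution.
Context {R : realType}.
Local Notation mu := (@lebesgue_measure R).
Local Notation tau := (pi *+ 2 : R).

(** The factor phi(n) makes the integrand an exact s-derivative of - e^((t - s) phi(n)) z. Nothing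
    is divided by phi(n), so n = 0 is included. *)
Lemma Cintegral_semigroup (t : R) (n : int) (z : R[i]) : 0 <= t ->
  - Cintegral `[0, t] (fun s => cexp ((t - s)%:C%C * phi n) * (phi n * z)) =
  (1 - cexp (t%:C%C * phi n)) * z.
Proof.
move=> t0; pose al : R := - n%:~R / (1 + n%:~R ^+ 2); case: z => u v.
have ce y : cexp (y%:C%C * phi n) = Complex (cos (y * al)) (sin (y * al)).
  rewrite /cexp; apply: complex_ext;
  by rewrite /= !mul0r !mulr0 subrr !addr0 expR0 mul1r.
have dlin (s : R) : is_derive s 1 (fun s => (t - s) * al) (- al).
  have h := derM (derB (der_cst s t) (is_derive_id s (1 : R))) (der_cst s al).
  by apply: der_eq h _; ring.
have dc (s : R) := @der_comp _ (fun s : R => (t - s) * al) cos s _ _ (is_derive_cos _) (dlin s).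
have ds (s : R) := @der_comp _ (fun s : R => (t - s) * al) sin s _ _ (is_derive_sin _) (dlin s).
have cl : continuous (fun s : R => (t - s) * al) := der_continuous dlin.
have cc := cts_comp (@continuous_cos R) cl; have cs := cts_comp (@continuous_sin R) cl.
pose g1 s : R := al * (- (cos ((t - s) * al) * v) - sin ((t - s) * al) * u).
pose g2 s : R := al * (cos ((t - s) * al) * u - sin ((t - s) * al) * v).
have cg1 : continuous g1.
  by apply: ctsM; [exact: ctsC|apply: ctsB; [apply: ctsN|]; apply: ctsM => //; exact: ctsC].
have cg2 : continuous g2.
  by apply: ctsM; [exact: ctsC|apply: ctsB; apply: ctsM => //; exact: ctsC].
have d1 (s : R) : is_derive s 1 (fun s => sin ((t - s) * al) * v - cos ((t - s) * al) * u) (g1 s).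
  have h := derB (derM (ds s) (der_cst s v)) (derM (dc s) (der_cst s u)).
  by apply: der_eq h _; rewrite /g1; ring.
have d2 (s : R) : is_derive s 1 (fun s => - (cos ((t - s) * al) * v + sin ((t - s) * al) * u)) (g2 s).
  have h := derN (derD (derM (dc s) (der_cst s v)) (derM (ds s) (der_cst s u))).
  by apply: der_eq h _; rewrite /g2; ring.
rewrite /Cintegral.
rewrite [X in Complex X _](_ : _ = \int[mu]_(s in `[0, t]) g1 s); last first.
  by apply: eq_Rintegral => s _; rewrite ce !cparts/= /g1 /al; ring.
rewrite [X in Complex _ X](_ : _ = \int[mu]_(s in `[0, t]) g2 s); last first.
  by apply: eq_Rintegral => s _; rewrite ce !cparts/= /g2 /al; ring.
rewrite (Rintegral_itv_FTC2 t0 cg1 d1) (Rintegral_itv_FTC2 t0 cg2 d2) ce.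
rewrite subrr subr0 !mul0r cos0 sin0.
by apply: complex_ext; rewrite !cparts/=; ring.
Qed.

Variables (c : fseries R) (s : R) (Z Zs : R -> R -> R).
Hypothesis cZ : continuous (fun p : R * R => Z p.1 p.2).
Hypothesis pZ : forall t, periodic (Z t) tau.
Hypothesis cZs : continuous (fun p : R * R => Zs p.1 p.2).
Hypothesis pZs : forall t, periodic (Zs t) tau.
Hypothesis apZ : forall t (e : R), 0 < e -> \forall K \near \oo,
  forall x, `|Z t x - tpoly (evolved_noise c 0 t) (2 ^ K) x| <= e.
Hypothesis apZs : forall t (e : R), 0 < e -> \forall K \near \oo,
  forall x, `|Zs t x - tpoly (evolved_noise c s t) (2 ^ K) x| <= e.
Hypothesis c_conj : forall n : int, c (- n) = conjc (c n).

Let cZt t : continuous (Z t) := jcont_section (t := t) cZ.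
Let cZst t : continuous (Zs t) := jcont_section (t := t) cZs.
Let LZ t : torus_L1 (Z t) := torus_L1_continuous (@cZt t) (pZ t).
Let LZs t : torus_L1 (Zs t) := torus_L1_continuous (@cZst t) (pZs t).

Let fZ t : fourier (Z t) = fun m => (1 - cexp (t%:C%C * phi m)) * c m.
Proof.
rewrite (fourier_evolved c_conj (@cZt t) (pZ t) (@apZ t)).
by apply/funext => m; rewrite /bessel /multiplier powRr0 mul1r.
Qed.

(** [Zs] is <D>^s Z as a continuous function, so sup bounds on [Zs] are W^{s,oo} bounds on Z. *)
Let fZs t : fourier (Zs t) = bessel s (fourier (Z t)).
Proof. by rewrite (fourier_evolved c_conj (@cZst t) (pZs t) (@apZs t)) fZ. Qed.

Lemma stochastic_convolution : is_stochastic_convolution c Z.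
Proof.
by move=> t t0 n; rewrite fZ -Cintegral_semigroup.
Qed.

Let besselB (f g : R -> R) : torus_L1 f -> torus_L1 g ->
  bessel s (fourier (fun x => f x - g x)) = fun n => bessel s (fourier f) n - bessel s (fourier g) n.
Proof.
by move=> Lf Lg; apply/funext => n; rewrite /bessel /multiplier (fourierB n Lf Lg) mulrBr.
Qed.

Let fZsB t t' : fourier (fun x => Zs t' x - Zs t x) = bessel s (fourier (fun x => Z t' x - Z t x)).
Proof.
by rewrite besselB//; apply/funext => n; rewrite (fourierB n (LZs t') (LZs t)) !fZs.
Qed.

(** The smooth approximations are the dyadic partial sums of Z. Applying <D>^s to them gives the
    partial sums of [Zs], which converge uniformly. *)
Lemma stochastic_convolution_W : C_W s Z.
Proof.
move=> t t0; split; last first.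
  apply: cvge0_near => [t'|e e0]; first exact: Wnorm_ge0.
  apply: cvg_within; apply: filterS (jcont_uniform_periodic t cZs pZs e0) => t' H.
  apply: (@Wnorm_le _ s _ (fun x => Zs t' x - Zs t x)) => //.
  exact: torus_L1B.
split=> //; exists (fun k => tpoly (evolved_noise c 0 t) (2 ^ k)); split.
  by move=> k; exact: torus_smooth_tpoly.
have LT (a : nat -> R[i]) K : torus_L1 (tpoly a K).
  by apply: torus_L1_continuous; [exact: continuous_tpoly|exact: tpoly_periodic].
apply: cvge0_near => [k|e e0]; first exact: Wnorm_ge0.
apply: filterS (apZs t e0) => K H.
apply: (@Wnorm_le _ s _ (fun x => tpoly (evolved_noise c s t) (2 ^ K) x - Zs t x)).
- exact: torus_L1B.
- rewrite besselB// bessel_tpoly ?expn_gt0//; last by rewrite evolved_noise0.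
  rewrite [X in _ = fun n => fourier (tpoly X _) n - _](_ : _ = evolved_noise c s t).
    by apply/funext => n; rewrite (fourierB n (LT _ _) (LZs t)) fZs.
  by apply/funext => j; rewrite /evolved_noise /bessel /multiplier powRr0 mul1r.
- by move=> x; rewrite distrC.
Qed.

(** On the torus the sup norm of [Zs] controls its L^2 norm, hence the H^s norm of Z. *)
Lemma stochastic_convolution_H : C_H s Z.
Proof.
have dom f w n : fourier w = bessel s (fourier f) ->
    Normc.normc (bessel s (fourier f) n) <= Normc.normc (fourier w n) by move=> ->.
move=> t t0; split; last first.
  apply: cvge0_near => [t'|e e0]; first exact: Hnorm_ge0.
  apply: cvg_within; apply: filterS (jcont_uniform_periodic t cZs pZs e0) => t' H.
  apply: (@Hnorm_dominated _ s _ (fun x => Zs t' x - Zs t x)) => //.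
  - exact: ctsB.
  - by move=> x; rewrite !pZs.
  - by move=> n; apply: dom; exact: fZsB.
split=> //; have [B B0 hB] := @jcont_bounded R Zs t cZs pZs.
apply: le_lt_trans (@Hnorm_dominated _ s (Z t) (Zs t) B (@cZst t) (pZs t) _ _) (ltry _).
  by move=> x; apply: hB; rewrite t0 lexx.
by move=> n; apply: dom; exact: fZs.
Qed.

End StochasticConvolution.

Lemma probability1_setI {R : realType} {d : measure_display} {Omega : measurableType d}
    (P : probability Omega R) (S T : set Omega) : measurable S -> measurable T ->
  P S = 1%E -> P T = 1%E -> P (S `&` T) = 1%E.
Proof.
move=> mS mT PS PT.
have e : P S = (P (S `\` T) + P (S `&` T))%E := measureDI P mS mT.
rewrite -PS e (_ : P (S `\` T) = 0%E) ?add0e//.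
apply/eqP; rewrite -measure_le0.
have <- : P (~` T) = 0%E by rewrite probability_setC// PT subee.
by apply: le_measure; rewrite ?inE//; [exact: measurableD|exact: measurableC].
Qed.

Theorem proposition1p7 (R : realType) :
  exists eps0 : R, 0 < eps0 /\
  forall eps : R, 0 < eps -> eps < eps0 ->
  forall (d : measure_display) (Omega : measurableType d)
    (P : probability Omega R) (g : int -> Omega -> R[i]),
    white_noise_coefficients P g ->
    exists Sigma : set Omega, measurable Sigma /\ P Sigma = 1%E /\
    forall omega, Sigma omega ->
      let zeta := white_noise g omega in
      let s := 2^-1 - eps in
      exists Z : R -> R -> R,
        C_W s Z /\ is_stochastic_convolution zeta Z /\
      exists v : R -> R -> R,
        (C_H 1 v /\ solves_remainder Z v) /\
        (forall v' : R -> R -> R, C_H 1 v' -> solves_remainder Z v' ->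
           path_equal v' v) /\
      exists u : R -> R -> R,
        (C_H s u /\ solves_SBBM zeta u /\
         path_equal u (fun t x => Z t x + v t x)) /\
        (forall u' : R -> R -> R, C_H s u' -> solves_SBBM zeta u' ->
           (exists v' : R -> R -> R, C_H 1 v' /\
              path_equal u' (fun t x => Z t x + v' t x)) ->
           path_equal u' u).
Proof.
(* For eps < 1/2 the exponent sigma = 0 satisfies sigma <= 1/2 - eps, so the block estimates also
   give Z itself as a continuous function. *)
exists 2^-1; split=> [|eps e0 e1 d Omega P g hg]; first by rewrite invr_gt0.
have s0 : 0 <= 2^-1 - eps by rewrite subr_ge0 ltW.
have s1 : 2^-1 - eps <= 1 by lra.
have [S0 [mS0 PS0 H0]] := random_blocks_bound hg e0 s0.
have [S1 [mS1 PS1 H1]] := random_blocks_bound hg e0 (lexx _).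
exists (S0 `&` S1); split; first exact: measurableI.
split; first exact: probability1_setI.
move=> w [/H0[A0 A00 B0] /H1[A1 A10 B1]] zeta s.
have conj (n : int) : zeta (- n) = conjc (zeta n) by exact: (wnc_conj hg).
have [Z [M [M0 cZ pZ Z_le apZ]]] := evolved_noise_series e0 s0 A00
  (fun k n => (B0 k).1 n) (fun k j => (B0 k).2 j).
have [Zs [_ [_ cZs pZs _ apZs]]] := evolved_noise_series e0 (lexx _) A10
  (fun k n => (B1 k).1 n) (fun k j => (B1 k).2 j).
have conv := stochastic_convolution cZ pZ apZ conj.
exists Z; split; first exact: (stochastic_convolution_W cZ pZ cZs pZs apZ apZs conj).
split=> //.
have CH := stochastic_convolution_H cZ pZ cZs pZs apZ apZs conj.
have czb : continuous (fun t : R => (`|t| + t ^+ 2) * M).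
  apply: ctsM; last exact: ctsC.
  apply: ctsD; first exact: norm_continuous.
  by apply: ctsX => x; exact: cvg_id.
apply: (BBM_well_posed cZ pZ czb _ _ _ s1 CH conv).
- by move=> t; rewrite mulr_ge0// addr_ge0// sqr_ge0.
- move=> t t' t0 tt'; have t'0 := le_trans t0 tt'.
  by rewrite ler_wpM2r// !ger0_norm// lerD// lerXn2r// nnegrE.
- by move=> t x _; exact: Z_le.
Qed.
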